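(* Suppose that at least one of Assumption (A) and Assumption (B) (stated in the context) holds. Then, given data $(\mathcal Q_0,\nu_0,\alpha,X_0)\in\mathcal S_0$ with $\alpha$ of the form $$\alpha_t[0,x]=\mathcal Q_0[0,x]+\int_0^t\mathbf 1_{\{x\ge s\}}\lambda_s\,\pi[0,x-s]\,ds,\qquad t,x\ge0,$$ there exists at most one solution $(\mathcal Q,\nu,K,R)$ to the fluid model equations (FME) with these data.
   Context: Notation. For a Polish space $S$, $\mathcal M(S)$ is the space of finite nonnegative Borel measures on $S$ with the weak topology (Prohorov metric); $\mathcal M_a(S)$ is the subset of measures of total mass at most $a$; $\mathcal M=\mathcal M(\mathbb R_+)$; $\mathcal M^0$ is the set of atomless measures. $\langle f,\mu\rangle=\int f\,d\mu$. $\mathbb D_S$ and $\mathbb C_S$ are the spaces of right-continuous functions with left limits, resp. continuous functions, $\mathbb R_+\to S$. $\mathbb D^\uparrow_{\mathbb R_+},\mathbb C^\uparrow_{\mathbb R_+}$ are the nondecreasing members of $\mathbb D_{\mathbb R_+},\mathbb C_{\mathbb R_+}$. $\mathbb D^\uparrow_{\mathcal M}$ (resp. $\mathbb C^\uparrow_{\mathcal M}$) is the set of $\zeta\in\mathbb D_{\mathcal M}$ (resp. $\mathbb C_{\mathcal M}$) with $t\mapsto\langle f,\zeta_t\rangle$ nondecreasing for every bounded continuous $f\ge0$; $\mathbb C^{\uparrow,0}_{\mathcal M}$ is the set of $\zeta\in\mathbb C^\uparrow_{\mathcal M}$ with every $\zeta_t$ atomless. For $\zeta\in\mathbb D^\uparrow_{\mathbb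 R_+}$, ''$d\zeta$-a.e.'' refers to the Lebesgue–Stieltjes measure of $\zeta$ on $\mathbb R_+$, with mass $\zeta(0)$ at $0$. $\mathbb C^1_c$ denotes continuously differentiable functions with compact support. Measure-valued Skorohod map. For $(\alpha,\mu)\in\mathbb D^\uparrow_{\mathcal M}\times\mathbb D^\uparrow_{\mathbb R_+}$ there is a unique $(\xi,\beta,\iota)\in\mathbb D_{\mathcal M}\times\mathbb D^\uparrow_{\mathcal M}\times\mathbb D^\uparrow_{\mathbb R_+}$ (a known fact) such that for each $x\ge0$: (1) $\xi_t[0,x]=\alpha_t[0,x]-\mu_t+\beta_t(x,\infty)+\iota_t$ for all $t\ge 0$; (2) $\xi_t[0,x]=0$ for $d\beta_t(x,\infty)$-a.e. $t$; (3) $\xi_t[0,\infty)=0$ for $d\iota$-a.e. $t$; (4) $\beta_t[0,\infty)+\iota_t=\mu_t$ for all $t\ge0$. Write $\xi=\Theta_1(\alpha,\mu)$. Service distribution. $G$ is a cumulative distribution function on $[0,\infty)$ with density $g$; $H^s=\sup\{x\ge0:G(x)<1\}\in(0,\infty]$; $h=g/(1-G)$ on $[0,H^s)$. Standing assumption: there is $L^s<H^s$ such that $h$ is either bounded or lower semicontinuous on $(L^s,H^s)$. Data. $\lambda:\mathbb R_+\to\mathbb R_+$ is (measurable and) locally bounded, $\pi$ is a probability measure on $\mathbb R_+$ with $\pi\{0\}=0$. $\mathcal S_0$ is the set of $(\mathcal Q_0,\nu_0,\alpha,x)\in\mathcal M^0\times\mathcal M_1([0,H^s))\times\mathbb C^{\uparrow,0}_{\mathcal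 M}\times\mathbb R_+$ with $1-\langle1,\nu_0\rangle=[1-x]^+$ and $\langle1,\nu_0\rangle+\mathcal Q_0(\mathbb R_+)=x$. FME. A quadruple $(\mathcal Q,\nu,K,R)\in\mathbb C_{\mathcal M}\times\mathbb C_{\mathcal M_1([0,H^s))}\times\mathbb C^\uparrow_{\mathbb R_+}\times\mathbb C^\uparrow_{\mathbb R_+}$ solves the FME with data $(\mathcal Q_0,\nu_0,\alpha,X_0)$ if $\mathcal Q,\nu$ have initial values $\mathcal Q_0,\nu_0$, $\int_0^t\langle h,\nu_s\rangle ds<\infty$ for all $t$, and, with $E_t=\alpha_t[0,\infty)-\alpha_0[0,\infty)$, $Q_t=\mathcal Q_t[0,\infty)$, $X_t=Q_t+\langle1,\nu_t\rangle$, $D_t=\int_0^t\langle h,\nu_s\rangle ds$, one has for all $t\ge0$: (i) for all $\varphi\in\mathbb C^1_c([0,H^s)\times\mathbb R_+)$, $\langle\varphi(\cdot,t),\nu_t\rangle=\langle\varphi(\cdot,0),\nu_0\rangle+\int_0^t\langle\varphi_x(\cdot,s)+\varphi_s(\cdot,s),\nu_s\rangle ds-\int_0^t\langle h\varphi(\cdot,s),\nu_s\rangle ds+\int_0^t\varphi(0,s)dK_s$; (ii) $Q_0+E_t=Q_t+K_t+R_t$; (iii) $Q_t=[X_t-1]^+$; (iv) $K_t=\langle1,\nu_t\rangle-\langle1,\nu_0\rangle+D_t$; (v) $\mathcal Q=\Theta_1(\alpha,K+R)$; (vi) $\mathcal Q_t[0,t)=0$; (vii) $\int_0^t[1-X_s]^+dR_s=0$;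 (viii) $\sigma_t=t$ for $dR$-a.e. $t$, where $\sigma_t=\inf\mathrm{support}(\mathcal Q_t)$. Assumption (A): (1) $g$ vanishes at most at finitely many points of $[0,H^s)$ and, with $\mathcal Z$ the set of zeros of $g$, $g$ is bounded away from zero on every compact subset of $[0,H^s)\setminus\mathcal Z$; (2) $\nu_0$ is atomless. Assumption (B): there is $\kappa_1>0$ with $\pi[0,\kappa_1]=0$. *)

(* Defs.v *)
From HB Require Import structures.
From mathcomp Require Import all_boot all_order all_algebra.
From mathcomp Require Import all_classical all_reals all_analysis.
From mathcomp Require Import giry measurable_realfun lra.

Set Implicit Arguments.
Unset Strict Implicit.
Unset Printing Implicit Defensive.

Import Order.TTheory GRing.Theory Num.Theory.
Import numFieldNormedType.Exports.

Local Open Scope classical_set_scope.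
Local Open Scope ring_scope.

(* The half-line [0, oo) is a subset of R: a path is a function R -> T of which
   only the values at times t >= 0 matter. *)
Section paths.
Context {R : realType}.

Definition Rplus : set R := `[0, +oo[.

Definition pos_part (x : R) : R := Num.max x 0.

Definition cadlag (T : topologicalType) (z : R -> T) :=
  (forall t, 0 <= t -> z s @[s --> t^'+] --> z t) /\
  (forall t, 0 < t -> exists l : T, z s @[s --> t^'-] --> l).

Definition cont_path (T : topologicalType) (z : R -> T) :=
  {within Rplus, continuous z}.

Definition nondecreasing_path (z : R -> R) :=
  forall s t, 0 <= s -> s <= t -> z s <= z t.

Definition Dup (z : R -> R) :=
  [/\ cadlag z, forall t, 0 <= t -> 0 <= z t & nondecreasing_path z].

Definition Cup (z : R -> R) :=
  [/\ cont_path z, forall t, 0 <= t -> 0 <= z t & nondecreasing_path z].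

Lemma Cup_Dup (z : R -> R) : Cup z -> Dup z.
Proof.
move=> [zc z0 znd]; split=> //.
have zr t : 0 <= t -> z s @[s --> t^'+] --> z t.
  move=> t0; have /continuous_within_itvcyP[zc' z'0] := zc.
  move: t0; rewrite le_eqVlt => /predU1P[<-//|t0].
  apply: cvg_at_right_filter; apply: zc'.
  by rewrite in_itv/= andbT.
split=> // t t0; exists (z t).
have /continuous_within_itvcyP[zc' _] := zc.
by apply: cvg_at_left_filter; apply: zc'; rewrite in_itv/= andbT.
Qed.

End paths.

Section measures.
Context {R : realType}.
Implicit Types S : set R.

(* A finite Borel measure on the (measurable) subset S of R is represented by
   its image under the inclusion of S in R. *)
Record measOn S := MeasOn {
  meas :> {finite_measure set (measurableTypeR R) -> \bar R} ;
  meas_out : meas (~` S) = 0%E }.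

HB.instance Definition _ S := gen_eqMixin (measOn S).
HB.instance Definition _ S := gen_choiceMixin (measOn S).

Definition epairing S (f : R -> R) (m : measOn S) : \bar R :=
  (\int[m]_(x in S) (f x)%:E)%E.

Definition pairing S (f : R -> R) (m : measOn S) : R :=
  \int[m]_(x in S) f x.

(* Only continuity on S is required: the test functions for the weak topology
   of measures on [0, H) need not extend continuously to H. *)
Definition test_fun S (f : R -> R) :=
  {within S, continuous f} /\ [bounded f x | x in S].

(* The coarsest topology for which all m |-> <f, m> are continuous. *)
HB.instance Definition _ S := Topological.copy (measOn S)
  (sup_topology (fun f : {f | test_fun S f} =>
    Topological.class (initial_topology (@pairing S (sval f))))).

Lemma weak_cvgP S (T : Type) (F : set_system T) {FF : Filter F}
    (z : T -> measOn S) (m : measOn S) :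
  z @ F --> m <->
  forall f, test_fun S f -> pairing f (z t) @[t --> F] --> pairing f m.
Proof.
split=> [zm f fS|zm].
  have zm' := iffLR (@cvg_sup _ _ _ _ m (fmap_filter _ _)) zm (exist _ f fS).
  move=> A Am.
  have H : (z @ F) (@pairing S f @^-1` A).
    apply: zm'; exact: (@initial_continuous _ _ (@pairing S f) m A Am).
  exact: H.
apply: (iffRL (@cvg_sup _ _ _ _ m _)) => -[f fS] A.
rewrite nbhsE => -[_ [[B oB <-] /= Bm] BA].
have FB : F ((fun t => pairing f (z t)) @^-1` B).
  by apply: zm => //; rewrite nbhsE; exists B.
apply: filterS FB => t; exact: BA.
Qed.

Definition atomless S (m : measOn S) := forall x : R, m [set x] = 0%E.

Definition increasing_meas S (z : R -> measOn S) :=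
  forall f, test_fun S f -> (forall x, S x -> 0 <= f x) ->
  nondecreasing_path (fun t => pairing f (z t)).

Definition DupM S (z : R -> measOn S) := cadlag z /\ increasing_meas z.

Definition CupM S (z : R -> measOn S) := cont_path z /\ increasing_meas z.

Definition CupM0 S (z : R -> measOn S) :=
  CupM z /\ forall t, 0 <= t -> atomless (z t).

Definition meas_support (m : set R -> \bar R) : set R :=
  [set x | forall U : set R, open U -> U x -> (0 < m U)%E].

(* +oo for the zero measure *)
Definition inf_support (m : set R -> \bar R) : \bar R :=
  ereal_inf (EFin @` meas_support m).

End measures.

Section stieltjes.
Context {R : realType}.

(* Extending by 0 to the negative half-line gives the Lebesgue-Stieltjes measure
   its mass z 0 at 0. *)
Definition zero_ext (z : R -> R) (t : R) : R := if t < 0 then 0 else z t.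

Lemma zero_ext_nondecreasing z : Dup z -> nondecreasing (zero_ext z).
Proof.
move=> [_ z0 znd] s t st; rewrite /zero_ext.
case: ltP => s0; case: ltP => t0 //; first exact: z0.
- by move: (lt_le_trans (le_lt_trans st t0) s0); rewrite ltxx.
- exact: znd.
Qed.

Lemma zero_ext_right_continuous z : Dup z -> right_continuous (zero_ext z).
Proof.
move=> [[zrc _] _ _] t; rewrite {2}/zero_ext; case: ltP => t0.
- apply: (@cvg_trans _ ((cst 0 : R -> R) s @[s --> t^'+])); last exact: cvg_cst.
  apply: near_eq_cvg; near=> s.
  by rewrite /zero_ext ifT//; near: s; exact: nbhs_right_lt.
- apply: cvg_trans (zrc _ t0); apply: near_eq_cvg; near=> s.
  rewrite /zero_ext ifF//; apply/negbTE; rewrite -leNgt (le_trans t0)// ltW//.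
Unshelve. all: by end_near. Qed.

Definition cumul_of z (zD : Dup z) : cumulative R R :=
  HB.pack (zero_ext z)
    (isCumulative.Build R _ R (zero_ext z)
       (zero_ext_nondecreasing zD) (zero_ext_right_continuous zD)).

(* The Lebesgue-Stieltjes measure of a nondecreasing cadlag path. It is only used
   for paths satisfying [Dup] (see [Cup_Dup] and [Dup_tail]), so that the second
   branch plays no role. *)
Definition stieltjes (z : R -> R) : {measure set (measurableTypeR R) -> \bar R} :=
  match pselect (Dup z) with
  | left zD => lebesgue_stieltjes_measure (cumul_of zD)
  | right _ => mzero
  end.

End stieltjes.

Section skorohod.
Context {R : realType}.
Local Open Scope ereal_scope.

Definition tail_path (z : R -> measOn (@Rplus R)) (x t : R) : R :=
  fine (z t `]x, +oo[%classic).

Local Close Scope ereal_scope.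

Lemma pairing_indic_cvg (m : measOn (@Rplus R)) (f_ : (R -> R)^nat) (B : set R) :
  measurable (B : set (measurableTypeR R)) -> B `<=` Rplus ->
  (forall n, continuous (f_ n)) -> (forall n y, 0 <= f_ n y <= 1) ->
  (forall y, Rplus y -> f_ n y @[n --> \oo] --> (\1_B y : R)) ->
  pairing (f_ n) m @[n --> \oo] --> fine (m B).
Proof.
move=> mB BR cf f01 fB; rewrite /pairing /Rintegral.
have mR : measurable (Rplus : set (measurableTypeR R)) by exact: measurable_itv.
have -> : m B = (\int[m]_(y in Rplus) (\1_B y)%:E)%E.
  by rewrite integral_indic// setIidl.
apply: fine_cvg; rewrite fineK; last first.
  by rewrite integral_indic// fin_num_measure//; exact: measurableI.
apply: (dominated_cvg mR (g := cst 1%E)) => //.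
- move=> n; apply/measurable_EFinP; apply: (@measurable_funTS _ _ _ _ Rplus).
  exact: continuous_measurable_fun.
- move=> y yR; apply: cvg_EFin; first exact: nearW.
  exact: fB.
- apply/integrableP; split; first exact: measurable_cst.
  under eq_integral do rewrite /= normr1.
  by rewrite integral_cst// mul1e ltey_eq fin_num_measure.
- move=> n y _; rewrite /= lee_fin ger0_norm; by have /andP[] := f01 n y.
Qed.

Lemma Dup_tail (beta : R -> measOn (@Rplus R)) (x : R) :
  0 <= x -> DupM beta -> Dup (tail_path beta x).
Proof.
move=> x0 [[brc bll] binc].
pose ramp (n : nat) (y : R) : R := Num.min 1 (n%:R * Num.max (y - x) 0).
have ramp_cont n : continuous (ramp n).
  move=> y; apply: (@continuous_min _ _ (cst 1)
    (fun z : R => n%:R * Num.max (z - x) 0)); first exact: cvg_cst.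
  apply: cvgM; first exact: cvg_cst.
  apply: (@continuous_max _ _ (fun z : R => z - x) (cst 0)); last exact: cvg_cst.
  by apply: cvgB; [exact: cvg_id|exact: cvg_cst].
have ramp01 n y : 0 <= ramp n y <= 1.
  rewrite /ramp ge_min lexx andbT le_min ler01/= mulr_ge0//.
  by rewrite le_max lexx orbT.
have rampE y : ramp n y @[n --> \oo] --> (\1_`]x, +oo[ y : R).
  rewrite indicE; case: (leP y x) => yx.
    rewrite memNset /=; last by rewrite in_itv/= andbT ltNge yx.
    rewrite (_ : (fun n => ramp n y) = cst 0); first exact: cvg_cst.
    by apply/funext => n; rewrite /ramp max_r ?subr_le0// mulr0 min_r.
  rewrite mem_set /=; last by rewrite in_itv/= andbT.
  apply: (@cvg_trans _ ((cst 1 : nat -> R) n @[n --> \oo])); last exact: cvg_cst.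
  apply: near_eq_cvg; near=> n.
  rewrite /ramp/= max_l ?subr_ge0 ?ltW// min_l// -ler_pdivrMr ?subr_gt0//.
  by near: n; exact: nbhs_infty_ger.
have bnd (f : R -> R) : continuous f -> (forall y, 0 <= f y <= 1) -> test_fun Rplus f.
  move=> cf f01; split; first exact: continuous_subspaceT.
  exists 1; split => // M M1 y _ /=.
  by have /andP[f0 f1] := f01 y; rewrite ger0_norm// (le_trans f1)// ltW.
have incr (B : set R) (f_ : (R -> R)^nat) :
  measurable (B : set (measurableTypeR R)) -> B `<=` Rplus ->
  (forall n, continuous (f_ n)) -> (forall n y, 0 <= f_ n y <= 1) ->
  (forall y, Rplus y -> f_ n y @[n --> \oo] --> (\1_B y : R)) ->
  nondecreasing_path (fun t => fine (beta t B)).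
  move=> mB BR cf f01 fB s t s0 st.
  have cs := pairing_indic_cvg (m := beta s) mB BR cf f01 fB.
  have ct := pairing_indic_cvg (m := beta t) mB BR cf f01 fB.
  rewrite -(cvg_lim _ cs)// -(cvg_lim _ ct)//; apply: ler_lim.
  - by apply/cvg_ex; eexists; exact: cs.
  - by apply/cvg_ex; eexists; exact: ct.
  - apply: nearW => n; apply: binc => //; first exact: bnd.
    by move=> y _; have /andP[] := f01 n y.
have subR (B : set R) : B `<=` Rplus -> B `<=` Rplus by [].
have znd : nondecreasing_path (tail_path beta x).
  apply: (incr _ ramp) => //.
  by move=> y /=; rewrite /Rplus/= !in_itv/= !andbT => /ltW; exact: le_trans.
have cnd : nondecreasing_path (fun t => fine (beta t `[0, x]%classic)).
  apply: (incr _ (fun n y => 1 - ramp n y)) => //.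
  - by move=> y /=; rewrite /Rplus/= !in_itv/= andbT => /andP[].
  - by move=> n y; apply: cvgB; [exact: cvg_cst|exact: ramp_cont].
  - move=> n y; have /andP[r0 r1] := ramp01 n y.
    by rewrite subr_ge0 r1/= gerBl.
  - move=> y y0; rewrite [X in _ --> X](_ : _ = 1 - \1_`]x, +oo[ y).
      by apply: cvgB; [exact: cvg_cst|exact: rampE].
    have y0' : 0 <= y by move: y0; rewrite /Rplus/= in_itv/= andbT.
    rewrite !indicE; case: (leP y x) => yx.
      rewrite mem_set/= ?in_itv/= ?y0'// memNset ?subr0//=.
      by rewrite in_itv/= andbT ltNge yx.
    rewrite memNset/= ?in_itv/= ?y0' ?leNgt ?yx// mem_set ?subrr//=.
    by rewrite in_itv/= andbT.
have totE t : fine (beta t `[0, x]%classic) + tail_path beta x t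
              = pairing (cst 1) (beta t).
  rewrite /tail_path -fineD ?fin_num_measure// /pairing /Rintegral; congr fine.
  rewrite [RHS](integral_cst (beta t) (measurable_itv _) 1) mul1e.
  rewrite -measureU//.
  - congr (beta t _); apply/seteqP; split=> y; rewrite /Rplus/= !in_itv/= !andbT.
    + by case=> [/andP[]//|/ltW]; exact: le_trans.
    + by move=> ->; case: (leP y x); [left|right].
  - by apply/seteqP; split=> y //=; rewrite !in_itv/= andbT => -[/andP[_]]; case: leP.
have one_test : test_fun Rplus (cst 1 : R -> R).
  by apply: bnd => [y|y]; [exact: cvg_cst|rewrite ler01 lexx].
have zr t : 0 <= t -> tail_path beta x s @[s --> t^'+] --> tail_path beta x t.
  move=> t0; have tot := iffLR (weak_cvgP _ _) (brc t t0) _ one_test.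
  pose hi s := tail_path beta x t
    + (pairing (cst 1) (beta s) - pairing (cst 1) (beta t)).
  have sq : \forall s \near t^'+,
      (cst (tail_path beta x t) : R -> R) s <= tail_path beta x s <= hi s.
    near=> s; have ts : t <= s by apply: ltW; near: s; exact: nbhs_right_gt.
    rewrite /= znd//= /hi -!totE; have /= := cnd _ _ t0 ts; lra.
  apply: (squeeze_cvgr sq); first exact: cvg_cst.
  rewrite /hi -[X in _ --> X]addr0; apply: cvgD; first exact: cvg_cst.
  rewrite -(subrr (pairing (cst 1) (beta t))); apply: cvgB; [exact: tot|exact: cvg_cst].
split=> //; last by move=> t _; exact: fine_ge0.
split=> // t t0; apply/cvg_ex.
apply: nondecreasing_at_left_is_cvgr; apply: filterS (nbhs_left_gt t0) => u u0.
- move=> r s; rewrite !in_itv/= => /andP[ur _] _ rs; apply: znd => //.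
  exact: le_trans (ltW u0) (ltW ur).
- exists (tail_path beta x t) => z [r /=]; rewrite in_itv/= => /andP[ur rt] <-.
  by apply: znd; [exact: le_trans (ltW u0) (ltW ur)|exact: ltW].
Unshelve. all: by end_near. Qed.
Local Open Scope ereal_scope.

(* xi = Theta_1(alpha, mu), where (xi, beta, iota) is uniquely determined by
   (alpha, mu). *)
Definition skorohod_map1 (alpha : R -> measOn (@Rplus R)) (mu : R -> R)
    (xi : R -> measOn (@Rplus R)) :=
  cadlag xi /\
  exists (beta : R -> measOn (@Rplus R)) (iota : R -> R),
    [/\ DupM beta, Dup iota &
    forall x : R, (0 <= x)%R ->
      [/\ forall t : R, (0 <= t)%R ->
            xi t `[0%R, x]%classic = alpha t `[0%R, x]%classic - (mu t)%:E
                             + beta t `]x, +oo[%classic + (iota t)%:E,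
          {ae stieltjes (tail_path beta x), forall t,
             (0 <= t)%R -> xi t `[0%R, x]%classic = 0},
          {ae stieltjes iota, forall t,
             (0 <= t)%R -> xi t `[0%R, +oo[%classic = 0} &
          forall t : R, (0 <= t)%R ->
            beta t `[0%R, +oo[%classic + (iota t)%:E = (mu t)%:E]].

End skorohod.

Section service.
Context {R : realType}.
Implicit Types G g : R -> R.

Definition service_cdf G g :=
  [/\ measurable_fun (Rplus : set (measurableTypeR R)) g,
      forall x, 0 <= x -> 0 <= g x,
      forall x, 0 <= x -> (G x)%:E = (\int[lebesgue_measure]_(y in `[0%R, x]) (g y)%:E)%E &
      G x @[x --> +oo] --> (1 : R)].

Definition Hs G : \bar R := ereal_sup [set x%:E | x in [set x | 0 <= x /\ G x < 1]].

Definition hazard G g (x : R) : R := g x / (1 - G x).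

(* [0, H^s) *)
Definition ages G : set R := [set x | 0 <= x /\ (x%:E < Hs G)%E].

(* In the subspace topology the points outside the interval are isolated, so
   that semicontinuity is only required on the interval. *)
Definition hazard_regular G g :=
  exists L : R, [/\ 0 <= L, (L%:E < Hs G)%E &
    let I := [set x : R | (L%:E < x%:E < Hs G)%E] in
    [bounded hazard G g x | x in I] \/
    lower_semicontinuous ((fun x => (hazard G g x)%:E) : subspace I -> \bar R)].

Definition assumptionA G g (nu0 : measOn (ages G)) :=
  let Z := [set x | ages G x /\ g x = 0] in
  [/\ finite_set Z,
      forall C : set R, compact C -> C `<=` ages G `\` Z ->
        exists2 e : R, 0 < e & forall x, C x -> e <= g x &
      atomless nu0].

Definition assumptionB (pi : set R -> \bar R) :=
  exists2 k : R, 0 < k & pi `[0, k]%classic = 0%E.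

End service.

Section data.
Context {R : realType}.

Definition arrival_rate (lambda : R -> R) :=
  [/\ measurable_fun (Rplus : set (measurableTypeR R)) lambda,
      forall t, 0 <= t -> 0 <= lambda t &
      forall T, 0 <= T -> [bounded lambda t | t in `[0, T]%classic]].

Definition patience_law (pi : probability (measurableTypeR R) R) :=
  pi `[0, +oo[%classic = 1%E /\ pi [set 0] = 0%E.

Definition initial_data (G : R -> R) (Q0 : measOn (@Rplus R))
    (nu0 : measOn (ages G)) (alpha : R -> measOn (@Rplus R)) (x : R) :=
  [/\ atomless Q0, (nu0 setT <= 1)%E, CupM0 alpha & 0 <= x] /\
  1 - pairing (cst 1) nu0 = pos_part (1 - x) /\
  pairing (cst 1) nu0 + fine (Q0 `[0, +oo[%classic) = x.

Definition arrival_process (Q0 : measOn (@Rplus R)) (lambda : R -> R)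
    (pi : set R -> \bar R) (alpha : R -> measOn (@Rplus R)) :=
  forall t x, 0 <= t -> 0 <= x ->
    (alpha t `[0%R, x]%classic = Q0 `[0%R, x]%classic +
      \int[lebesgue_measure]_(s in `[0%R, t])
        (((s <= x)%R%:R * lambda s)%:E * pi `[0%R, (x - s)%R]%classic))%E.

End data.

Section fluid_model.
Context {R : realType}.

(* f has derivative l at x along A (one-sided at a boundary point of A) *)
Definition derives_within (A : set R) (f : R -> R) (x l : R) :=
  (f y - f x) / (y - x) @[y --> within A x^'] --> l.

(* phi is C^1 with compact support on D = A x [0, oo), up to the boundary, with
   partial derivatives phix and phis; the support is the closure in D. *)
Definition C1c (A : set R) (phi phix phis : R * R -> R) :=
  let D := A `*` Rplus in
  [/\ forall x s, D (x, s) ->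
        derives_within A (fun y => phi (y, s)) x (phix (x, s)) /\
        derives_within Rplus (fun r => phi (x, r)) s (phis (x, s)),
      {within D, continuous phi},
      {within D, continuous phix},
      {within D, continuous phis} &
      compact (D `&` closure [set p | D p /\ phi p != 0])].

Variables (G g : R -> R).
Variables (Q : R -> measOn (@Rplus R)) (nu : R -> measOn (ages G)).
Variables (K Ren : R -> R).

Definition total_queue t : R := fine (Q t `[0, +oo[%classic).

Definition total_mass t : R := total_queue t + pairing (cst 1) (nu t).

Definition departures t : \bar R :=
  (\int[lebesgue_measure]_(s in `[0%R, t]) epairing (hazard G g) (nu s))%E.

Definition arrivals (alpha : R -> measOn (@Rplus R)) t : R :=
  fine (alpha t `[0, +oo[%classic) - fine (alpha 0 `[0, +oo[%classic).

Definition FME (Q0 : measOn (@Rplus R)) (nu0 : measOn (ages G))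
    (alpha : R -> measOn (@Rplus R)) :=
  let h := hazard G g in
  let X := total_mass in
  [/\ cont_path Q,
      cont_path nu /\ (forall t, 0 <= t -> (nu t setT <= 1)%E),
      Cup K & Cup Ren] /\
  [/\ measure_eq (Q 0) Q0, measure_eq (nu 0) nu0 &
      forall t, 0 <= t -> (departures t < +oo)%E] /\
  forall t, 0 <= t ->
  [/\ forall phi phix phis, C1c (ages G) phi phix phis ->
        pairing (fun x => phi (x, t)) (nu t) =
        pairing (fun x => phi (x, 0)) nu0
        + \int[lebesgue_measure]_(s in `[0, t])
            pairing (fun x => phix (x, s) + phis (x, s)) (nu s)
        - \int[lebesgue_measure]_(s in `[0, t])
            pairing (fun x => h x * phi (x, s)) (nu s)
        + \int[stieltjes K]_(s in `[0, t]) phi (0, s),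
      total_queue 0 + arrivals alpha t = total_queue t + K t + Ren t,
      total_queue t = pos_part (X t - 1) &
      K t = pairing (cst 1) (nu t) - pairing (cst 1) nu0 + fine (departures t)] /\
  [/\ Q t `[0, t[%classic = 0%E &
      (\int[stieltjes Ren]_(s in `[0%R, t]) (pos_part (1 - X s)%R)%:E = 0)%E] /\
  skorohod_map1 alpha (fun s => K s + Ren s) Q /\
  {ae stieltjes Ren, forall s, 0 <= s -> inf_support (Q s) = s%:E}.

End fluid_model.

(* Main.v *)
(* Let W = 1/(1 - G), so that W' = h W. Tested against W(x) F(x - s), the age
   equation loses its departure term and becomes a pure translation:
     int_[0, c[ W dnu_t = int_[0, c - t[ W dnu0 + K_t - K_{(t - c)^+}.
   Hence nu is determined by K, and if the entry processes of two solutions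
   agree up to time u, the difference DB of the busy masses satisfies
   |DB - DK| <= G(e) sup |DK| on [u, u + e]: as soon as DK and DB have opposite
   signs this forces DK = 0.

   For each x the mass Q_t[0, x] is a one-dimensional reflection of
   alpha_t[0, x] - K_t - R_t. By (A) or (B), while a queue is present just after
   u, entries into service outpace the arrivals with deadline before u + e, so
   that this driving path is nonincreasing. If the queue is empty at u, then no
   mass with such a deadline ever waits on the window, no reneging occurs, and
   DQ = - DK has the sign of DB. If the queue is nonempty at u, then DB = 0, so
   DK = 0; and if R1 exceeded R2, mass of Q1 would renege at some time r, which
   would leave mass of Q2 exactly at the deadline r, although alpha_r is
   atomless. Thus the solutions agree slightly beyond any time up to which they
   agree. *)
Require Import Defs.
From HB Require Import structures.
From mathcomp Require Import all_boot all_order all_algebra.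
From mathcomp Require Import all_classical all_reals all_analysis.
From mathcomp Require Import giry measurable_realfun kernel ring lra.
Set Implicit Arguments.
Unset Strict Implicit.
Unset Printing Implicit Defensive.
Import Order.TTheory GRing.Theory Num.Theory.
Import numFieldNormedType.Exports.
Local Open Scope classical_set_scope.
Local Open Scope ring_scope.

(** * Paths and Lebesgue-Stieltjes measures *)

Section stieltjes_paths.
Context {R : realType}.
Implicit Types (z : R -> R) (s t : R).

(** The function [W] is no admissible test function: [g] is only measurable, so [W] need not be C^1.
    It is replaced by a C^1 function [P], uniformly close to [W] on [0, M], with [P'] close to [h W]
    in L^1 of Lebesgue measure. The error this leaves in the time integrals is measured by the
    occupation measure of [nu] over [0, t]. The age equation itself, tested with a function of age
    alone whose derivative is at least the indicator of [p, q], bounds this measure by (1 + K_t)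
    times Lebesgue measure on compact sets of ages.

    The factor G(e) comes from recovering masses from the weighted masses w(y) = int_[0, y[ W dm
    through m[0, c[ = (1 - G(c)) w(c) + int_0^c g w. For two solutions the values of w differ at age
    y by DK_t - DK_{(t - y)^+}, which is DK_t once y >= e; what remains of DB - DK is an integral of
    g DK_{(t - y)^+} over [0, e].

    The driving paths of the reflections are known to be nonincreasing only while the queue is
    positive, so the path arguments start from the last time at which some continuous path is
    nonpositive. *)

Lemma lebesgue_stieltjes_itvoc (f : cumulative R R) a b : a <= b ->
  lebesgue_stieltjes_measure f `]a, b]%classic = (f b - f a)%:E.
Proof.
move=> ab; rewrite /lebesgue_stieltjes_measure /measure_extension/=.
by rewrite measurable_mu_extE/= ?wlength_itv_bnd//; exact: is_ocitv.
Qed.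

Lemma stieltjesE z (zD : Dup z) :
  stieltjes z = lebesgue_stieltjes_measure (cumul_of zD).
Proof.
rewrite /stieltjes; case: pselect => // zD'.
by rewrite (Prop_irrelevance zD zD').
Qed.

Lemma stieltjes_itvoc z s t : Dup z -> 0 <= s -> s <= t ->
  stieltjes z `]s, t]%classic = (z t - z s)%:E.
Proof.
move=> zD s0 st; rewrite (stieltjesE zD).
have := lebesgue_stieltjes_itvoc (cumul_of zD) st; rewrite /= /zero_ext.
by rewrite !ltNge s0 (le_trans s0 st).
Qed.

Lemma stieltjes_itv0c z a t : Dup z -> a < 0 -> 0 <= t ->
  stieltjes z `]a, t]%classic = (z t)%:E.
Proof.
move=> zD a0 t0; rewrite (stieltjesE zD).
have := lebesgue_stieltjes_itvoc (cumul_of zD) (ltW (lt_le_trans a0 t0)); rewrite /= /zero_ext.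
by rewrite a0 ltNge t0/= subr0.
Qed.

Lemma stieltjes_ninfty0 z : Dup z -> stieltjes z `]-oo, 0[%classic = 0%E.
Proof.
move=> zD.
have -> : `]-oo, (0:R)[%classic =
    \bigcup_n `](- n.+1%:R : R), - n.+1%:R^-1]%classic.
  apply/seteqP; split => [x/=|x [n _]/=]; rewrite !in_itv/=; last first.
    by move=> /andP[_ /le_lt_trans]; apply; rewrite oppr_lt0 invr_gt0.
  move=> x0; have x0' : 0 < - x by rewrite oppr_gt0.
  (* One [n] bounds both [|x|] and its inverse, which places [x] between the two ends of the n-th
     interval. *)
  have [n nx] : exists n, `|x| + `|x|^-1 < n.+1%:R.
    by exists (Num.truncn (`|x| + `|x|^-1)); exact: truncnS_gt.
  exists n => //=; rewrite in_itv/=; apply/andP; split.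
    rewrite ltrNl; apply: le_lt_trans nx.
    by rewrite ltr0_norm// lerDl invr_ge0 ltW.
  rewrite lerNr -[leRHS]invrK lef_pV2 ?posrE ?invr_gt0//.
  apply/ltW/(le_lt_trans _ nx); rewrite ltr0_norm// lerDr ltW//.
apply/eqP; rewrite -measure_le0.
apply: (le_trans (measure_sigma_subadditive _ _ _ (@subset_refl _ _))) => //.
  by apply: bigcup_measurable => n _; exact: measurable_itv.
rewrite eseries0// => n _ _ /=.
rewrite (stieltjesE zD).
have [ab|ba] := leP (- n.+1%:R : R) (- n.+1%:R^-1); last first.
  by rewrite set_itv_ge ?measure0// bnd_simp -leNgt ltW.
apply: etrans (lebesgue_stieltjes_itvoc _ ab) _.
by rewrite /= /zero_ext !oppr_lt0 invr_gt0 ltr0n subrr.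
Qed.

Lemma stieltjes_itvcc z t : Dup z -> 0 <= t ->
  stieltjes z `[0, t]%classic = (z t)%:E.
Proof.
move=> zD t0.
rewrite -(stieltjes_itv0c zD (ltrN10 _) t0).
rewrite (@itv_bndbnd_setU _ _ (BRight (-1)) (BLeft 0) (BRight t)) ?bnd_simp ?t0 //.
rewrite measureU//; last first.
  apply/seteqP; split=> x //=; rewrite !in_itv/= => -[/andP[_ x0] /andP[x0' _]].
  by move: x0; rewrite ltNge x0'.
rewrite [X in _ = (X + _)%E](_ : _ = 0%E) ?add0e//.
apply/eqP; rewrite -measure_le0 -(stieltjes_ninfty0 zD) le_measure// ?inE//.
by move=> x /=; rewrite !in_itv/= => /andP[].
Qed.

(** The interval ]s, t] lies in the exceptional null set, and its mass is the increment of [z]. This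
    turns a complementarity condition into flatness. *)
Lemma stieltjes_ae_const z (P : R -> Prop) s t : Dup z ->
  {ae stieltjes z, forall r, P r} -> 0 <= s -> s <= t ->
  (forall r, s < r <= t -> ~ P r) -> z s = z t.
Proof.
move=> zD [N [mN N0 PN]] s0 st nP.
have : stieltjes z `]s, t]%classic = 0%E.
  apply/eqP; rewrite -measure_le0 -N0 le_measure ?inE//.
  by move=> r /=; rewrite in_itv/= => /nP nPr; exact: PN.
by rewrite stieltjes_itvoc// => -[] /eqP; rewrite subr_eq0 => /eqP.
Qed.

(** A time at which [P] fails carries no atom, and the atom of the measure at [t] is the left jump
    of [z]. *)
Lemma stieltjes_ae_left_cont z (P : R -> Prop) t : Dup z ->
  {ae stieltjes z, forall r, P r} -> 0 < t -> ~ P t ->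
  z s @[s --> t^'-] --> z t.
Proof.
move=> zD [N [mN N0 PN]] t0 nP.
have zt0 : stieltjes z [set t] = 0%E.
  apply/eqP; rewrite -measure_le0 -N0 le_measure ?inE//.
  by move=> r /= ->; exact: PN.
have [_ z0 znd] := zD.
(* The step t / (n + 1) keeps the left ends nonnegative, where the mass is an increment of [z]. *)
pose F (n : nat) : set R := `]t - t / n.+1%:R, t]%classic.
have F0 n : 0 <= t - t / n.+1%:R by rewrite subr_ge0 ler_pdivrMr// ler_peMr ?ler1n// ltW.
have Ft n : t - t / n.+1%:R < t by rewrite ltrBlDr ltrDl divr_gt0.
have capF : \bigcap_n F n = [set t].
  apply/seteqP; split=> [r rF|_ -> n _]; last by rewrite /F/= in_itv/= Ft lexx.
  apply/eqP; rewrite eq_le; have := rF 0%N I; rewrite /F/= in_itv/= => /andP[_ ->]/=.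
  rewrite leNgt; apply/negP => rt.
  have [n nt] : exists n, t / (t - r) < n.+1%:R.
    by exists (Num.truncn (t / (t - r))); exact: truncnS_gt.
  have := rF n I; rewrite /F/= in_itv/= => /andP[+ _].
  move: nt; rewrite ltr_pdivrMr ?subr_gt0// mulrC -ltr_pdivrMr// => tn.
  by rewrite ltrBlDr -ltrBlDl ltNge (ltW tn).
have zFE n : stieltjes z (F n) = (z t - z (t - t / n.+1%:R))%:E.
  by rewrite stieltjes_itvoc// ltW.
have zF : stieltjes z (F n) @[n --> \oo] --> 0%E.
  rewrite -zt0 -capF; apply: nonincreasing_cvg_mu.
  - by rewrite zFE ltry.
  - by move=> n; exact: measurable_itv.
  - by rewrite capF.
  - move=> m n mn; apply/subsetPset => r; rewrite /F/= !in_itv/= => /andP[+ ->].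
    rewrite andbT; apply: le_lt_trans; rewrite lerD2l lerN2 ler_pM2l//.
    by rewrite lef_pV2 ?posrE// ler_nat.
apply/cvgrPdist_lt => e e0.
have [n _ /(_ n (leqnn n))/= ne] : \forall n \near \oo, z t - z (t - t / n.+1%:R) < e.
  have /fine_cvgP[_ zF0] := zF.
  apply: cvgr_lt e0; apply: cvg_trans zF0; apply: near_eq_cvg.
  by near=> n; rewrite /= zFE.
near=> s.
have ns : t - t / n.+1%:R < s by near: s; exact: nbhs_left_gt.
have st : s < t by near: s; exact: nbhs_left_lt.
have s0 := le_trans (F0 n) (ltW ns).
rewrite ger0_norm ?subr_ge0 ?znd ?(ltW st)//.
by apply: le_lt_trans ne; rewrite lerD2l lerN2 znd// ltW.
Unshelve. all: by end_near. Qed.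

End stieltjes_paths.

(** * One-dimensional reflection *)

Section paths_on_half_line.
Context {R : realType}.
Implicit Types (f z psi y eta : R -> R) (s t r a b : R).

Lemma cont_path_ltP f : cont_path f -> forall t e, 0 <= t -> 0 < e ->
  exists2 d, 0 < d & forall s, 0 <= s -> `|t - s| < d -> `|f t - f s| < e.
Proof.
move=> fc t e t0 e0.
have Rt : Rplus t by rewrite /Rplus/= in_itv/= t0.
have := (iffLR (subspace_continuousP _ _) fc) t Rt.
move=> /cvgrPdist_lt/(_ e e0).
rewrite near_withinE => /nbhs_ballP[d /= d0 H].
exists d => // s s0 ts; apply: H; first by rewrite /ball/= .
by rewrite /Rplus/= in_itv/= s0.
Qed.

Lemma cont_path_left_right f :
  (forall t, 0 <= t -> f s @[s --> t^'+] --> f t) ->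
  (forall t, 0 < t -> f s @[s --> t^'-] --> f t) -> cont_path f.
Proof.
move=> fr fl; apply/continuous_within_itvcyP; split; last exact: fr.
move=> t; rewrite in_itv/= andbT => t0.
by apply/left_right_continuousP; split; [exact: fl|exact/fr/ltW].
Qed.

Lemma cont_pathB f g : cont_path f -> cont_path g -> cont_path (f \- g).
Proof. by move=> fc gc t; apply: cvgB; [exact: fc|exact: gc]. Qed.

Lemma cont_pathD f g : cont_path f -> cont_path g -> cont_path (f \+ g).
Proof. by move=> fc gc t; apply: cvgD; [exact: fc|exact: gc]. Qed.

(** The time is the supremum of the nonpositivity set of [f] in [a, b], which is closed by
    continuity. What follows it is an interval on which [f] is positive, to which flatness of a
    regulator can be applied. *)
Lemma last_nonpos_time f a b : cont_path f -> 0 <= a -> a <= b -> f a <= 0 ->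
  exists s, [/\ a <= s, s <= b, f s <= 0 & forall r, s < r -> r <= b -> 0 < f r].
Proof.
move=> fc a0 ab fa.
pose S := [set r | a <= r <= b /\ f r <= 0].
have Sa : S a by rewrite /S/= lexx ab.
have hS : has_sup S by split; [exists a|exists b => r [/andP[]]].
have aS : a <= sup S by apply: ub_le_sup => //; case: hS.
have Sb : sup S <= b by apply: ge_sup; [exists a|move=> r [/andP[]]].
exists (sup S); split=> //.
- rewrite leNgt; apply/negP => fS.
  have [d d0 dP] := cont_path_ltP fc (le_trans a0 aS) fS.
  have [r [/andP[ar rb] fr] dr] := sup_adherent d0 hS.
  have rS : r <= sup S.
    by apply: ub_le_sup; [case: hS|split; rewrite ?ar].
  have := dP r (le_trans a0 ar); rewrite ger0_norm ?subr_ge0//.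
  rewrite ltrBlDr addrC -ltrBlDr => /(_ dr) /ltr_normlW; lra.
- move=> r Sr rb; rewrite ltNge; apply/negP => fr.
  have := Sr; rewrite ltNge => /negP; apply; apply: ub_le_sup; first by case: hS.
  by split=> //; rewrite rb andbT (le_trans aS (ltW Sr)).
Qed.

(** The last clause is the complementarity condition without measures: [eta] is flat as long as [y]
    is positive on ]s, t]. The left end is excluded so that [s] may be a zero of [y]. *)
Definition reflection psi y eta :=
  [/\ forall t, 0 <= t -> y t = psi t + eta t,
      forall t, 0 <= t -> 0 <= y t,
      nondecreasing_path eta,
      cont_path eta &
      forall s t, 0 <= s -> s <= t -> (forall r, s < r -> r <= t -> 0 < y r) ->
        eta t = eta s].

Lemma reflection_cont psi y eta : cont_path psi -> reflection psi y eta ->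
  cont_path y.
Proof.
move=> pc [yE _ _ ec _].
have : cont_path (psi \+ eta) by exact: cont_pathD.
apply: subspace_eq_continuous => t.
by rewrite inE /Rplus/= in_itv/= andbT => t0; exact/esym/yE.
Qed.

(** After the last time [s] at which eta1 <= eta2, one has y1 > y2 >= 0, so [eta1] stays flat while
    [eta2] does not decrease; hence [eta1] never gets above [eta2]. The other inequality is
    symmetric. *)
Lemma reflection_unique psi1 psi2 y1 y2 eta1 eta2 u :
  reflection psi1 y1 eta1 -> reflection psi2 y2 eta2 -> eta1 0 = eta2 0 ->
  (forall t, 0 <= t -> t <= u -> psi1 t = psi2 t) ->
  forall t, 0 <= t -> t <= u -> eta1 t = eta2 t.
Proof.
wlog suff : psi1 psi2 y1 y2 eta1 eta2 / reflection psi1 y1 eta1 ->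
    reflection psi2 y2 eta2 -> eta1 0 = eta2 0 ->
    (forall t, 0 <= t -> t <= u -> psi1 t = psi2 t) ->
    forall t, 0 <= t -> t <= u -> eta1 t <= eta2 t.
  move=> H r1 r2 e0 p t t0 tu; apply/eqP; rewrite eq_le.
  rewrite (H _ _ _ _ _ _ r1 r2 e0 p)//=.
  by apply: (H _ _ _ _ _ _ r2 r1) => // s s0 su; rewrite p.
move=> [y1E y10 nd1 c1 f1] [y2E y20 nd2 c2 f2] e0 p t t0 tu.
rewrite leNgt; apply/negP => lt21.
have [] := @last_nonpos_time (eta1 \- eta2) 0 t (cont_pathB c1 c2).
- by [].
- by [].
- by rewrite /= e0 subrr.
move=> s [s0 st /=]; rewrite subr_le0 => es pos.
have : eta1 t = eta1 s.
  apply: f1 => // r sr rt; have r0 : 0 <= r by exact: le_trans (ltW sr).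
  rewrite y1E// p ?(le_trans rt)//; have := y20 _ r0; rewrite y2E//.
  by have := pos _ sr rt; lra.
by have := nd2 _ _ s0 st; lra.
Qed.

(** If [y] is positive on ]a, b], the regulator is flat and [y] moves with [psi]. Otherwise the same
    holds from the last zero of [y] on, and since [psi] decreases from there, [y b] is at most 0. *)
Lemma reflection_le psi y eta a b : cont_path psi -> reflection psi y eta ->
  0 <= a -> a <= b ->
  (forall s r, a <= s -> s <= r -> r <= b -> psi r <= psi s) ->
  y b <= pos_part (y a + (psi b - psi a)).
Proof.
move=> pc yr a0 ab psid; have [yE y0 nd c f] := yr.
rewrite /pos_part le_max; have [ypos|] := pselect (forall r, a < r -> r <= b -> 0 < y r).
  apply/orP; left; have := f _ _ a0 ab ypos.
  by rewrite (yE a)// (yE b) ?(le_trans a0)//; lra.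
move=> /existsNP[c0 /not_implyP[ac /not_implyP[cb /negP]]]; rewrite -leNgt => yc.
have c00 : 0 <= c0 by exact: le_trans (ltW ac).
have [s [cs sb ys pos]] := last_nonpos_time (reflection_cont pc yr) c00 cb yc.
have s0 := le_trans c00 cs.
apply/orP; right; have := f _ _ s0 sb pos.
move: ys; rewrite (yE b) ?(le_trans a0)// (yE s)//.
by have := psid s b (le_trans (ltW ac) cs) sb (lexx _); lra.
Qed.

Lemma reflection_ge psi y eta a b : reflection psi y eta ->
  0 <= a -> a <= b -> y a + (psi b - psi a) <= y b.
Proof.
move=> [yE _ nd _ _] a0 ab; rewrite (yE a)// (yE b) ?(le_trans a0)//.
by have := nd _ _ a0 ab; lra.
Qed.

End paths_on_half_line.

(** * One-dimensional reflections inside the measure-valued Skorohod map *)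

Section skorohod_facts.
Context {R : realType}.
Implicit Types (alpha xi : R -> measOn (@Rplus R)) (mu : R -> R) (x t : R).

Definition mass_upto alpha x t : R := fine (alpha t `[0, x]%classic).

Lemma measOn_itvE (S : set R) (m : measOn S) (i : interval R) :
  m [set` i] = (fine (m [set` i]))%:E.
Proof. by rewrite fineK// fin_num_measure//; exact: measurable_itv. Qed.

(** The regulator is the mass of [beta] beyond [x] plus [iota]: where xi[0, x] > 0 both
    complementarity conditions fail, so neither summand increases. The point to prove is left
    continuity, because [beta] and [iota] are only cadlag. At times with xi[0, x] > 0 it follows
    from the absence of atoms. *)
Lemma skorohod_reflection alpha mu xi : skorohod_map1 alpha mu xi ->
  cont_path mu -> mu 0 = 0 ->
  forall x, 0 <= x -> cont_path (mass_upto alpha x) ->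
  exists eta, reflection (mass_upto alpha x \- mu) (mass_upto xi x) eta /\
    eta 0 = 0.
Proof.
move=> [_ [beta [iota [bD iD H]]]] muc mu0 x x0 ac.
have [xiE aeb aei tot] := H x x0.
have tD := Dup_tail x0 bD.
pose eta := tail_path beta x \+ iota; exists eta.
have yE t : 0 <= t -> mass_upto xi x t = mass_upto alpha x t - mu t + eta t.
  move=> t0; rewrite /mass_upto xiE// /eta/= /tail_path.
  by rewrite (measOn_itvE (alpha t)) (measOn_itvE (beta t))/= addrA.
have y0 t : 0 <= t -> 0 <= mass_upto xi x t by move=> _; rewrite fine_ge0.
have [tl tp tn] := tD; have [il ip inn] := iD.
have nd : nondecreasing_path eta.
  by move=> s t s0 st; rewrite /eta/= lerD ?tn ?inn.
have npos t : 0 <= t -> 0 < mass_upto xi x t ->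
    ~ (0 <= t -> xi t `[0, x]%classic = 0%E) /\
    ~ (0 <= t -> xi t `[0, +oo[%classic = 0%E).
  move=> t0 yt; split => /(_ t0) xi0.
    by move: yt; rewrite /mass_upto xi0 ltxx.
  suff xi0' : xi t `[0, x]%classic = 0%E by move: yt; rewrite /mass_upto xi0' ltxx.
  apply/eqP; rewrite -measure_le0 -xi0 le_measure ?inE//; try exact: measurable_itv.
  by move=> r /=; rewrite !in_itv/= => /andP[->].
split; last first.
  have := tot 0 (lexx _); rewrite mu0 /eta/= /tail_path => b0.
  have i0 := ip _ (lexx _).
  have bx0 : (beta 0%R `]x, +oo[%classic + (iota 0%R)%:E <= 0%:E)%E.
    rewrite -b0 leeD2r// le_measure ?inE//; try exact: measurable_itv.
    by move=> r /=; rewrite !in_itv/= !andbT => /ltW; exact: le_trans.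
  apply: le_anti; rewrite (addr_ge0 _ i0) ?fine_ge0// andbT.
  by move: bx0; rewrite measOn_itvE -EFinD lee_fin.
split=> //.
- apply: cont_path_left_right => t t0.
    by apply: cvgD; [apply: tl.1|apply: il.1].
  (* At a zero of the reflected path, [eta] equals mu - alpha at [t] and is at least mu - alpha
     before [t]; being nondecreasing, it is squeezed between this continuous path and [eta t]. *)
  have [yt|yt] := leP (mass_upto xi x t) 0.
    have psc : (mu \- mass_upto alpha x) s @[s --> t^'-] --> mu t - mass_upto alpha x t.
      have /continuous_within_itvcyP[psc _] := cont_pathB muc ac.
      by apply: cvg_at_left_filter; apply: psc; rewrite in_itv/= t0.
    have et : eta t = mu t - mass_upto alpha x t.
      have := y0 t (ltW t0); have := yE t (ltW t0); lra.
    apply: (@squeeze_cvgr _ _ _ _ (mu \- mass_upto alpha x) (cst (eta t))).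
    + near=> s; have st : s < t by near: s; exact: nbhs_left_lt.
      have s0 : 0 <= s by apply: ltW; near: s; exact: nbhs_left_gt.
      rewrite /=; apply/andP; split; last exact/nd/ltW.
      by have := y0 s s0; rewrite yE//; lra.
    + by rewrite et.
    + exact: cvg_cst.
  have [n1 n2] := npos _ (ltW t0) yt; apply: cvgD.
    exact: stieltjes_ae_left_cont aeb _ _.
  exact: stieltjes_ae_left_cont aei _ _.
- move=> s t s0 st pos; rewrite /eta/=; congr (_ + _); apply/esym.
    by apply: (stieltjes_ae_const tD aeb s0 st) => r /andP[sr rt]; have [] := npos _ (le_trans s0 (ltW sr)) (pos _ sr rt).
  by apply: (stieltjes_ae_const iD aei s0 st) => r /andP[sr rt]; have [] := npos _ (le_trans s0 (ltW sr)) (pos _ sr rt).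
Unshelve. all: by end_near. Qed.

(** The terms in [mu] and [iota] cancel, and the mass of [beta] beyond [x] decreases in [x]. So xi_t
    has on ]x', x] at most the mass of alpha_t, which transfers the absence of atoms from arrivals
    to the queue. *)
Lemma skorohod_increment_le alpha mu xi : skorohod_map1 alpha mu xi ->
  forall x x' t, 0 <= x' -> x' <= x -> 0 <= t ->
  mass_upto xi x t - mass_upto xi x' t <= mass_upto alpha x t - mass_upto alpha x' t.
Proof.
move=> [_ [beta [iota [bD iD H]]]] x x' t x'0 x'x t0.
have [xE _ _ _] := H x (le_trans x'0 x'x).
have [x'E _ _ _] := H x' x'0.
rewrite /mass_upto xE// x'E//.
rewrite (measOn_itvE (alpha t) `[0, x]) (measOn_itvE (alpha t) `[0, x']).
rewrite (measOn_itvE (beta t) `]x, +oo[) (measOn_itvE (beta t) `]x', +oo[).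
rewrite /=.
have : fine (beta t `]x, +oo[%classic) <= fine (beta t `]x', +oo[%classic).
  rewrite -lee_fin -!measOn_itvE.
  apply: le_measure; rewrite ?inE//; try exact: measurable_itv.
  by move=> r /=; rewrite !in_itv/= !andbT; exact: le_lt_trans.
lra.
Qed.

End skorohod_facts.

(** * Arrivals *)

Section arrivals.
Context {R : realType}.
Variables (lambda : R -> R) (pi : probability (measurableTypeR R) R).
Variables (Q0 : measOn (@Rplus R)) (alpha : R -> measOn (@Rplus R)).
Implicit Types x s r t v T L p c : R.
Hypothesis hlambda : arrival_rate lambda.
Hypothesis halpha : arrival_process Q0 lambda pi alpha.
Local Notation leb := (@lebesgue_measure R).

Lemma arrival_rate_bounded T : 0 <= T ->
  exists2 L, 0 <= L & forall t, 0 <= t -> t <= T -> lambda t <= L.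
Proof.
have [_ l0 lb] := hlambda.
move=> T0; have [M [_ /(_ (`|M| + 1))]] := lb T T0.
rewrite (le_lt_trans (ler_norm M)) ?ltrDl// => /(_ isT) H.
exists (`|M| + 1); first by rewrite addr_ge0.
by move=> t t0 tT; apply: le_trans (ler_norm _) (H _ _); rewrite /= in_itv/= t0.
Qed.

Let rate (x v : R) : \bar R :=
  (((v <= x)%R%:R * lambda v)%:E * pi `[0%R, (x - v)%R]%classic)%E.

Let rate_ge0 x v : 0 <= v -> (0 <= rate x v)%E.
Proof.
by have [_ l0 _] := hlambda; move=> v0; rewrite mule_ge0// lee_fin mulr_ge0// l0.
Qed.

Let measurable_rate x : measurable_fun (Rplus : set (measurableTypeR R)) (rate x).
Proof.
have [ml _ _] := hlambda.
have mR : measurable (Rplus : set (measurableTypeR R)) by exact: measurable_itv.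
apply: emeasurable_funM.
  apply/measurable_EFinP/measurable_funM => //.
  rewrite [X in measurable_fun _ X](_ : _ = \1_`]-oo, x]); last first.
    by apply/funext => v; rewrite indicE mem_setE in_itv.
  by apply/measurable_funTS/measurable_indic; exact: measurable_itv.
rewrite [X in measurable_fun _ X](_ : _ = EFin \o fun v => fine (pi `[0, x - v]%classic)); last first.
  by apply/funext => v /=; rewrite fineK// fin_num_measure//; exact: measurable_itv.
apply/measurable_EFinP; apply: nonincreasing_measurable => // s t st.
apply: fine_le; try by rewrite fin_num_measure//; exact: measurable_itv.
rewrite le_measure ?inE//; try exact: measurable_itv.
move=> r /=; rewrite !in_itv/= => /andP[-> /le_trans]; apply.
by rewrite lerD2l lerN2.
Qed.

(** A customer arriving at v >= s with deadline at most [x] has patience at most x - v <= x - s, an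
    event of probability at most [p]; arrivals come at rate at most [L]. *)
Lemma arrival_increment_bounds L p x s r : 0 <= x -> 0 <= s -> s <= r ->
  (forall t, s <= t -> t <= r -> lambda t <= L) -> 0 <= p ->
  (pi `[0%R, (x - s)%R]%classic <= p%:E)%E ->
  0 <= mass_upto alpha x r - mass_upto alpha x s <= L * p * (r - s).
Proof.
move=> x0 s0 sr lL p0 pip.
have r0 := le_trans s0 sr; have [_ l0 _] := hlambda.
have L0 : 0 <= L by apply: le_trans (l0 s s0) (lL _ _ _).
have mI : measurable (`]s, r]%classic : set (measurableTypeR R)) by exact: measurable_itv.
have subI : `]s, r]%classic `<=` (@Rplus R).
  move=> v; rewrite /Rplus/= !in_itv/= andbT => /andP[/ltW sv _].
  exact: le_trans sv.
have E : (alpha r `[0%R, x]%classic = alpha s `[0%R, x]%classic +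
    \int[leb]_(v in `]s, r]) rate x v)%E.
  rewrite !halpha// -addeA; congr (_ + _)%E.
  rewrite (@itv_bndbnd_setU _ _ (BLeft 0) (BRight s) (BRight r)) ?bnd_simp//.
  rewrite ge0_integral_setU//; try exact: measurable_itv.
  - rewrite -itv_bndbnd_setU ?bnd_simp//.
    apply: measurable_funS (measurable_rate x); first exact: measurable_itv.
    by move=> v; rewrite /Rplus/= !in_itv/= andbT => /andP[].
  - move=> v; rewrite -itv_bndbnd_setU ?bnd_simp//= in_itv/= => /andP[v0 _].
    exact: rate_ge0.
  - rewrite disj_set2E; apply/eqP/seteqP; split => v //=; rewrite !in_itv/=.
    by move=> [/andP[_ vs] /andP[+ _]]; rewrite ltNge vs.
have I0 : (0 <= \int[leb]_(v in `]s, r]) rate x v)%E.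
  by apply: integral_ge0 => v /subI; rewrite /Rplus/= in_itv/= andbT; exact: rate_ge0.
have IL : (\int[leb]_(v in `]s, r]) rate x v <= (L * p * (r - s))%:E)%E.
  apply: (@le_trans _ _ (\int[leb]_(v in `]s, r]) (cst (L * p)%:E) v)%E); last first.
    rewrite integral_cst//= lebesgue_measure_itv/= lte_fin.
    by case: ltP => // _; rewrite ?EFinM// mule0 lee_fin mulr_ge0 ?mulr_ge0 ?subr_ge0.
  apply: ge0_le_integral => //.
  - by move=> v /subI; rewrite /Rplus/= in_itv/= andbT; exact: rate_ge0.
  - by apply: measurable_funS (measurable_rate x) => //; exact: measurable_itv.
  - move=> v /=; rewrite in_itv/= => /andP[sv vr]; rewrite /rate [leRHS]EFinM.
    have v0 := le_trans s0 (ltW sv).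
    apply: lee_pmul => //; first by rewrite lee_fin mulr_ge0// l0.
      rewrite lee_fin (le_trans _ (lL _ (ltW sv) vr))//.
      by case: (v <= x); rewrite ?mul1r ?mul0r ?l0.
    apply: le_trans pip; rewrite le_measure ?inE//; try exact: measurable_itv.
    move=> w /=; rewrite !in_itv/= => /andP[-> /le_trans]; apply.
    by rewrite lerD2l lerN2 ltW.
move: I0 IL E; case: (\int[_]_(_ in _) _)%E => // i i0 iL.
rewrite /mass_upto (measOn_itvE (alpha s)) (measOn_itvE (alpha r)) => -[->].
by move: i0 iL; rewrite !lee_fin/= => ? ?; apply/andP; split; lra.
Qed.

(** With the trivial bound p = 1, the increments are Lipschitz on bounded time intervals. *)
Lemma arrival_cont x : 0 <= x -> cont_path (mass_upto alpha x).
Proof.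
move=> x0.
have pi1 s : (pi `[0%R, (x - s)%R]%classic <= 1%:E)%E.
  by rewrite probability_le1//; exact: measurable_itv.
have bnd T s r L : (forall t, 0 <= t -> t <= T -> lambda t <= L) -> 0 <= s ->
    s <= r -> r <= T -> 0 <= mass_upto alpha x r - mass_upto alpha x s <= L * (r - s).
  move=> lL s0 sr rT; rewrite -[L]mulr1; apply: arrival_increment_bounds => //.
  by move=> t st tr; apply: lL; [exact: le_trans st|exact: le_trans rT].
apply/subspace_continuousP => t tR; have t0 : 0 <= t.
  by move: tR; rewrite /Rplus/= in_itv/= andbT.
have [L L0 lL] := arrival_rate_bounded (addr_ge0 t0 ler01).
have L10 : 0 < L + 1 by rewrite ltr_wpDl.
apply/cvgrPdist_lt => e e0; rewrite near_withinE.
apply/nbhs_ballP; exists (Num.min 1 (e / (L + 1))) => /=.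
  by rewrite lt_min ltr01 divr_gt0.
move=> s; rewrite /ball/= lt_min => /andP[ts1 +] sR.
have s0 : 0 <= s by move: sR; rewrite /Rplus/= in_itv/= andbT.
rewrite ltr_pdivlMr// => tse; apply: le_lt_trans tse.
change (`|mass_upto alpha x t - mass_upto alpha x s| <= `|t - s| * (L + 1)).
have [st|/ltW ts] := leP s t.
  have /andP[h1 h2] := bnd _ _ _ _ lL s0 st (ler_wpDr ler01 (lexx t)).
  rewrite (ger0_norm h1) ger0_norm ?subr_ge0//; apply: le_trans h2 _.
  by rewrite mulrC ler_wpM2l ?subr_ge0// lerDl.
have st1 : s <= t + 1 by move: ts1; rewrite distrC ger0_norm ?subr_ge0//; lra.
have /andP[h1 h2] := bnd _ _ _ _ lL t0 ts st1.
rewrite distrC (distrC t) (ger0_norm h1) ger0_norm ?subr_ge0//; apply: le_trans h2 _.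
by rewrite mulrC ler_wpM2l ?subr_ge0// lerDl.
Qed.

(** The intervals [0, 1 / (n + 1)] shrink to {0}, which has no mass. This makes the rate of arrivals
    with a near deadline as small as desired. *)
Lemma patience_small c : patience_law pi -> 0 < c ->
  exists2 e, 0 < e & (pi `[0%R, e]%classic <= c%:E)%E.
Proof.
move=> [_ pi0] c0; pose F (n : nat) : set R := `[0, n.+1%:R^-1]%classic.
have capF : \bigcap_n F n = [set 0].
  apply/seteqP; split=> [r rF|_ -> n _]; last by rewrite /F/= in_itv/= lexx/= invr_ge0.
  have := rF 0%N I; rewrite /F/= in_itv/= => /andP[r0 _].
  apply/eqP; rewrite eq_le r0 andbT leNgt; apply/negP => rp.
  have [n nr] : exists n, r^-1 < n.+1%:R by exists (Num.truncn r^-1); exact: truncnS_gt.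
  have := rF n I; rewrite /F/= in_itv/= r0/= leNgt => /negP; apply.
  by rewrite -[ltRHS]invrK ltf_pV2 ?posrE ?invr_gt0.
have piF : pi (F n) @[n --> \oo] --> 0%E.
  rewrite -pi0 -capF; apply: nonincreasing_cvg_mu.
  - by rewrite (le_lt_trans (probability_le1 _ _)) ?ltry//; exact: measurable_itv.
  - by move=> n; exact: measurable_itv.
  - by rewrite capF.
  - move=> m n mn; apply/subsetPset => r; rewrite /F/= !in_itv/= => /andP[-> /le_trans].
    by apply; rewrite lef_pV2 ?posrE// ler_nat.
have /fine_cvgP[_ /cvgrPdist_lt/(_ c c0)[n _ /(_ n (leqnn n))/=]] := piF.
rewrite sub0r normrN => /ltr_normlW/ltW piF0; exists n.+1%:R^-1; first by rewrite invr_gt0.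
by rewrite -lee_fin fineK in piF0 => //; rewrite fin_num_measure//; exact: measurable_itv.
Qed.

End arrivals.

(** * Test functions for the transport equation *)

Section smooth_cutoffs.
Context {R : realType}.
Implicit Types (f : R -> R) (x y u h l C : R).

Lemma is_derive_quadratic f x l C :
  (forall h, `|f (x + h) - f x - l * h| <= C * h ^+ 2) -> is_derive x 1 f l.
Proof.
move=> H; have C0 : 0 <= C.
  by have := le_trans (normr_ge0 _) (H 1); rewrite expr1n mulr1.
have cv : h^-1 *: (f (h *: 1 + x) - f x) @[h --> 0^'] --> l.
  apply/cvgrPdist_lt => e e0; near=> h.
  have h0 : h != 0 by near: h; exact: nbhs_dnbhs_neq.
  have he : `|h| < e / (C + 1).
    near: h; apply: dnbhs0_lt; by rewrite divr_gt0// ltr_wpDl.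
  rewrite distrC -(ltr_pM2r (x := `|h|)) ?normr_gt0// -normrM mulrBl.
  rewrite /GRing.scale/= mulr1 mulrAC mulVf// mul1r (addrC h).
  apply: le_lt_trans (H h) _.
  rewrite -real_normK ?num_real// expr2 mulrA ltr_pM2r ?normr_gt0//.
  move: he; rewrite ltr_pdivlMr ?ltr_wpDl//; apply: le_lt_trans.
  by rewrite mulrC ler_wpM2l// lerDl.
apply: DeriveDef; first by apply/cvg_ex; exists l.
by rewrite /derive; exact/cvg_lim.
Unshelve. all: by end_near. Qed.

(** The square of the positive part is C^1. The cutoffs, and the primitives of ramps used in the
    occupation bound, are built from it. *)
Definition psq x := Num.max x 0 ^+ 2.

Lemma is_derive_psq x : is_derive x 1 psq (2 * Num.max x 0).
Proof.
apply: (@is_derive_quadratic _ _ _ 1) => h; rewrite /psq.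
by rewrite !maxEge ler_norml; case: (leP 0 x) => x0; case: (leP 0 (x + h)) => xh; nra.
Qed.

Lemma continuous_pos : continuous (fun x => Num.max x 0).
Proof. by move=> x; apply: continuous_max; [exact: cvg_id|exact: cvg_cst]. Qed.

(** A C^1 descent from 1 to 0 across [0, 1]. *)
Definition cutoff x := psq (1 - psq x).
Definition cutoff' x := - (4 * (Num.max (1 - psq x) 0 * Num.max x 0)).

Lemma is_derive_cutoff x : is_derive x 1 cutoff (cutoff' x).
Proof.
have d1 := is_derive_psq x.
have d2 : is_derive x 1 (fun y => 1 - psq y) (0 - 2 * Num.max x 0).
  exact: is_deriveB.
have d3 := is_derive_psq (1 - psq x).
apply: (is_derive_eq (@is_derive1_comp _ psq (fun y => 1 - psq y) x _ _ d3 d2)).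
by rewrite /cutoff'; ring.
Qed.

Lemma continuous_psq : continuous psq.
Proof. by move=> x; apply: differentiable_continuous; apply/derivable1_diffP; have [] := is_derive_psq x. Qed.

Lemma continuous_cutoff' : continuous cutoff'.
Proof.
move=> x; apply: cvgN; apply: cvgM; first exact: cvg_cst.
apply: cvgM; last exact: continuous_pos.
apply: (@cvg_comp _ _ _ (fun y => 1 - psq y) (fun z => Num.max z 0)); last exact: continuous_pos.
by apply: cvgB; [exact: cvg_cst|exact: continuous_psq].
Qed.

Lemma cutoff_le0 x : x <= 0 -> cutoff x = 1.
Proof. by move=> x0; rewrite /cutoff /psq (max_r x0) expr0n/= subr0 max_l ?expr1n. Qed.

Lemma cutoff'_le0 x : x <= 0 -> cutoff' x = 0.
Proof. by move=> x0; rewrite /cutoff' (max_r x0) !mulr0 oppr0. Qed.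

Lemma cutoff_ge1 x : 1 <= x -> cutoff x = 0.
Proof.
move=> x1; rewrite /cutoff /psq (max_l (le_trans ler01 x1)) max_r ?expr0n//.
by rewrite subr_le0 exprn_ege1.
Qed.

Lemma cutoff_itv01 x : 0 <= cutoff x <= 1.
Proof.
rewrite /cutoff /psq sqr_ge0/= expr_le1// ?le_max ?lexx ?orbT//.
by rewrite ge_max ler01 andbT gerBl sqr_ge0.
Qed.

End smooth_cutoffs.

Section test_functions.
Context {R : realType}.
Implicit Types (f : R -> R) (x y s t : R).

Lemma is_derive_within (A : set R) f x l : is_derive x 1 f l ->
  derives_within A f x l.
Proof.
move=> [df fl].
have : h^-1 *: (f (h *: 1 + x) - f x) @[h --> 0^'] --> l.
  by move: fl; rewrite /derive => <-.
move=> /cvgrPdist_lt cv; apply/cvgrPdist_lt => e /cv.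
rewrite /dnbhs !near_withinE => /nbhs_ballP[d /= d0 H].
apply/nbhs_ballP; exists d => //= y xy yx yA.
have := H (y - x); rewrite /ball/= sub0r normrN distrC subr_eq0 => /(_ xy yx).
by rewrite /GRing.scale/= mulr1 subrK mulrC.
Qed.

(** The set [A] may be open on the right, so boundedness of the support is not enough. It has to lie
    in a rectangle with [[0, M]] inside [A], which is compact within [D]. *)
Lemma C1c_compact (A : set R) (phi : R * R -> R) M T :
  0 <= M -> 0 <= T -> A `<=` Rplus -> `[0, M]%classic `<=` A ->
  (forall x s, A x -> 0 <= s -> phi (x, s) != 0 -> x <= M /\ s <= T) ->
  let D := A `*` Rplus in
  compact (D `&` closure [set p | D p /\ phi p != 0]).
Proof.
move=> M0 T0 AR MA supp D.
pose C : set (R * R) := `[0, M]%classic `*` `[0, T]%classic.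
have cC : compact C by apply: compact_setX; exact: segment_compact.
have CD : C `<=` D.
  move=> [x s] [/= /MA Ax]; rewrite in_itv/= => /andP[s0 _]; split => //.
  by rewrite /Rplus/= in_itv/= s0.
have closC : closed C.
  by apply: compact_closed => //; exact: norm_hausdorff.
have SC : closure [set p | D p /\ phi p != 0] `<=` C.
  rewrite [X in _ `<=` X](_ : C = closure C); last exact/closure_id.
  apply: closure_subset.
  move=> [x s] [[/= Ax]]; rewrite /Rplus/= in_itv/= andbT => s0 /(supp _ _ Ax s0)[xM sT].
  have := AR _ Ax; rewrite /Rplus/= in_itv/= andbT => x0.
  by split => /=; rewrite in_itv/= ?x0 ?s0.
rewrite (_ : _ `&` _ = closure [set p | D p /\ phi p != 0]); last first.
  by apply/seteqP; split=> [p []//|p cp]; split => //; exact/CD/SC.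
by apply: subclosed_compact SC => //; exact: closed_closure.
Qed.

(** The three factors are a weight in the age, a profile moving with the flow, and a cutoff in time.
    The terms in [F'] are opposite in the two partial derivatives. *)
Lemma C1c_product (A : set R) (P P' F F' X X' : R -> R) M T :
  0 <= M -> 0 <= T -> A `<=` Rplus -> `[0, M]%classic `<=` A ->
  (forall x, 0 <= x -> is_derive x 1 P (P' x)) ->
  (forall x, 0 <= x -> {for x, continuous P'}) ->
  (forall x, is_derive x 1 F (F' x)) -> continuous F' ->
  (forall x, is_derive x 1 X (X' x)) -> continuous X' ->
  (forall x s, A x -> 0 <= s -> P x * F (x - s) * X s != 0 -> x <= M /\ s <= T) ->
  C1c A (fun p => P p.1 * F (p.1 - p.2) * X p.2)
    (fun p => (P' p.1 * F (p.1 - p.2) + P p.1 * F' (p.1 - p.2)) * X p.2)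
    (fun p => P p.1 * (F (p.1 - p.2) * X' p.2 - F' (p.1 - p.2) * X p.2)).
Proof.
move=> M0 T0 AR MA dP cP' dF cF' dX cX' supp.
have cder f f' x : is_derive x 1 f (f' x) -> {for x, continuous f}.
  by move=> [df _]; apply/differentiable_continuous/derivable1_diffP.
have AR0 x : A x -> 0 <= x by move=> /AR; rewrite /Rplus/= in_itv/= andbT.
have c1 (p : R * R) : {for p, continuous (fun p : R * R => p.1 : R)}.
  by apply: cvg_fst.
have c2 (p : R * R) : {for p, continuous (fun p : R * R => p.2 : R)}.
  by apply: cvg_snd.
have c12 (p : R * R) : {for p, continuous (fun p : R * R => p.1 - p.2 : R)}.
  by apply: cvgB; [exact: c1|exact: c2].
have cc1 f (p : R * R) : {for p.1, continuous f} -> {for p, continuous (fun p : R * R => f p.1)}.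
  by move=> cf; apply: (@continuous_comp _ _ _ (fun p : R * R => p.1) f).
have cc2 f (p : R * R) : {for p.2, continuous f} -> {for p, continuous (fun p : R * R => f p.2)}.
  by move=> cf; apply: (@continuous_comp _ _ _ (fun p : R * R => p.2) f).
have cc12 f (p : R * R) : {for p.1 - p.2, continuous f} -> {for p, continuous (fun p : R * R => f (p.1 - p.2))}.
  by move=> cf; apply: (@continuous_comp _ _ _ (fun p : R * R => p.1 - p.2) f).
have mul (f g : R * R -> R) p : {for p, continuous f} -> {for p, continuous g} ->
    {for p, continuous (fun q => f q * g q)} by exact: cvgM.
have add (f g : R * R -> R) p : {for p, continuous f} -> {for p, continuous g} ->
    {for p, continuous (fun q => f q + g q)} by exact: cvgD.
have sub (f g : R * R -> R) p : {for p, continuous f} -> {for p, continuous g} ->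
    {for p, continuous (fun q => f q - g q)} by exact: cvgB.
have cP x : A x -> {for x, continuous P} by move=> /AR0 x0; exact: cder (dP _ x0).
have cPP x : A x -> {for x, continuous P'} by move=> /AR0 x0; exact: cP'.
have cF x : {for x, continuous F} by exact: cder (dF x).
have cX x : {for x, continuous X} by exact: cder (dX x).
split.
- move=> x s [/= /AR0 x0 _]; split; apply: is_derive_within.
    have h1 : is_derive x 1 (fun y => F (y - s)) (F' (x - s)).
      have hs : is_derive x 1 (fun y => y - s) (1 - 0) by exact: is_deriveB.
      apply: (is_derive_eq (@is_derive1_comp _ F (fun y => y - s) x _ _ (dF _) hs)).
      by rewrite subr0 mulr1.
    have h2 := is_deriveM (dP x x0) h1.
    have h3 := is_deriveM h2 (is_derive_cst (X s) x 1).
    by apply: (is_derive_eq h3); rewrite /GRing.scale/=; ring.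
  have h1 : is_derive s 1 (fun r => F (x - r)) (- F' (x - s)).
    have hs : is_derive s 1 (fun r => x - r) (0 - 1) by exact: is_deriveB.
    apply: (is_derive_eq (@is_derive1_comp _ F (fun r => x - r) s _ _ (dF _) hs)).
    by rewrite sub0r mulrN1.
  have h2 := is_deriveM (is_derive_cst (P x) s 1) h1.
  have h3 := is_deriveM h2 (dX s).
  by apply: (is_derive_eq h3); rewrite /GRing.scale/= /cst fctE; ring.
- apply: continuous_in_subspaceT => p; rewrite inE => -[Ap _].
  apply: (mul (fun p => P p.1 * F (p.1 - p.2)) (fun p => X p.2)); last exact/cc2.
  by apply: (mul (fun p => P p.1) (fun p => F (p.1 - p.2))); [exact/cc1/cP|exact/cc12].
- apply: continuous_in_subspaceT => p; rewrite inE => -[Ap _].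
  apply: (mul (fun p => P' p.1 * F (p.1 - p.2) + P p.1 * F' (p.1 - p.2))
    (fun p => X p.2)); last exact/cc2.
  apply: (add (fun p => P' p.1 * F (p.1 - p.2)) (fun p => P p.1 * F' (p.1 - p.2))).
    by apply: (mul (fun p => P' p.1) (fun p => F (p.1 - p.2))); [exact/cc1/cPP|exact/cc12].
  by apply: (mul (fun p => P p.1) (fun p => F' (p.1 - p.2))); [exact/cc1/cP|exact/cc12/cF'].
- apply: continuous_in_subspaceT => p; rewrite inE => -[Ap _].
  apply: (mul (fun p => P p.1)
    (fun p => F (p.1 - p.2) * X' p.2 - F' (p.1 - p.2) * X p.2)); first exact/cc1/cP.
  apply: (sub (fun p => F (p.1 - p.2) * X' p.2) (fun p => F' (p.1 - p.2) * X p.2)).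
    by apply: (mul (fun p => F (p.1 - p.2)) (fun p => X' p.2)); [exact/cc12|exact/cc2/cX'].
  by apply: (mul (fun p => F' (p.1 - p.2)) (fun p => X p.2)); [exact/cc12/cF'|exact/cc2].
- by apply: (C1c_compact M0 T0).
Qed.

Lemma pairing_eq S (m : measOn S) f g : (forall x, S x -> f x = g x) ->
  pairing f m = pairing g m.
Proof. by move=> fg; apply: eq_Rintegral => x; rewrite inE => /fg. Qed.

End test_functions.

(** * The age equation for product test functions *)

Section transport.
Context {R : realType}.
Variables (G g : R -> R) (nu : R -> measOn (ages G)) (nu0 : measOn (ages G)).
Variable K : R -> R.
Implicit Types (x s t M : R).
Local Notation leb := (@lebesgue_measure R).
Local Notation h := (hazard G g).

Definition transport_eq :=
  forall t, 0 <= t -> forall phi phix phis, C1c (ages G) phi phix phis ->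
    pairing (fun x => phi (x, t)) (nu t) =
    pairing (fun x => phi (x, 0)) nu0
    + \int[leb]_(s in `[0, t])
        pairing (fun x => phix (x, s) + phis (x, s)) (nu s)
    - \int[leb]_(s in `[0, t])
        pairing (fun x => h x * phi (x, s)) (nu s)
    + \int[stieltjes K]_(s in `[0, t]) phi (0, s).

Lemma ages_Rplus : ages G `<=` Rplus.
Proof. by move=> x [x0 _]; rewrite /Rplus/= in_itv/= x0. Qed.

Lemma ages_itv M : ages G M -> `[0, M]%classic `<=` ages G.
Proof.
move=> [_ MH] x /=; rewrite in_itv/= => /andP[x0 xM]; split => //.
by apply: le_lt_trans MH; rewrite lee_fin.
Qed.

(** The cutoff [X] equals 1 with zero derivative up to [t] and vanishes from t + d on: it makes the
    support compact in time and is invisible to the integrals over [0, t]. Ageing preserves x - s,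
    so only [P'] survives from the derivatives. *)
Lemma transport_identity (P P' F F' : R -> R) M d t :
  transport_eq -> 0 <= t -> 0 < d -> ages G M ->
  (forall x, 0 <= x -> is_derive x 1 P (P' x)) ->
  (forall x, 0 <= x -> {for x, continuous P'}) ->
  (forall x, is_derive x 1 F (F' x)) -> continuous F' ->
  (forall x s, ages G x -> 0 <= s -> s <= t + d -> M < x ->
    P x * F (x - s) = 0) ->
  pairing (fun x => P x * F (x - t)) (nu t) =
  pairing (fun x => P x * F x) nu0
  + \int[leb]_(s in `[0, t]) pairing (fun x => P' x * F (x - s)) (nu s)
  - \int[leb]_(s in `[0, t]) pairing (fun x => h x * (P x * F (x - s))) (nu s)
  + \int[stieltjes K]_(s in `[0, t]) (P 0 * F (- s)).
Proof.
move=> tr t0 d0 AM dP cP' dF cF' supp.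
pose X s := cutoff ((s - t) / d); pose X' s := cutoff' ((s - t) / d) / d.
have dX s : is_derive s 1 X (X' s).
  have d1 : is_derive s 1 (fun r => (r - t) * d^-1) (d^-1).
    apply: (is_derive_eq (is_deriveM (is_deriveB (is_derive_id s 1) (is_derive_cst t s 1)) (is_derive_cst d^-1 s 1))).
    by rewrite /GRing.scale/=; ring.
  by apply: (is_derive_eq (@is_derive1_comp _ cutoff _ s _ _ (is_derive_cutoff _) d1)).
have cX' : continuous X'.
  move=> s; apply: cvgM; last exact: cvg_cst.
  apply: (@continuous_comp _ _ _ (fun s => (s - t) / d) cutoff'); last exact: continuous_cutoff'.
  by apply: cvgM; [apply: cvgB; [exact: cvg_id|exact: cvg_cst]|exact: cvg_cst].
have X1 s : s <= t -> X s = 1.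
  by move=> st; apply: cutoff_le0; rewrite pmulr_lle0 ?invr_gt0// subr_le0.
have X'0 s : s <= t -> X' s = 0.
  by move=> st; rewrite /X' cutoff'_le0 ?mul0r// pmulr_lle0 ?invr_gt0// subr_le0.
have M0 : 0 <= M by case: AM.
have td0 : 0 <= t + d by rewrite addr_ge0// ltW.
have C := @C1c_product R (ages G) P P' F F' X X' M (t + d) M0 td0 ages_Rplus
  (ages_itv AM) dP cP' dF cF' dX cX'.
have /C{}C : forall x s, ages G x -> 0 <= s ->
    P x * F (x - s) * X s != 0 -> x <= M /\ s <= t + d.
  move=> x s Ax s0 nz.
  have std : s <= t + d.
    rewrite leNgt; apply/negP => tds; move: nz.
    by rewrite /X cutoff_ge1 ?mulr0 ?eqxx// ler_pdivlMr// mul1r lerBrDl ltW.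
  split=> //; rewrite leNgt; apply/negP => Mx; move: nz.
  by rewrite (supp _ _ Ax s0 std Mx) mul0r eqxx.
have E1 : \int[leb]_(s in `[0, t]) pairing (fun x =>
      (P' x * F (x - s) + P x * F' (x - s)) * X s
      + P x * (F (x - s) * X' s - F' (x - s) * X s)) (nu s) =
    \int[leb]_(s in `[0, t]) pairing (fun x => P' x * F (x - s)) (nu s).
  apply: eq_Rintegral => s; rewrite inE/= in_itv/= => /andP[s0 st].
  by apply: pairing_eq => x _; rewrite X1// X'0//; ring.
have E2 : \int[leb]_(s in `[0, t])
      pairing (fun x => h x * (P x * F (x - s) * X s)) (nu s) =
    \int[leb]_(s in `[0, t]) pairing (fun x => h x * (P x * F (x - s))) (nu s).
  apply: eq_Rintegral => s; rewrite inE/= in_itv/= => /andP[s0 st].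
  by apply: pairing_eq => x _; rewrite X1// mulr1.
have E3 : \int[stieltjes K]_(s in `[0, t]) (P 0 * F (0 - s) * X s) =
    \int[stieltjes K]_(s in `[0, t]) (P 0 * F (- s)).
  apply: eq_Rintegral => s; rewrite inE/= in_itv/= => /andP[s0 st].
  by rewrite X1// mulr1 sub0r.
have E4 : pairing (fun x => P x * F (x - t) * X t) (nu t) =
    pairing (fun x => P x * F (x - t)) (nu t).
  by apply: pairing_eq => x _ /=; rewrite X1// mulr1.
have E5 : pairing (fun x => P x * F (x - 0) * X 0) nu0 =
    pairing (fun x => P x * F x) nu0.
  by apply: pairing_eq => x _ /=; rewrite X1// mulr1 subr0.
by have := tr t t0 _ _ _ C; rewrite /= E1 E2 E3 E4 E5.
Qed.

End transport.

(** * Occupation measures of the age process *)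

Section measure_paths.
Context {R : realType}.
Variables (S : set R).
Hypothesis mS : measurable (S : set (measurableTypeR R)).
Implicit Types (z : R -> measOn S) (m : measOn S) (f : R -> R) (x s t : R).

Lemma measOn_setI m (A : set R) : measurable (A : set (measurableTypeR R)) ->
  m (A `&` S) = m A.
Proof.
move=> mA; rewrite -[in RHS](setUIDK A S) measureU//.
- rewrite -[LHS]adde0; congr (_ + _)%E; apply/esym/eqP.
  rewrite -measure_le0; apply: (@le_trans _ _ (m (~` S))); last by rewrite meas_out.
  apply: le_measure; rewrite ?inE.
  + exact: measurableD.
  + exact: measurableC.
  + by move=> x [].
- exact: measurableI.
- exact: measurableD.
- by apply/seteqP; split=> x // [[_ ?] []].
Qed.

Lemma measOn_setT m : m setT = m S.
Proof. by rewrite -(measOn_setI m measurableT) setTI. Qed.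

Lemma pairing_cst1 m : pairing (cst 1) m = fine (m S).
Proof.
rewrite /pairing /Rintegral; congr fine.
by apply: etrans (integral_cst m mS 1) _; exact: mul1e.
Qed.

Lemma bounded_test_fun f M : continuous f -> (forall x, `|f x| <= M) -> test_fun S f.
Proof.
move=> cf fM; split; first exact: continuous_subspaceT.
exists M; split; first exact: num_real.
by move=> N MN x _; rewrite /= (le_trans (fM x))// ltW.
Qed.

Lemma pairing_cont_path z f : cont_path z -> test_fun S f ->
  cont_path (fun t => pairing f (z t)).
Proof.
move=> zc fS; apply/subspace_continuousP => t tR.
exact: (iffLR (weak_cvgP _ _) ((iffLR (subspace_continuousP _ _) zc) t tR) _ fS).
Qed.

(** Freezing the path at negative times gives continuity, hence measurability, on the whole line. *)
Lemma cont_path_max0 f : cont_path f -> continuous (fun s => f (Num.max s 0)).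
Proof.
move=> fc t; apply/cvgrPdist_lt => e e0.
have [|d d0 H] := cont_path_ltP fc (_ : 0 <= Num.max t 0) e0.
  by rewrite le_max lexx orbT.
have /cvgrPdist_lt/(_ d d0) := @continuous_pos R t.
by apply: filterS => s; apply: H; rewrite le_max lexx orbT.
Qed.

Lemma ramp_cont (n : nat) x : continuous (fun y => Num.min 1 (n%:R * Num.max (y - x) 0)).
Proof.
move=> y.
apply: (@continuous_min _ _ (cst 1) (fun z : R => n%:R * Num.max (z - x) 0)); first exact: cvg_cst.
apply: cvgM; first exact: cvg_cst.
apply: (@continuous_max _ _ (fun z : R => z - x) (cst 0)); last exact: cvg_cst.
by apply: cvgB; [exact: cvg_id|exact: cvg_cst].
Qed.

Lemma ramp_norm (n : nat) x y : `|Num.min 1 (n%:R * Num.max (y - x) 0)| <= 1.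
Proof.
rewrite ger0_norm ?ge_min ?lexx//.
by rewrite le_min ler01/= mulr_ge0// le_max lexx orbT.
Qed.

Lemma ramp_cvg x y : Num.min 1 (n%:R * Num.max (y - x) 0) @[n --> \oo] -->
  (\1_`]x, +oo[ y : R).
Proof.
rewrite indicE mem_setE in_itv/= andbT; case: ltP => xy.
  apply: (@cvg_trans _ ((cst 1 : nat -> R) n @[n --> \oo])); last exact: cvg_cst.
  apply: near_eq_cvg; near=> n.
  rewrite /= max_l ?subr_ge0 ?ltW// min_l// -ler_pdivrMr ?subr_gt0//.
  by near: n; exact: nbhs_infty_ger.
rewrite (_ : (fun n => _) = cst 0); first exact: cvg_cst.
by apply/funext => n; rewrite max_r ?subr_le0// mulr0 min_r.
Unshelve. all: by end_near. Qed.

Lemma pairing_ray_cvg m x :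
  pairing (fun y => Num.min 1 (n%:R * Num.max (y - x) 0)) m @[n --> \oo] -->
  fine (m `]x, +oo[%classic).
Proof.
have mray : measurable (`]x, +oo[%classic : set (measurableTypeR R)) by exact: measurable_itv.
rewrite /pairing /Rintegral.
have -> : m `]x, +oo[%classic = (\int[m]_(y in S) (\1_`]x, +oo[ y)%:E)%E.
  by rewrite integral_indic//; exact/esym/measOn_setI.
apply: fine_cvg; rewrite fineK; last first.
  by rewrite integral_indic// fin_num_measure//; exact: measurableI.
apply: (dominated_cvg mS (g := cst 1%E)) => //.
- move=> n; apply/measurable_EFinP; apply: (@measurable_funTS _ _ _ _ S).
  by apply: continuous_measurable_fun; exact: ramp_cont.
- by move=> y _; apply: cvg_EFin; [exact: nearW|exact: ramp_cvg].
- exact: finite_measure_integrable_cst.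
- by move=> n y _; rewrite /= lee_fin ramp_norm.
Qed.

Lemma measurable_pairing_path z f : cont_path z -> test_fun S f ->
  measurable_fun setT (fun s : measurableTypeR R => pairing f (z (Num.max s 0))).
Proof.
move=> zc fS; apply: continuous_measurable_fun.
by apply: (@cont_path_max0 (fun t => pairing f (z t))); exact: pairing_cont_path.
Qed.

Lemma measurable_total z : cont_path z ->
  measurable_fun setT (fun s : measurableTypeR R => z (Num.max s 0) setT).
Proof.
move=> zc; rewrite [X in measurable_fun _ X](_ : _ =
    EFin \o (fun s => pairing (cst 1) (z (Num.max s 0)))); last first.
  by apply/funext => s /=; rewrite measOn_setT pairing_cst1 fineK// fin_num_measure.
apply/measurable_EFinP; apply: measurable_pairing_path => //.
by apply: (@bounded_test_fun _ 1) => [|x]; [exact: cst_continuous|rewrite normr1].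
Qed.

(** Weak continuity controls only pairings with continuous functions. The masses of open rays are
    limits of pairings with ramps; the rays form a generating class stable under intersection, and
    the Dynkin argument extends measurability to Borel sets. *)
Lemma measurable_path z : cont_path z -> forall U : set R,
  measurable (U : set (measurableTypeR R)) ->
  measurable_fun setT (fun s : measurableTypeR R => z (Num.max s 0) U).
Proof.
move=> zc.
pose P (U : set (measurableTypeR R)) :=
  measurable_fun setT (fun s : measurableTypeR R => z (Num.max s 0) U).
have E : @measurable _ (measurableTypeR R) = <<s @RGenOInfty.G R >>.
  exact: RGenOInfty.measurableE.
suff H U : <<s @RGenOInfty.G R >> U -> P U by move=> U mU; apply: H; rewrite -E.
move: U; refine (@dynkin_induction _ (measurableTypeR R) (@RGenOInfty.G R) P E _ _ _ _ _); rewrite /P.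
- move=> A B [x ->] [y ->]; exists (Num.max x y).
  apply/seteqP; split => r /=; rewrite !in_itv/= !andbT gt_max.
    by case=> -> ->.
  by case/andP.
- exact: measurable_total.
- move=> _ [x ->].
  rewrite [X in measurable_fun _ X](_ : _ = EFin \o (fun s => fine (z (Num.max s 0) `]x, +oo[%classic))).
    apply/measurable_EFinP; apply: measurable_fun_cvg; last by move=> s _; exact: pairing_ray_cvg.
    move=> n; apply: measurable_pairing_path => //.
    by apply: (@bounded_test_fun _ 1); [exact: ramp_cont|exact: ramp_norm].
  by apply/funext => s /=; rewrite measOn_itvE.
- move=> U mU H.
  rewrite [X in measurable_fun _ X](_ : _ = (fun s => z (Num.max s 0%R) setT - z (Num.max s 0%R) U)%E).
    by apply: emeasurable_funB => //; exact: measurable_total.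
  apply/funext => s; rewrite -setTD measureD//; first by rewrite setTI.
  by rewrite -ge0_fin_numE// fin_num_measure.
- move=> F mF tF H.
  rewrite [X in measurable_fun _ X](_ : _ = (fun s => \sum_(k <oo) z (Num.max s 0%R) (F k))%E).
    exact: ge0_emeasurable_sum.
  apply/funext => s; apply/esym/cvg_lim => //.
  by apply: measure_sigma_additive.
Qed.

End measure_paths.

(** * Domination of an integrated kernel by a measure *)

Section kernel_domination.
Local Open Scope ereal_scope.
Context d d' (X : measurableType d) (Y : measurableType d') (R : realType).
Variables (l : {measure set X -> \bar R}) (D : set X).
Variables (k : X -> {measure set Y -> \bar R}) (m : {measure set Y -> \bar R}).
Hypothesis mD : measurable D.
Hypothesis mk : forall U, measurable U -> measurable_fun D (k ^~ U).
Import HBNNSimple.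

(* f vanishes outside E, hence so do the simple functions below it: domination
   is only needed on the subsets of E. *)
Lemma kernel_integral_le (E : set Y) (f : Y -> \bar R) :
  (forall A, measurable A -> A `<=` E -> \int[l]_(s in D) k s A <= m A) ->
  (forall y, 0 <= f y) -> (forall y, ~ E y -> f y = 0) ->
  measurable_fun setT f ->
  \int[l]_(s in D) \int[k s]_y f y <= \int[m]_y f y.
Proof.
move=> dom f0 fE mf.
have simple (h : {nnsfun Y >-> R}) : (forall y, ~ E y -> h y = 0%R) ->
    \int[l]_(s in D) \int[k s]_y (h y)%:E <= \int[m]_y (h y)%:E.
  move=> hE.
  have intE (p : {measure set Y -> \bar R}) :
      \int[p]_y (h y)%:E = \sum_(r \in range h) (r%:E * p (h @^-1` [set r])).
    by rewrite integralT_nnsfun sintegralE.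
  under eq_integral do rewrite intE.
  rewrite intE ge0_integral_fsum//; last 2 first.
  - move=> r; apply: measurable_funeM; exact: mk.
  - by move=> r s _; rewrite nnsfun_mulemu_ge0.
  apply: lee_fsum => // r _.
  have mr : measurable (h @^-1` [set r]) by exact: measurable_sfunP.
  have [r0|r0|->] := ltgtP r 0%R; last 2 first.
  - rewrite ge0_integralZl//; last 2 first.
      exact: mk.
      by rewrite lee_fin ltW.
    rewrite lee_wpmul2l ?lee_fin ?(ltW r0)// dom// => y /= hy.
    by apply: contrapT => /hE; rewrite hy => r0'; rewrite r0' ltxx in r0.
  - by rewrite mul0e integral0_eq// => s _; rewrite mul0e.
  - rewrite preimage_nnfun0// measure0 mule0 integral0_eq// => s _.
    by rewrite measure0 mule0.
pose h_ := nnsfun_approx measurableT mf.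
have h_nd n1 n2 y : (n1 <= n2)%N -> (h_ n1 y)%:E <= (h_ n2 y)%:E.
  by move=> n12; rewrite lee_fin; exact/lefP/nd_nnsfun_approx.
have h_cvg y : (h_ n y)%:E @[n --> \oo] --> f y.
  exact: (cvg_nnsfun_approx measurableT mf (fun y _ => f0 y) (I : setT y)).
have h_lef n y : (h_ n y)%:E <= f y.
  rewrite -(cvg_lim _ (h_cvg y))//; apply: lime_ge.
    by apply/cvg_ex; exists (f y); exact: h_cvg.
  by exists n => // j /= nj; exact: h_nd.
have hlim s : \int[k s]_y (h_ n y)%:E @[n --> \oo] --> \int[k s]_y f y.
  rewrite [X in _ --> X](_ : _ = \int[k s]_y limn (fun n => (h_ n y)%:E)); last first.
    by apply: eq_integral => y _; rewrite (cvg_lim _ (h_cvg y)).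
  apply: cvg_monotone_convergence => //.
  - by move=> n; exact/measurable_EFinP.
  - by move=> n y _; rewrite lee_fin.
  - by move=> y _ n1 n2 /h_nd.
have : \int[l]_(s in D) \int[k s]_y (h_ n y)%:E @[n --> \oo] -->
    \int[l]_(s in D) \int[k s]_y f y.
  rewrite [X in _ --> X](_ : _ =
      \int[l]_(s in D) limn (fun n => \int[k s]_y (h_ n y)%:E)); last first.
    by apply: eq_integral => s _; rewrite (cvg_lim _ (hlim s)).
  apply: cvg_monotone_convergence => //.
  - move=> n; rewrite [X in measurable_fun _ X](_ : _ = fun s =>
        \sum_(r \in range (h_ n)) (r%:E * k s (h_ n @^-1` [set r]))).
      by apply: emeasurable_fsum => // r; apply: measurable_funeM; exact: mk.
    by apply/funext => s; rewrite integralT_nnsfun sintegralE.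
  - by move=> n s _; apply: integral_ge0 => y _; rewrite lee_fin.
  - move=> s _ n1 n2 n12; apply: ge0_le_integral => //.
    + by move=> y _; rewrite lee_fin.
    + exact/measurable_EFinP.
    + exact/measurable_EFinP.
    + by move=> y _; exact: h_nd.
move=> cv; rewrite -(cvg_lim _ cv)//.
apply: lime_le; first by apply/cvg_ex; eexists; exact: cv.
apply: nearW => n; apply: le_trans (simple (h_ n) _) _.
  move=> y /fE fy; apply/eqP; rewrite eq_le fun_ge0 andbT -lee_fin.
  by rewrite (le_trans (h_lef n y))// fy.
apply: ge0_le_integral => //.
- by move=> y _; rewrite lee_fin.
- exact/measurable_EFinP.
Qed.

End kernel_domination.

Section measure_paths_interval.
Context {R : realType}.
Variables (S : set R).
Hypothesis mS : measurable (S : set (measurableTypeR R)).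
Implicit Types (z : R -> measOn S) (m : measOn S) (f : R -> R) (x s t c : R).

Lemma measurable_path_itv z t (U : set R) : cont_path z ->
  measurable (U : set (measurableTypeR R)) ->
  measurable_fun (`[0, t]%classic : set (measurableTypeR R)) (fun s => z s U).
Proof.
move=> zc mU; apply: (eq_measurable_fun (fun s : measurableTypeR R => z (Num.max s 0) U)).
  by move=> s; rewrite inE/= in_itv/= => /andP[s0 _]; rewrite max_l.
by apply: measurable_funTS; exact: measurable_path.
Qed.

Lemma measurable_pairing_itv z f t : cont_path z -> test_fun S f ->
  measurable_fun (`[0, t]%classic : set (measurableTypeR R)) (fun s => pairing f (z s)).
Proof.
move=> zc fS; apply: (eq_measurable_fun (fun s : measurableTypeR R => pairing f (z (Num.max s 0)))).
  by move=> s; rewrite inE/= in_itv/= => /andP[s0 _]; rewrite max_l.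
by apply: measurable_funTS; exact: measurable_pairing_path.
Qed.

End measure_paths_interval.

Section sign_of_Rintegral.
Context d (T : measurableType d) (R : realType) (mu : {measure set T -> \bar R}).
Variables (D : set T) (mD : measurable D).
Implicit Types f : T -> R.

(** The default value [fine (-oo) = 0] keeps the sign even when the integral diverges. This matters
    for departure terms before their integrability is established. *)
Lemma Rintegral_le0 f : (forall x, D x -> f x <= 0) -> \int[mu]_(x in D) f x <= 0.
Proof.
move=> f0; rewrite /Rintegral; apply: fine_le0.
rewrite (eq_integral (fun x => - (- f x)%:E)%E); last first.
  by move=> x _; rewrite -EFinN opprK.
rewrite integral_ge0N; last by move=> x Dx; rewrite lee_fin oppr_ge0 f0.
by rewrite oppe_le0; apply: integral_ge0 => x Dx; rewrite lee_fin oppr_ge0 f0.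
Qed.

Lemma Rintegral_lower f c : measurable_fun D f -> (mu D <= 1)%E -> 0 <= c ->
  (forall x, D x -> - c <= f x <= 0) -> - c <= \int[mu]_(x in D) f x.
Proof.
move=> mf mu1 c0 fc; rewrite /Rintegral.
rewrite (eq_integral (fun x => - (- f x)%:E)%E); last first.
  by move=> x _; rewrite -EFinN opprK.
rewrite integral_ge0N; last first.
  by move=> x /fc/andP[_ f0]; rewrite lee_fin oppr_ge0.
have H : (\int[mu]_(x in D) (- f x)%:E <= c%:E)%E.
  apply: (@le_trans _ _ (\int[mu]_(x in D) (cst c%:E) x)%E).
    apply: ge0_le_integral => //.
    - by move=> x /fc/andP[_ f0]; rewrite lee_fin oppr_ge0.
    - by apply/measurable_EFinP; exact: measurableT_comp.
    - by move=> x /fc/andP[fx _]; rewrite lee_fin lerNl.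
  rewrite integral_cst// -[leRHS]mule1 lee_wpmul2l//.
have I0 : (0 <= \int[mu]_(x in D) (- f x)%:E)%E.
  by apply: integral_ge0 => x /fc/andP[_ f0]; rewrite lee_fin oppr_ge0.
rewrite fineN lerN2 -lee_fin fineK//.
by rewrite ge0_fin_numE// (le_lt_trans H)// ltry.
Qed.

End sign_of_Rintegral.

Section ages_facts.
Context {R : realType}.
Variables (G : R -> R).
Implicit Types (x M : R).

Lemma ages_is_interval : is_interval (ages G).
Proof.
move=> x y [x0 xH] [y0 yH] z /andP[xz zy]; split; first exact: le_trans xz.
by apply: le_lt_trans yH; rewrite lee_fin.
Qed.

Lemma measurable_ages : measurable (ages G : set (measurableTypeR R)).
Proof. exact: is_interval_measurable ages_is_interval. Qed.

Lemma ages_larger x : ages G x -> exists2 y, x < y & ages G y.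
Proof.
move=> [x0 /ereal_sup_gt[_ [y [y0 Gy] <-]]]; rewrite lte_fin => xy.
(* The midpoint is taken because [y] might be the supremum itself, while ages lie strictly below
   it. *)
exists ((x + y) / 2); first by rewrite midf_lt.
split; first by rewrite divr_ge0// addr_ge0.
apply: (@lt_le_trans _ _ y%:E); first by rewrite lte_fin midf_lt.
by apply: ereal_sup_ubound; exists y.
Qed.

End ages_facts.

Section service_cdf_facts.
Context {R : realType}.
Variables (G g : R -> R).
Hypothesis hG : service_cdf G g.
Implicit Types (x y : R).
Local Notation leb := (@lebesgue_measure R).

Lemma cdf_increment x y : 0 <= x -> x <= y ->
  ((G y)%:E = (G x)%:E + \int[leb]_(z in `]x, y]) (g z)%:E)%E.
Proof.
have [mg g0 GE _] := hG; move=> x0 xy; have y0 := le_trans x0 xy.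
rewrite !GE// (@itv_bndbnd_setU _ _ (BLeft 0) (BRight x) (BRight y)) ?bnd_simp//.
rewrite ge0_integral_setU//; try exact: measurable_itv.
- apply/measurable_EFinP; rewrite -itv_bndbnd_setU ?bnd_simp//.
  apply: measurable_funS mg; first exact: measurable_itv.
  by move=> z; rewrite /Rplus/= !in_itv/= andbT => /andP[].
- move=> z; rewrite -itv_bndbnd_setU ?bnd_simp//= in_itv/= => /andP[z0 _].
  by rewrite lee_fin g0.
- rewrite disj_set2E; apply/eqP/seteqP; split => z //=; rewrite !in_itv/=.
  by move=> [/andP[_ zx] /andP[+ _]]; rewrite ltNge zx.
Qed.

Lemma cdf_ge0 x : 0 <= x -> 0 <= G x.
Proof.
have [mg g0 GE _] := hG; move=> x0; rewrite -lee_fin GE//.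
by apply: integral_ge0 => z /=; rewrite in_itv/= => /andP[z0 _]; rewrite lee_fin g0.
Qed.

Lemma cdf_nondecreasing x y : 0 <= x -> x <= y -> G x <= G y.
Proof.
have [mg g0 GE _] := hG; move=> x0 xy; rewrite -lee_fin (cdf_increment x0 xy).
rewrite leeDl//; apply: integral_ge0 => z /=; rewrite in_itv/= => /andP[xz _].
by rewrite lee_fin g0// (le_trans x0)// ltW.
Qed.

Lemma cdf0 : G 0 = 0.
Proof.
have [mg g0 GE _] := hG; apply: EFin_inj; rewrite GE// set_itv1.
exact: integral_set1.
Qed.

Lemma cdf_lt1 x : ages G x -> G x < 1.
Proof.
move=> [x0 /ereal_sup_gt[_ [y [y0 Gy] <-]]]; rewrite lte_fin => xy.
by apply: le_lt_trans Gy; exact/cdf_nondecreasing/ltW.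
Qed.

Lemma hazard_ge0 x : ages G x -> 0 <= hazard G g x.
Proof.
have [mg g0 GE _] := hG; move=> Ax; have x0 := Ax.1.
by rewrite divr_ge0 ?g0// subr_ge0 ltW// cdf_lt1.
Qed.

End service_cdf_facts.

(** * Occupation bound on intervals of ages *)

Section occupancy.
Context {R : realType}.
Variables (G g : R -> R) (nu : R -> measOn (ages G)) (nu0 : measOn (ages G)).
Variable K : R -> R.
Hypothesis hG : service_cdf G g.
Hypothesis nuc : cont_path nu.
Hypothesis nu1 : forall t, 0 <= t -> (nu t setT <= 1)%E.
Hypothesis nu01 : (nu0 setT <= 1)%E.
Hypothesis KD : Dup K.
Hypothesis tr : transport_eq g nu nu0 K.
Implicit Types (x s t M p q c d : R).
Local Notation leb := (@lebesgue_measure R).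
Local Notation h := (hazard G g).

(** For d > 0, [ramp p d] rises linearly from 0 at p - d to 1 at p, and [psq_ramp p d] is its C^1
    primitive vanishing to the left of p - d. *)
Let psq_ramp p d x := (psq (x - p + d) - psq (x - p)) / (2 * d).
Let ramp p d x := (Num.max (x - p + d) 0 - Num.max (x - p) 0) / d.

Let is_derive_psq_ramp p d x : d != 0 -> is_derive x 1 (psq_ramp p d) (ramp p d x).
Proof.
move=> d0.
have da a : is_derive x 1 (fun y => psq (y - a)) (2 * Num.max (x - a) 0).
  have d1 : is_derive x 1 (fun y => y - a) (1 - 0).
    exact: is_deriveB.
  apply: (is_derive_eq (@is_derive1_comp _ psq _ x _ _ (is_derive_psq _) d1)).
  by rewrite subr0 mulr1.
have -> : psq_ramp p d = (fun y => (psq (y - (p - d)) - psq (y - p)) * (2 * d)^-1).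
  by apply/funext => y; rewrite /psq_ramp opprB addrA (addrAC y).
apply: (is_derive_eq (is_deriveM (is_deriveB (da (p - d)) (da p)) (is_derive_cst (2 * d)^-1 x 1))).
by rewrite /GRing.scale/= /ramp opprB addrA (addrAC x) mulr0 add0r; field.
Qed.

Let ramp_continuous p d : continuous (ramp p d).
Proof.
move=> x; apply: cvgM; last exact: cvg_cst.
apply: cvgB.
  apply: (@continuous_comp _ _ _ (fun x => x - p + d) (fun x => Num.max x 0)); last exact: continuous_pos.
  by apply: cvgD; [apply: cvgB; [exact: cvg_id|exact: cvg_cst]|exact: cvg_cst].
apply: (@continuous_comp _ _ _ (fun x => x - p) (fun x => Num.max x 0)); last exact: continuous_pos.
by apply: cvgB; [exact: cvg_id|exact: cvg_cst].
Qed.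

(** The function y |-> psq (y + d) - psq y has slope between 0 and 2 d. *)
Let psq_ramp_bounds d y z : 0 < d -> z <= y ->
  0 <= psq (y + d) - psq y - (psq (z + d) - psq z) <= (y - z) * (2 * d).
Proof.
move=> d0 zy; rewrite /psq.
have [yd|yd] := leP 0 (y + d); have [y0|y0] := leP 0 y;
have [zd|zd] := leP 0 (z + d); have [z0|z0] := leP 0 z; try lra;
by apply/andP; split; nra.
Qed.

Let mass_balance_bound (a b i j k c l : R) : a = b + i - j + k -> a <= 0 ->
  - c <= b -> j <= 0 -> - c * l <= k -> i <= (1 + l) * c.
Proof. by move=> ? ? ? ? ?; lra. Qed.

(** The test function [U] takes values in [-c, 0] with c = q - p + d, and its derivative [U'] lies
    between the indicator of [p, q] and 1. In the balance of [U], the masses at time [t] and the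
    departures have a favourable sign. The initial mass, at most 1, and the entries [K t] cost at
    most [c] per unit, which gives (1 + K t) c; then d tends to 0. *)
Lemma occupancy_itv p q M t : 0 <= p -> p <= q -> q <= M -> ages G M -> 0 <= t ->
  (\int[leb]_(s in `[0%R, t]) nu s `[p, q]%classic <= ((1 + K t) * (q - p))%:E)%E.
Proof.
move=> p0 pq qM AM t0; have [N MN AN] := ages_larger AM.
have Kt0 : 0 <= K t by have [_ + _] := KD; apply.
suff H d : 0 < d -> d <= N - M ->
    (\int[leb]_(s in `[0%R, t]) nu s `[p, q]%classic <= ((1 + K t) * (q - p + d))%:E)%E.
  apply/lee_addgt0Pr => e e0.
  pose d := Num.min (N - M) (e / (1 + K t)).
  have d0 : 0 < d by rewrite lt_min subr_gt0 MN divr_gt0// ltr_wpDr.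
  apply: le_trans (H d d0 _) _; first by rewrite ge_min lexx.
  rewrite -EFinD lee_fin mulrDr lerD2l mulrC -ler_pdivlMr ?ltr_wpDr//.
  by rewrite ge_min lexx orbT.
move=> d0 dN.
pose U' x := ramp p d x - ramp (q + d) d x.
(* The subtracted constant is the value of the difference of primitives beyond q + d, so that [U]
   vanishes there and is nonpositive everywhere. *)
pose U x := psq_ramp p d x - psq_ramp (q + d) d x - (q - p + d).
have dU x : is_derive x 1 U (U' x).
  have d00 : d != 0 by rewrite gt_eqF.
  apply: (is_derive_eq (is_deriveB (is_deriveB (is_derive_psq_ramp p x d00) (is_derive_psq_ramp (q + d) x d00)) (is_derive_cst (q - p + d) x 1))).
  by rewrite subr0.
have cU' : continuous U' by move=> x; apply: cvgB; exact: ramp_continuous.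
have U'01 x : 0 <= U' x <= 1.
  rewrite /U' /ramp -mulrBl.
  rewrite divr_ge0 ?(ltW d0)//= ?ler_pdivrMr ?mul1r// !maxEge.
    by do 4 case: ifPn => ?; lra.
  by do 4 case: ifPn => ?; lra.
have U'1 x : p <= x -> x <= q -> U' x = 1.
  move=> px xq; rewrite /U' /ramp -mulrBl.
  transitivity (d / d); last by rewrite divff// gt_eqF.
  congr (_ / _).
  rewrite (max_l (_ : 0 <= x - p + d)); last lra.
  rewrite (max_l (_ : 0 <= x - p)); last lra.
  rewrite (max_r (_ : x - (q + d) + d <= 0)); last lra.
  rewrite (max_r (_ : x - (q + d) <= 0)); last lra.
  lra.
have Ub x : - (q - p + d) <= U x <= 0.
  rewrite /U; set u := psq_ramp p d x - _.
  suff : 0 <= u <= q - p + d by move=> /andP[? ?]; apply/andP; split; lra.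
  have d2 : 0 < 2 * d by rewrite mulr_gt0.
  have xx : x - (q + d) <= x - p by lra.
  have /andP[u0 u1] := @psq_ramp_bounds d (x - p) (x - (q + d)) d0 xx.
  rewrite /u /psq_ramp -mulrBl divr_ge0 ?(ltW d2)//= ler_pdivrMr//.
  by apply: le_trans u1 _; rewrite ler_pM2r//; lra.
have Uout x : N < x -> U x = 0.
  move=> Nx; rewrite /U /psq_ramp /psq.
  rewrite (max_l (_ : 0 <= x - p + d)); last lra.
  rewrite (max_l (_ : 0 <= x - p)); last lra.
  rewrite (max_l (_ : 0 <= x - (q + d) + d)); last lra.
  rewrite (max_l (_ : 0 <= x - (q + d))); last lra.
  by field; rewrite gt_eqF.
pose c := q - p + d; have c0 : 0 <= c by rewrite /c; lra.
have mA := measurable_ages G.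
have dcst x : is_derive x 1 (cst 1 : R -> R) ((cst 0 : R -> R) x).
  exact: is_derive_cst.
have ccst : continuous (cst 0 : R -> R) by move=> x; exact: cvg_cst.
have supp x s : ages G x -> 0 <= s -> s <= t + 1 -> N < x -> U x * cst 1 (x - s) = 0.
  by move=> _ _ _ /Uout ->; rewrite mul0r.
have E := @transport_identity R G g nu nu0 K U U' _ _ N 1 t tr t0 ltr01 AN
  (fun x _ => dU x) (fun x _ => cU' x) dcst ccst supp.
have mU S : measurable_fun S (fun x : measurableTypeR R => U x * cst 1 x).
  apply: measurable_funTS; apply: measurable_funM; last exact: measurable_cst.
  apply: continuous_measurable_fun => x; apply: differentiable_continuous.
  by apply/derivable1_diffP; have [] := dU x.
have E1 : pairing (fun x => U x * cst 1 (x - t)) (nu t) <= 0.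
  by apply: Rintegral_le0 => x _; rewrite mulr1; have /andP[] := Ub x.
have E2 : - c <= pairing (fun x => U x * cst 1 x) nu0.
  apply: Rintegral_lower => //.
  - by rewrite (le_trans _ nu01)// le_measure ?inE.
  - by move=> x _; rewrite mulr1 Ub.
have E3 : \int[leb]_(s in `[0, t]) pairing (fun x => h x * (U x * cst 1 (x - s))) (nu s) <= 0.
  apply: Rintegral_le0 => s _; apply: Rintegral_le0 => x Ax.
  rewrite mulr1 mulr_ge0_le0 ?(hazard_ge0 hG)//; by have /andP[] := Ub x.
have E4 : - c * K t <= \int[stieltjes K]_(s in `[0, t]) (U 0 * cst 1 (- s)).
  rewrite (@eq_Rintegral _ _ _ _ _ (cst (U 0))); last by move=> s _; rewrite mulr1.
  rewrite Rintegral_cst//.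
  rewrite stieltjes_itvcc//= ler_wpM2r//.
  by have /andP[] := Ub 0.
have E5 : \int[leb]_(s in `[0, t]) pairing (fun x => U' x * cst 1 (x - s)) (nu s) <= (1 + K t) * c.
  exact: mass_balance_bound E E1 E2 E3 E4.
have tU' : test_fun (ages G) U'.
  by apply: (@bounded_test_fun _ _ _ 1) => // x; have /andP[? ?] := U'01 x; rewrite ger0_norm.
have mI : measurable (`[0, t]%classic : set (measurableTypeR R)) by exact: measurable_itv.
have IU0 (m : measOn (ages G)) : (0 <= \int[m]_(x in ages G) (U' x)%:E)%E.
  by apply: integral_ge0 => x _; rewrite lee_fin; have /andP[] := U'01 x.
have IU1 (m : measOn (ages G)) : (m setT <= 1)%E ->
    (\int[m]_(x in ages G) (U' x)%:E <= 1)%E.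
  move=> m1; apply: (@le_trans _ _ (m (ages G))); last first.
    by rewrite (le_trans _ m1)// le_measure ?inE.
  rewrite -[leRHS]mul1e -integral_cst//; apply: ge0_le_integral => //.
  - by move=> x _; rewrite lee_fin; have /andP[] := U'01 x.
  - by apply/measurable_EFinP/measurable_funTS; exact: continuous_measurable_fun.
  - by move=> x _; rewrite /= lee_fin; have /andP[] := U'01 x.
have fU (m : measOn (ages G)) : (m setT <= 1)%E -> (\int[m]_(x in ages G) (U' x)%:E)%E \is a fin_num.
  by move=> m1; rewrite ge0_fin_numE ?IU0// (le_lt_trans (IU1 _ m1))// ltry.
have pU' (m : measOn (ages G)) : (m setT <= 1)%E ->
    (m `[p, q]%classic <= (pairing U' m)%:E)%E.
  move=> m1.
  have mpq : measurable (`[p, q]%classic : set (measurableTypeR R)) by exact: measurable_itv.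
  rewrite /pairing /Rintegral fineK ?fU//.
  have -> : m `[p, q]%classic = (\int[m]_(x in ages G) (\1_`[p, q] x)%:E)%E.
    by rewrite integral_indic//; exact/esym/measOn_setI.
  apply: ge0_le_integral => //.
  - by apply/measurable_EFinP/measurable_funTS; exact: measurable_indic.
  - by apply/measurable_EFinP/measurable_funTS; exact: continuous_measurable_fun.
  - move=> x _; rewrite lee_fin indicE mem_setE in_itv/=; have [/andP[px xq]|_] := boolP (p <= x <= q).
      by rewrite U'1.
    by have /andP[] := U'01 x.
apply: (@le_trans _ _ (\int[leb]_(s in `[0%R, t]) (pairing U' (nu s))%:E)%E).
  apply: ge0_le_integral => //.
  - by apply: measurable_path_itv => //; exact: measurable_itv.
  - by apply/measurable_EFinP; exact: measurable_pairing_itv.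
  - move=> s /=; rewrite in_itv/= => /andP[s0 _]; apply: pU'; exact: nu1.
have -> : (\int[leb]_(s in `[0%R, t]) (pairing U' (nu s))%:E)%E =
   (\int[leb]_(s in `[0, t]) pairing (fun x => U' x * cst 1 (x - s)) (nu s))%:E.
  rewrite (@eq_Rintegral _ _ _ leb `[0, t]%classic (fun s => pairing U' (nu s))); last first.
    by move=> s _; apply: pairing_eq => x _; rewrite mulr1.
  have I0 : (0 <= \int[leb]_(s in `[0%R, t]) (pairing U' (nu s))%:E)%E.
    apply: integral_ge0 => s _; rewrite lee_fin; apply: Rintegral_ge0 => x _.
    by have /andP[] := U'01 x.
  rewrite /Rintegral fineK// ge0_fin_numE//.
  apply: (@le_lt_trans _ _ (\int[leb]_(s in `[0%R, t]) (cst 1%E) s)%E); last first.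
    by rewrite integral_cst//= mul1e lebesgue_measure_itv/=; case: ifPn; rewrite ?ltry// -EFinB ltry.
  apply: ge0_le_integral => //.
  - move=> s _; rewrite lee_fin; apply: Rintegral_ge0 => x _.
    by have /andP[] := U'01 x.
  - by apply/measurable_EFinP; exact: measurable_pairing_itv.
  - move=> s /=; rewrite in_itv/= => /andP[s0 _]; rewrite lee_fin.
    by rewrite -lee_fin /pairing /Rintegral fineK ?fU ?IU1// nu1.
by rewrite lee_fin.
Qed.

End occupancy.

Section occupancy_functions.
Context {R : realType}.
Variables (G g : R -> R) (nu : R -> measOn (ages G)) (nu0 : measOn (ages G)).
Variable K : R -> R.
Hypothesis hG : service_cdf G g.
Hypothesis nuc : cont_path nu.
Hypothesis nu1 : forall t, 0 <= t -> (nu t setT <= 1)%E.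
Hypothesis nu01 : (nu0 setT <= 1)%E.
Hypothesis KD : Dup K.
Hypothesis tr : transport_eq g nu nu0 K.
Implicit Types (x s t M p q a b c d : R).
Local Notation leb := (@lebesgue_measure R).
Local Notation h := (hazard G g).

Lemma occupancy_ocitv a b M t : ages G M -> 0 <= t ->
  (\int[leb]_(s in `[0%R, t]) nu s (`]a, b]%classic `&` `[0%R, M]%classic) <=
   (1 + K t)%:E * leb `]a, b]%classic)%E.
Proof.
move=> AM t0; have M0 : 0 <= M by case: AM.
have Kt0 : 0 <= K t by have [_ + _] := KD; apply.
have [ab|ba] := ltP a b; last first.
  have -> : `]a, b]%classic = set0 by rewrite set_itv_ge// bnd_simp -leNgt.
  rewrite set0I integral0_eq; last by move=> s _; rewrite measure0.
  by rewrite mule_ge0// lee_fin addr_ge0.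
pose p := Num.max a 0; pose q := Num.min b M.
have [pq|qp] := leP p q; last first.
  rewrite integral0_eq ?mule_ge0 ?lee_fin ?addr_ge0// => s _.
  rewrite (_ : _ `&` _ = set0) ?measure0//; apply/seteqP; split => x //=.
  rewrite !in_itv/= => -[/andP[ax xb] /andP[x0 xM]].
  move: qp; rewrite /p /q gt_min !lt_max => /orP[/orP[]|/orP[]] ?; lra.
apply: le_trans (_ : (((1 + K t) * (q - p))%:E <= _)%E); last first.
  rewrite lebesgue_measure_itv/= lte_fin ab -EFinB -EFinM lee_fin ler_wpM2l ?addr_ge0//.
  have : q <= b by rewrite /q ge_min lexx.
  have : a <= p by rewrite /p le_max lexx.
  lra.
have p0 : 0 <= p by rewrite /p le_max lexx orbT.
have qM : q <= M by rewrite /q ge_min lexx orbT.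
apply: le_trans (occupancy_itv hG nuc nu1 nu01 KD tr p0 pq qM AM t0).
have mA := measurable_ages G.
apply: ge0_le_integral => //.
- apply: measurable_path_itv => //; apply: measurableI; exact: measurable_itv.
- by apply: measurable_path_itv => //; exact: measurable_itv.
- move=> s _; rewrite le_measure ?inE//.
  + by apply: measurableI; exact: measurable_itv.
  + move=> x /=; rewrite !in_itv/= => -[/andP[ax xb] /andP[x0 xM]].
    by rewrite ge_max le_min (ltW ax) x0 xb xM.
Qed.

(** Lebesgue measure is an infimum over countable covers by half-open intervals; for each cover, the
    interval bound and countable subadditivity of [nu s] give the estimate. *)
Lemma occupancy_set (A : set R) M t : ages G M -> 0 <= t ->
  measurable (A : set (measurableTypeR R)) -> A `<=` `[0, M]%classic ->
  (\int[leb]_(s in `[0%R, t]) nu s A <= (1 + K t)%:E * leb A)%E.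
Proof.
move=> AM t0 mA AM'.
have mAg := measurable_ages G.
have Kt0 : 0 <= K t by have [_ + _] := KD; apply.
have K10 : 0 < 1 + K t by rewrite ltr_wpDr.
rewrite -lee_pdivrMl//.
have -> : leb A = ereal_inf [set (\sum_(k <oo) wlength idfun (F k))%E |
    F in @measurable_cover _ (ocitv_type R) A] by [].
apply: le_ereal_inf_tmp => _ [F [mF AF] <-].
rewrite lee_pdivrMl//.
have mFn n : measurable (F n : set (measurableTypeR R)) by exact: sub_sigma_algebra.
have lebF n : wlength idfun (F n) = leb (F n).
  rewrite /lebesgue_measure /lebesgue_stieltjes_measure /measure_extension/=.
  by rewrite measurable_mu_extE//; exact: mF.
apply: (@le_trans _ _ (\int[leb]_(s in `[0%R, t]) \sum_(n <oo) nu s (F n `&` `[0%R, M]%classic))%E).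
  apply: ge0_le_integral => //.
  - exact: measurable_path_itv.
  - apply: ge0_emeasurable_sum => // n _.
    by apply: measurable_path_itv => //; apply: measurableI => //; exact: measurable_itv.
  - move=> s _; apply: measure_sigma_subadditive => //.
    + by move=> n; apply: measurableI => //; exact: measurable_itv.
    + by move=> x Ax; have [n _ Fx] := AF x Ax; exists n => //; split => //; exact: AM'.
rewrite integral_nneseries//; last first.
  by move=> n; apply: measurable_path_itv => //; apply: measurableI => //; exact: measurable_itv.
rewrite -nneseriesZl//.
apply: lee_nneseries => [n _ _|n _].
  by apply: integral_ge0.
rewrite lebF; have := mF n; rewrite /= => -[[a b] _ <-].
exact: occupancy_ocitv.
Qed.

Lemma occupancy_fun (f : R -> \bar R) M t : ages G M -> 0 <= t ->
  measurable_fun setT (f : measurableTypeR R -> \bar R) ->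
  (forall x, 0 <= f x)%E -> (forall x, ~ (0 <= x <= M) -> f x = 0%E) ->
  (\int[leb]_(s in `[0%R, t]) \int[nu s]_x f x <= (1 + K t)%:E * \int[leb]_x f x)%E.
Proof.
move=> AM t0 mf f0 fM.
have mAg := measurable_ages G.
have Kt0 : 0 <= K t by have [_ + _] := KD; apply.
have K10 : 0 <= 1 + K t by rewrite addr_ge0.
have -> : ((1 + K t)%:E * \int[leb]_x f x = \int[mscale (NngNum K10) leb]_x f x)%E.
  by rewrite ge0_integral_mscale.
apply: (@kernel_integral_le _ _ _ _ _ leb `[0, t]%classic nu (mscale (NngNum K10) leb) _ _ `[0, M]%classic) => //.
- by move=> U mU; exact: measurable_path_itv.
- by move=> A mA AM'; apply: le_trans (occupancy_set AM t0 mA AM') _.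
Qed.

End occupancy_functions.

(** * The inverse survival function *)

Section quadratic_increments.
Context {R : realType}.
Implicit Types (f D : R -> R) (x y C M : R).

(** [D] has zero derivative with respect to [f]. Cutting the range of [f], not its domain, into
    steps of height [d] by the intermediate value theorem bounds the variation of [D] by C d times
    that of [f], for every d > 0. In this way [f] is not differentiated. *)
Lemma quadratic_increment_const f D C M : 0 <= C ->
  {within `[0, M], continuous f} ->
  (forall x y, 0 <= x -> x <= y -> y <= M -> f x <= f y) ->
  (forall x y, 0 <= x -> x <= y -> y <= M ->
    `|D y - D x| <= C * (f y - f x) ^+ 2) ->
  forall x, 0 <= x -> x <= M -> D x = D 0.
Proof.
move=> C0 fc fnd HD x x0 xM.
have H d n y : 0 < d -> 0 <= y -> y <= M -> f y - f 0 <= n%:R * d ->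
    `|D y - D 0| <= C * d * (f y - f 0).
  move=> d0; elim: n y => [|n IH] y y0 yM fy.
    apply: le_trans (HD _ _ _ y0 yM) _ => //.
    have f0y := fnd _ _ (lexx 0) y0 yM.
    by rewrite (_ : f y - f 0 = 0) ?expr0n ?mulr0//; lra.
  have [fyn|nfy] := leP (f y - f 0) (n%:R * d); first exact: IH.
  have [z] : exists2 z, z \in `[0, y] & f z = f 0 + n%:R * d.
    apply: IVT => //.
      by apply: continuous_subspaceW fc => z /=; rewrite !in_itv/= => /andP[-> /le_trans]; apply.
    have f0y := fnd _ _ (lexx 0) y0 yM.
    rewrite (min_l f0y) (max_r f0y) lerDl mulr_ge0 ?ler0n ?(ltW d0)//=.
    by move: nfy; lra.
  rewrite in_itv/= => /andP[z0 zy] fz.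
  have zM := le_trans zy yM.
  have := IH z z0 zM; rewrite fz addrC addKr => /(_ (lexx _)) Dz.
  have Dyz := HD z y z0 zy yM.
  have fzy := fnd _ _ z0 zy yM.
  have fyd : f y - f z <= d by rewrite fz; move: fy; rewrite -natr1 mulrDl mul1r; lra.
  rewrite -(subrK (D z) (D y)) -addrA; apply: le_trans (ler_normD _ _) _.
  rewrite (_ : f y - f 0 = (f y - f z) + n%:R * d); last by rewrite fz; lra.
  rewrite mulrDr lerD//; apply: le_trans Dyz _.
  by rewrite expr2 -mulrA ler_wpM2l// ler_wpM2r// subr_ge0.
apply/eqP; rewrite -subr_eq0 -normr_le0; apply/ler_addgt0Pr => e e0; rewrite add0r.
have fx0 : 0 <= f x - f 0 by rewrite subr_ge0; exact: fnd.
pose d := e / (C * (f x - f 0) + 1).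
have den : 0 < C * (f x - f 0) + 1 by rewrite ltr_wpDl// mulr_ge0.
have d0 : 0 < d by rewrite divr_gt0.
have [n fn] : exists n, f x - f 0 <= n%:R * d.
  exists (Num.truncn ((f x - f 0) / d)).+1; rewrite -ler_pdivrMr//.
  exact/ltW/truncnS_gt.
apply: le_trans (H d n x d0 x0 xM fn) _.
rewrite mulrAC.
by rewrite /d mulrA ler_pdivrMr// mulrC ler_wpM2l ?(ltW e0)// lerDl.
Qed.

End quadratic_increments.

Section survival.
Context {R : realType}.
Variables (G g : R -> R).
Hypothesis hG : service_cdf G g.
Implicit Types (x y M e : R).
Local Notation leb := (@lebesgue_measure R).
Local Notation h := (hazard G g).

Definition inv_survival x := (1 - G x)^-1.
Local Notation W := inv_survival.

Lemma hazardM x : h x * W x = g x * W x ^+ 2.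
Proof. by rewrite /hazard -/(W x) expr2 mulrA. Qed.

Lemma inv_survival0 : W 0 = 1.
Proof. by rewrite /W (cdf0 hG) subr0 invr1. Qed.

Lemma inv_survival_gt0 x : ages G x -> 0 < W x.
Proof. by move=> Ax; rewrite invr_gt0 subr_gt0 (cdf_lt1 hG). Qed.

Lemma inv_survival_nd x y : 0 <= x -> x <= y -> ages G y -> W x <= W y.
Proof.
move=> x0 xy Ay; have Gy := cdf_lt1 hG Ay; have Gxy := cdf_nondecreasing hG x0 xy.
by rewrite lef_pV2 ?posrE ?subr_gt0//; lra.
Qed.

Lemma measurable_cdf : measurable_fun (Rplus : set (measurableTypeR R)) G.
Proof.
apply: (eq_measurable_fun (fun x : measurableTypeR R => G (Num.max x 0))).
  by move=> x; rewrite inE/= /Rplus/= in_itv/= andbT => x0; rewrite max_l.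
apply: nondecreasing_measurable; first exact: measurable_itv.
move=> x y xy; apply: (cdf_nondecreasing hG); first by rewrite le_max lexx orbT.
by rewrite ge_max !le_max xy lexx orbT.
Qed.

Lemma measurable_inv_survival : measurable_fun (Rplus : set (measurableTypeR R)) W.
Proof.
apply: (@measurable_comp _ _ _ _ _ _ setT (fun x : R => x^-1)) => //.
  rewrite -(setUv [set 0%R]); apply/measurable_funU => //.
    exact: measurableC.
  split; first exact: measurable_fun_set1.
  apply: open_continuous_measurable_fun.
    by rewrite openC; exact: accessible_closed_set1 (hausdorff_accessible (@Rhausdorff R)) _.
  by move=> x; rewrite inE => /eqP; exact: inv_continuous.
by apply: measurable_funB => //; exact: measurable_cdf.
Qed.

Lemma measurable_hazard : measurable_fun (Rplus : set (measurableTypeR R)) h.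
Proof.
have [mg _ _ _] := hG; apply: measurable_funM => //.
exact: measurable_inv_survival.
Qed.

Lemma itv_Rplus M : `[0, M]%classic `<=` (@Rplus R).
Proof. by move=> x; rewrite /Rplus/= !in_itv/= andbT => /andP[]. Qed.

Lemma integrable_density M : 0 <= M -> leb.-integrable `[0, M] (EFin \o g).
Proof.
have [mg g0 GE _] := hG; move=> M0; apply/integrableP; split.
  apply/measurable_EFinP; apply: measurable_funS mg; first exact: measurable_itv.
  exact: itv_Rplus.
rewrite (_ : (\int[leb]_(x in _) _)%E = (G M)%:E) ?ltry// GE//.
apply: eq_integral => x; rewrite inE/= in_itv/= => /andP[x0 _].
by rewrite ger0_norm ?g0.
Qed.

Lemma cdf_continuous M : 0 <= M -> {within `[0, M], continuous G}.
Proof.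
have [mg g0 GE _] := hG; move=> M0.
have := parameterized_integral_continuous M0 (integrable_density M0).
apply: subspace_eq_continuous => x; rewrite inE/= in_itv/= => /andP[x0 _].
by apply: EFin_inj; rewrite /from_subspace GE//= /parameterized_integral/= /Rintegral fineK// -GE.
Qed.

Lemma integrable_hazard_survival M : ages G M ->
  leb.-integrable `[0, M] (EFin \o (fun x => h x * W x)).
Proof.
have [mg g0 GE _] := hG; move=> AM; have M0 := AM.1.
have mI : measurable (`[0, M]%classic : set (measurableTypeR R)) by exact: measurable_itv.
have iM := integrableZl mI (W M ^+ 2) (integrable_density M0).
apply: le_integrable iM => //.
- apply/measurable_EFinP/measurable_funM.
    by apply: measurable_funS measurable_hazard; [exact: measurable_itv|exact: itv_Rplus].
  by apply: measurable_funS measurable_inv_survival; [exact: measurable_itv|exact: itv_Rplus].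
- move=> x /=; rewrite in_itv/= => /andP[x0 xM].
  have Ax := ages_itv AM; have {}Ax : ages G x by apply: Ax; rewrite /= in_itv/= x0.
  have Wx := inv_survival_gt0 Ax; have WM := inv_survival_nd x0 xM AM.
  have WM0 := le_trans (ltW Wx) WM.
  rewrite lee_fin hazardM !ger0_norm ?mulr_ge0 ?g0 ?sqr_ge0//.
  rewrite (mulrC (g x)) ler_wpM2r ?g0//.
  by rewrite lerXn2r ?nnegrE ?(ltW Wx).
  all: exact: ltW.
Qed.

Lemma cdf_Rintegral x y : 0 <= x -> x <= y ->
  G y - G x = \int[leb]_(u in `]x, y]) g u.
Proof.
have [mg g0 GE _] := hG; move=> x0 xy; have y0 := le_trans x0 xy.
have GR z : 0 <= z -> G z = \int[leb]_(u in `[0, z]) g u.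
  by move=> z0; rewrite /Rintegral -GE.
rewrite !GR//; apply: Rintegral_itvB; rewrite ?bnd_simp//.
exact: integrable_density.
Qed.

Let subr_interchange (a b c d : R) : (a - b) - (c - d) = (a - c) - (b - d).
Proof. by ring. Qed.

Let is_derive_shift (f : R -> R) c x l : is_derive x 1 f l ->
  is_derive x 1 (fun y => f y - c) l.
Proof.
move=> df; apply: (is_derive_eq (is_deriveB df (is_derive_cst c x 1))).
by rewrite subr0.
Qed.

(** Here [a] is an increment of [G] and the [w] are values of [W]. From wz - wy = a wy wz, the
    distance of wz - wy to wy^2 a and to wz^2 a is a^2 times a product of three values of [W]. *)
Let squared_increment_bound (a wy wz wx i : R) : 0 <= a -> 0 <= wy -> wy <= wz ->
  wz <= wx -> wz - wy = a * (wy * wz) -> wy ^+ 2 * a <= i -> i <= wz ^+ 2 * a ->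
  `|wz - wy - i| <= wx ^+ 3 * a ^+ 2.
Proof.
move=> a0 wy0 wyz wzx E i1 i2.
have wz0 := le_trans wy0 wyz; have wx0 := le_trans wz0 wzx; have wyx := le_trans wyz wzx.
have b1 : wz - wy - wy ^+ 2 * a = a ^+ 2 * (wy * wy * wz).
  rewrite {1}E (_ : _ - _ = a * wy * (wz - wy)); last by ring.
  by rewrite E; ring.
have b2 : wz ^+ 2 * a - (wz - wy) = a ^+ 2 * (wy * wz * wz).
  rewrite {1}E (_ : _ - _ = a * wz * (wz - wy)); last by ring.
  by rewrite E; ring.
have c1 : a ^+ 2 * (wy * wy * wz) <= wx ^+ 3 * a ^+ 2.
  rewrite [leRHS]mulrC ler_wpM2l ?sqr_ge0// !exprS expr0 mulr1 mulrA.
  by apply: ler_pM; rewrite ?mulr_ge0//; apply: ler_pM.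
have c2 : a ^+ 2 * (wy * wz * wz) <= wx ^+ 3 * a ^+ 2.
  rewrite [leRHS]mulrC ler_wpM2l ?sqr_ge0// !exprS expr0 mulr1 mulrA.
  by apply: ler_pM; rewrite ?mulr_ge0//; apply: ler_pM.
have c0 : 0 <= wx ^+ 3 * a ^+ 2 by rewrite mulr_ge0 ?sqr_ge0 ?exprn_ge0.
by rewrite ler_norml; apply/andP; split; lra.
Qed.

(** As [g] is only integrable, the identity W' = h W cannot be integrated pointwise. Instead, since
    h W = g W^2 and [W] is monotone, both sides change over [y, z] by the same amount up to O((G z -
    G y)^2), so their difference is constant. *)
Lemma inv_survivalE x : ages G x ->
  W x = 1 + \int[leb]_(u in `[0, x]) (h u * W u).
Proof.
have [mg g0 GE _] := hG; move=> Ax; have x0 := Ax.1.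
pose I y := \int[leb]_(u in `[0, y]) (h u * W u).
pose D y := W y - I y.
suff : D x = D 0.
  by rewrite /D /I set_itv1 Rintegral_set1 subr0 inv_survival0 => /eqP; rewrite subr_eq => /eqP.
apply: (@quadratic_increment_const _ G D (W x ^+ 3) x) => //.
- by rewrite exprn_ge0// ltW// inv_survival_gt0.
- exact: cdf_continuous.
- by move=> y z y0 yz _; exact: (cdf_nondecreasing hG).
move=> y z y0 yz zx.
have Az : ages G z by apply: (ages_itv Ax); rewrite /= in_itv/= (le_trans y0).
have Ay : ages G y by apply: (ages_itv Ax); rewrite /= in_itv/= y0 (le_trans yz).
have Gyz := cdf_nondecreasing hG y0 yz.
have Wy := inv_survival_gt0 Ay; have Wyz := inv_survival_nd y0 yz Az.
have Wzx := inv_survival_nd (le_trans y0 yz) zx Ax.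
have WE : W z - W y = (G z - G y) * (W y * W z).
  have := cdf_lt1 hG Ay; have := cdf_lt1 hG Az; rewrite /W => G1 G2.
  by field; apply/andP; split; rewrite subr_eq0; apply/eqP => ?; lra.
have IE : W y ^+ 2 * (G z - G y) <= I z - I y <= W z ^+ 2 * (G z - G y).
  have iz := integrable_hazard_survival Az.
  have iyz : leb.-integrable `]y, z] (EFin \o (fun u => h u * W u)).
    apply: integrableS iz; [exact: measurable_itv|exact: measurable_itv|].
    by move=> u /=; rewrite !in_itv/= => /andP[/ltW/(le_trans y0)->].
  have igyz : leb.-integrable `]y, z] (EFin \o g).
    apply: integrableS (integrable_density (le_trans y0 yz)); [exact: measurable_itv|exact: measurable_itv|].
    by move=> u /=; rewrite !in_itv/= => /andP[/ltW/(le_trans y0)->].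
  have mI : measurable (`]y, z]%classic : set (measurableTypeR R)) by exact: measurable_itv.
  rewrite /I Rintegral_itvB ?bnd_simp// cdf_Rintegral// -!RintegralZl//.
  have gW u : y < u -> u <= z -> W y ^+ 2 * g u <= h u * W u <= W z ^+ 2 * g u.
    move=> yu uz; have u0 := le_trans y0 (ltW yu).
    have Au : ages G u by apply: (ages_itv Az); rewrite /= in_itv/= u0.
    have W1 := inv_survival_nd y0 (ltW yu) Au; have W2 := inv_survival_nd u0 uz Az.
    have Wu := inv_survival_gt0 Au; have Wz := inv_survival_gt0 Az.
    rewrite hazardM (mulrC (g u)) !ler_wpM2r ?g0//= lerXn2r ?nnegrE ?(ltW Wu) ?(ltW Wy) ?(ltW Wz)//.
  apply/andP; split; apply: le_Rintegral => //.
  - exact: (integrableZl mI (W y ^+ 2) igyz).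
  - by move=> u /=; rewrite in_itv/= => /andP[yu uz]; have /andP[] := gW u yu uz.
  - exact: (integrableZl mI (W z ^+ 2) igyz).
  - by move=> u /=; rewrite in_itv/= => /andP[yu uz]; have /andP[] := gW u yu uz.
rewrite /D.
rewrite subr_interchange.
by have /andP[] := IE; apply: squared_increment_bound => //; rewrite ?subr_ge0 ?(ltW Wy).
Qed.

Lemma primitive_exists (f : R -> R) : continuous f ->
  exists F : R -> R, (forall x, 0 <= x -> is_derive x 1 F (f x)) /\
    (forall x, 0 <= x -> F x = \int[leb]_(u in `[0, x]) f u).
Proof.
move=> fc.
have ifc a b : leb.-integrable `[a, b] (EFin \o f).
  by apply: continuous_compact_integrable; [exact: segment_compact|exact: continuous_subspaceT].
(* Starting the integral at -1 gives a two-sided derivative at 0 as well. *)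
pose F0 x := \int[leb]_(u in `[-1, x]) f u; pose F x := F0 x - F0 0.
exists F; split=> x x0.
  have x1 : -1 < x by lra.
  have xx : x < x + 1 by lra.
  have [dF F'] : derivable F0 x 1 /\ derive1 F0 x = f x.
    exact: (@continuous_FTC1_closed R f (-1) x (x + 1) xx (ifc _ _) x1 (fc x)).
  have dF0 : is_derive x 1 F0 (f x) by split => //; rewrite -derive1E.
  exact: (@is_derive_shift F0 (F0 0) x (f x) dF0).
rewrite /F /F0 Rintegral_itvB ?bnd_simp ?lerN10//.
by rewrite Rintegral_itv_obnd_cbnd//; apply: integrableS (ifc 0 x) => //;
  exact: subset_itv_oc_cc.
Qed.

(** [P'] is the positive part of a continuous L^1 approximation of [h W]. Since h W >= 0, taking the
    positive part does not increase the error, and it gives P >= 1 for P = 1 + int P'. Uniform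
    closeness to [W] follows by integrating. *)
Lemma survival_approx M e : ages G M -> 0 < e ->
  exists P P' : R -> R,
  [/\ forall x, 0 <= x -> is_derive x 1 P (P' x), continuous P',
      forall x, 0 <= P' x, P 0 = 1 &
      (forall x, 0 <= x -> x <= M -> 1 <= P x /\ `|P x - W x| <= e) /\
      (\int[leb]_(x in `[0%R, M]) `|P' x - h x * W x|%:E <= e%:E)%E].
Proof.
move=> AM e0; have M0 := AM.1.
have iw := integrable_hazard_survival AM.
have lebM : (leb `[0%R, M]%classic < +oo)%E.
  by rewrite lebesgue_measure_itv/=; case: ifPn; rewrite ?ltry// -EFinB ltry.
have mI : measurable (`[0, M]%classic : set (measurableTypeR R)) by exact: measurable_itv.
have mw := measurable_int _ iw.
have [] := @approximation_continuous_integrable R `[0, M]%classic (fun x => h x * W x) _ _ iw.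
- exact: measurable_itv.
- exact: lebM.
move=> p_ [pc pint pcv].
have [n _ /(_ n (leqnn n)) pn] : \forall n \near \oo,
    (\int[leb]_(z in `[0%R, M]) `|(h z * W z - p_ n z)%:E| <= e%:E)%E.
  have /fine_cvgP[_ /cvgrPdist_le/(_ e e0)] := pcv.
  apply: filterS => n; rewrite sub0r normrN /= => /(le_trans (ler_norm _)).
  rewrite -lee_fin fineK//; apply: integrable_fin_num => //.
  by apply: (@integrable_norm _ _ _ leb _ (fun x => h x * W x - p_ n x));
    exact: (integrableB mI iw (pint n)).
pose P' x := Num.max (p_ n x) 0.
have cP' : continuous P'.
  move=> x; apply: (@continuous_comp _ _ _ (p_ n) (fun z => Num.max z 0)); first exact: pc.
  exact: continuous_pos.
have [F [dF FE]] := primitive_exists cP'.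
exists (fun x => F x - (- 1)), P'.
have IE : (\int[leb]_(x in `[0%R, M]) `|P' x - h x * W x|%:E <= e%:E)%E.
  apply: le_trans pn; apply: ge0_le_integral => //.
  - apply/measurable_EFinP; apply: measurableT_comp => //; apply: measurable_funB => //.
      by apply/measurable_funTS; apply: continuous_measurable_fun; exact: cP'.
    exact/measurable_EFinP.
  - apply/measurable_EFinP; apply: measurableT_comp => //; apply: measurable_funB => //.
      exact/measurable_EFinP.
    by apply/measurable_funTS; apply: continuous_measurable_fun; exact: pc.
  - move=> x /=; rewrite in_itv/= => /andP[x0 xM].
    have Ax : ages G x by apply: (ages_itv AM); rewrite /= in_itv/= x0.
    have hW : 0 <= h x * W x by rewrite mulr_ge0 ?(hazard_ge0 hG)// ltW// inv_survival_gt0.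
    rewrite lee_fin /P' (distrC (h x * W x)); have [p0|p0] := leP 0 (p_ n x).
      by [].
    by rewrite !ler0_norm; lra.
split => //.
- by move=> x x0; exact: (@is_derive_shift F (- 1) x (P' x) (dF x x0)).
- by move=> x; rewrite /P' le_max lexx orbT.
- by rewrite FE// set_itv1 Rintegral_set1 opprK add0r.
split=> // x x0 xM.
have Ax : ages G x by apply: (ages_itv AM); rewrite /= in_itv/= x0.
have iP' : leb.-integrable `[0, x] (EFin \o P').
  by apply: continuous_compact_integrable; [exact: segment_compact|exact: continuous_subspaceT].
have iwx := integrable_hazard_survival Ax.
have mx : measurable (`[0, x]%classic : set (measurableTypeR R)) by exact: measurable_itv.
split.
  rewrite FE// opprK lerDr; apply: Rintegral_ge0 => u _.
  by rewrite /P' le_max lexx orbT.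
rewrite FE// inv_survivalE// opprK [_ + 1]addrC opprD addrACA subrr add0r -RintegralB//.
have ib : leb.-integrable `[0, x] (EFin \o (fun u => P' u - h u * W u)) by exact: (integrableB mx iP' iwx).
apply: le_trans (le_normr_Rintegral mx ib) _.
rewrite -lee_fin /Rintegral fineK; last first.
  by apply: integrable_fin_num => //; exact: (@integrable_norm _ _ _ leb _ (fun u => P' u - h u * W u)).
apply: le_trans IE; apply: ge0_subset_integral => //.
  apply/measurable_EFinP; apply: measurableT_comp => //; apply: measurable_funB => //.
    by apply/measurable_funTS; apply: continuous_measurable_fun; exact: cP'.
  exact/measurable_EFinP.
by move=> u /=; rewrite !in_itv/= => /andP[-> /le_trans]; apply.
Qed.

End survival.

(** * Renewal equation *)

Section path_kernels.
Context {R : realType}.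
Variables (S : set R) (z : R -> measOn S).
Hypothesis mS : measurable (S : set (measurableTypeR R)).
Hypothesis zc : cont_path z.
Hypothesis z1 : forall t, 0 <= t -> (z t setT <= 1)%E.
Implicit Types (u v F : R -> R) (x s t e : R).
Local Notation leb := (@lebesgue_measure R).

(** The path frozen at negative times is a finite kernel on the whole line, and the translated
    integrand is jointly measurable in time and age. *)
Lemma measurable_translated_pairing u F t :
  measurable_fun (S : set (measurableTypeR R)) u -> (forall x, S x -> 0 <= u x) ->
  measurable_fun setT (F : measurableTypeR R -> R) -> (forall x, 0 <= F x) ->
  measurable_fun (`[0, t]%classic : set (measurableTypeR R))
    (fun s => \int[z s]_(x in S) (u x * F (x - s))%:E)%E.
Proof.
move=> mu u0 mF F0.
pose k0 (s : measurableTypeR R) : {measure set (measurableTypeR R) -> \bar R} :=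
  z (Num.max s 0).
have mk0 : forall U, measurable U -> measurable_fun setT (k0 ^~ U).
  by move=> U mU; exact: measurable_path.
have k0u : measure_fam_uub k0.
  (* The uniform bound of a finite kernel is strict, hence 2 for masses at most 1. *)
  exists 2 => s; apply: (@le_lt_trans _ _ 1%E); last by rewrite lte_fin ltr1n.
  by apply: z1; rewrite le_max lexx orbT.
pose k1 := isKernel.Build _ _ _ _ R k0 mk0.
pose kK : R.-ker (measurableTypeR R) ~> (measurableTypeR R) := HB.pack k0 k1.
pose k2 := Kernel_isFinite.Build _ _ _ _ R kK k0u.
pose k : R.-fker (measurableTypeR R) ~> (measurableTypeR R) := HB.pack k0 k1 k2.
pose f (p : measurableTypeR R * measurableTypeR R) := ((u \_ S) p.2 * F (p.2 - p.1))%:E.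
have f0 p : (0 <= f p)%E.
  rewrite lee_fin mulr_ge0 ?F0// patchE; case: ifPn => //.
  by rewrite inE => /u0.
have mf : measurable_fun setT f.
  apply/measurable_EFinP/measurable_funM.
    apply: (measurableT_comp (f := u \_ S)) => //.
    exact/(measurable_restrictT _ _).1.
  by apply: (measurableT_comp mF); exact: measurable_funB.
have := measurable_fun_integral_finite_kernel f k f0 mf.
move=> /(@measurable_funTS _ _ _ _ `[0, t]%classic); apply: eq_measurable_fun => s.
rewrite inE/= in_itv/= => /andP[s0 _].
rewrite [RHS]integral_mkcond /k0 max_l//; apply: eq_integral => x _.
by rewrite /f !patchE; case: ifPn => // _; rewrite mul0r.
Qed.

(** The comparison is made between nonnegative extended integrals, where it needs no finiteness; the
    bound with the roles of [u1] and [u2] as given then makes the integral of [u1] finite, and only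
    after that is everything read in the reals. *)
Lemma iterated_pairing_dist u1 u2 F v t e :
  measurable_fun (S : set (measurableTypeR R)) u1 ->
  measurable_fun (S : set (measurableTypeR R)) u2 ->
  measurable_fun (S : set (measurableTypeR R)) v ->
  measurable_fun setT (F : measurableTypeR R -> R) ->
  (forall x, S x -> 0 <= u1 x) -> (forall x, S x -> 0 <= u2 x) ->
  (forall x, S x -> 0 <= v x) -> (forall x, 0 <= F x) ->
  (forall x s, S x -> 0 <= s -> s <= t ->
    `|u1 x * F (x - s) - u2 x * F (x - s)| <= v x) ->
  (\int[leb]_(s in `[0%R, t]) \int[z s]_(x in S) (u2 x * F (x - s))%:E < +oo)%E ->
  (\int[leb]_(s in `[0%R, t]) \int[z s]_(x in S) (v x)%:E <= e%:E)%E ->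
  `|\int[leb]_(s in `[0, t]) pairing (fun x => u1 x * F (x - s)) (z s) -
    \int[leb]_(s in `[0, t]) pairing (fun x => u2 x * F (x - s)) (z s)| <= e.
Proof.
move=> mu1 mu2 mv mF u10 u20 v0 F0 uv fin2 finv.
have mI : measurable (`[0, t]%classic : set (measurableTypeR R)) by exact: measurable_itv.
pose J u s := (\int[z s]_(x in S) (u x * F (x - s))%:E)%E.
pose V s := (\int[z s]_(x in S) (v x)%:E)%E.
have mJ1 := @measurable_translated_pairing u1 F t mu1 u10 mF F0.
have mJ2 := @measurable_translated_pairing u2 F t mu2 u20 mF F0.
have mV : measurable_fun (`[0, t]%classic : set (measurableTypeR R)) V.
  have := @measurable_translated_pairing v (cst 1) t mv v0 (measurable_cst _) (fun=> ler01).
  by apply: eq_measurable_fun => s _; apply: eq_integral => x _; rewrite mulr1.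
have J0 u : (forall x, S x -> 0 <= u x) -> forall s, (0 <= J u s)%E.
  by move=> u0 s; apply: integral_ge0 => x Sx; rewrite lee_fin mulr_ge0 ?u0.
have V0 s : (0 <= V s)%E by apply: integral_ge0 => x Sx; rewrite lee_fin v0.
have mFs s : measurable_fun S (fun x : measurableTypeR R => F (x - s)).
  by apply: measurable_funTS; apply: (measurableT_comp mF); exact: measurable_funB.
have le12 u u' : measurable_fun (S : set (measurableTypeR R)) u' ->
    (forall x, S x -> 0 <= u x) -> (forall x, S x -> 0 <= u' x) ->
    measurable_fun (S : set (measurableTypeR R)) u ->
    (forall x s, S x -> 0 <= s -> s <= t -> u x * F (x - s) <= u' x * F (x - s) + v x) ->
    forall s, 0 <= s -> s <= t -> (J u s <= J u' s + V s)%E.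
  move=> mu' u0 u'0 mu H s s0 st; rewrite /J /V -ge0_integralD//; last first.
  - exact/measurable_EFinP.
  - by apply/measurable_EFinP; exact: (measurable_funM mu' (mFs s)).
  - by move=> x Sx; rewrite lee_fin mulr_ge0 ?u'0.
  apply: ge0_le_integral => //.
  - by move=> x Sx; rewrite lee_fin mulr_ge0 ?u0.
  - by apply/measurable_EFinP; exact: (measurable_funM mu (mFs s)).
  - apply/measurable_EFinP; apply: measurable_funD => //.
    exact: (measurable_funM mu' (mFs s)).
  - by move=> x Sx; rewrite -EFinD lee_fin H.
have IJ u u' : measurable_fun (S : set (measurableTypeR R)) u' ->
    (forall x, S x -> 0 <= u x) -> (forall x, S x -> 0 <= u' x) ->
    measurable_fun (S : set (measurableTypeR R)) u ->
    (forall x s, S x -> 0 <= s -> s <= t -> u x * F (x - s) <= u' x * F (x - s) + v x) ->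
    (\int[leb]_(s in `[0%R, t]) J u s <= \int[leb]_(s in `[0%R, t]) J u' s + e%:E)%E.
  move=> mu' u0 u'0 mu H.
  apply: (@le_trans _ _ (\int[leb]_(s in `[0%R, t]) (J u' s + V s))%E).
    apply: ge0_le_integral => //.
    - by move=> s _; exact: J0.
    - exact: measurable_translated_pairing.
    - by apply: emeasurable_funD => //; exact: measurable_translated_pairing.
    - by move=> s /=; rewrite in_itv/= => /andP[s0 st]; exact: le12.
  rewrite ge0_integralD//; first exact: leeD2l.
  - by move=> s _; exact: J0.
  - exact: measurable_translated_pairing.
have I12 : (\int[leb]_(s in `[0%R, t]) J u1 s <= \int[leb]_(s in `[0%R, t]) J u2 s + e%:E)%E.
  by apply: IJ => // x s Sx s0 st; apply: ler_distlDr; exact: uv.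
have I21 : (\int[leb]_(s in `[0%R, t]) J u2 s <= \int[leb]_(s in `[0%R, t]) J u1 s + e%:E)%E.
  by apply: IJ => // x s Sx s0 st; apply: ler_distlCDr; exact: uv.
have fin1 : (\int[leb]_(s in `[0%R, t]) J u1 s < +oo)%E.
  by apply: le_lt_trans I12 _; rewrite lte_add_pinfty// ltry.
(* A pairing is the [fine] of an inner integral that may be infinite; finiteness of the outer
   integral excludes this for almost every time. *)
have RE u : measurable_fun (`[0, t]%classic : set (measurableTypeR R)) (J u) ->
    (forall x, S x -> 0 <= u x) ->
    (\int[leb]_(s in `[0%R, t]) J u s < +oo)%E ->
    (\int[leb]_(s in `[0, t]) pairing (fun x => u x * F (x - s)) (z s))%:E =
    (\int[leb]_(s in `[0%R, t]) J u s)%E.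
  move=> mJ u0 fin; rewrite /Rintegral.
  have iJ : leb.-integrable `[0, t] (J u).
    apply/integrableP; split => //.
    by under eq_integral do rewrite gee0_abs ?J0//.
  have E : (\int[leb]_(s in `[0%R, t]) (pairing (fun x => u x * F (x - s)) (z s))%:E =
      \int[leb]_(s in `[0%R, t]) J u s)%E.
    apply: ae_eq_integral => //.
      by apply/measurable_EFinP; exact: (measurableT_comp (f := fine)).
    have := integrable_ae mI iJ; apply: filterS => s H /H Js.
    by rewrite /pairing /Rintegral -/(J u s) fineK.
  by rewrite E fineK// integrable_fin_num.
rewrite ler_distlC; apply/andP.
have e1 := RE u1 mJ1 u10 fin1; have e2 := RE u2 mJ2 u20 fin2.
move: I12 I21; rewrite -e1 -e2 -!EFinD !lee_fin.
by move=> ? ?; rewrite lerBlDr.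
Qed.

End path_kernels.

Section pairing_bounds.
Context {R : realType}.
Variables (S : set R) (m : measOn S).
Hypothesis mS : measurable (S : set (measurableTypeR R)).
Implicit Types (f : R -> R) (e B : R).

Lemma bounded_integrable f B : measurable_fun (S : set (measurableTypeR R)) f ->
  (forall x, S x -> `|f x| <= B) -> m.-integrable S (EFin \o f).
Proof.
move=> mf fB; apply: measurable_bounded_integrable => //.
  by rewrite ltey_eq fin_num_measure.
exists B; split; first exact: num_real.
by move=> N BN x Sx; exact: le_trans (fB x Sx) (ltW BN).
Qed.

Lemma pairing_dist f f' B e : (m setT <= 1)%E -> 0 <= e ->
  measurable_fun (S : set (measurableTypeR R)) f ->
  measurable_fun (S : set (measurableTypeR R)) f' ->
  (forall x, S x -> `|f' x| <= B) -> (forall x, S x -> `|f x - f' x| <= e) ->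
  `|pairing f m - pairing f' m| <= e.
Proof.
move=> m1 e0 mf mf' f'B ff'.
have if' := bounded_integrable mf' f'B.
have jf : m.-integrable S (EFin \o f).
  apply: (bounded_integrable (B := B + e)) => // x Sx.
  by rewrite -[f x](subrK (f' x)) addrC (le_trans (ler_normD _ _))// lerD ?f'B ?ff'.
have id : m.-integrable S (EFin \o (fun x => f x - f' x)) := integrableB mS jf if'.
rewrite /pairing -RintegralB//; apply: le_trans (le_normr_Rintegral mS id) _.
rewrite -lee_fin /Rintegral fineK; last first.
  by apply: integrable_fin_num => //; exact: (@integrable_norm _ _ _ m _ (fun x => f x - f' x)).
apply: (@le_trans _ _ (\int[m]_(x in S) (cst e%:E x))%E).
  apply: ge0_le_integral => //.
  - apply/measurable_EFinP; apply: measurableT_comp => //; exact: measurable_funB.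
rewrite integral_cst//= -[leRHS]mule1; apply: lee_pmul => //.
by apply: le_trans m1; rewrite le_measure ?inE.
Qed.

End pairing_bounds.

Section renewal.
Context {R : realType}.
Variables (G g : R -> R) (nu : R -> measOn (ages G)) (nu0 : measOn (ages G)).
Variable K : R -> R.
Hypothesis hG : service_cdf G g.
Hypothesis nuc : cont_path nu.
Hypothesis nu1 : forall t, 0 <= t -> (nu t setT <= 1)%E.
Hypothesis nu01 : (nu0 setT <= 1)%E.
Hypothesis KD : Dup K.
Hypothesis tr : transport_eq g nu nu0 K.
Hypothesis depfin : forall t, 0 <= t -> (departures g nu t < +oo)%E.
Implicit Types (F : R -> R) (x s t M a b c d e : R).
Local Notation leb := (@lebesgue_measure R).
Local Notation h := (hazard G g).
Local Notation W := (inv_survival G).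

Let mA := measurable_ages G.

Let measurable_on_ages (f : R -> R) :
  measurable_fun (Rplus : set (measurableTypeR R)) f ->
  measurable_fun (ages G : set (measurableTypeR R)) f.
Proof.
by move=> mf; apply: measurable_funS mf; [exact: measurable_itv|exact: ages_Rplus].
Qed.

Let measurable_derivable (P P' : R -> R) : (forall x, 0 <= x -> is_derive x 1 P (P' x)) ->
  measurable_fun (ages G : set (measurableTypeR R)) P.
Proof.
move=> dP; apply: measurable_on_ages; apply: subspace_continuous_measurable_fun.
  exact: measurable_itv.
apply: continuous_in_subspaceT => x; rewrite inE /Rplus/= in_itv/= andbT => x0.
by apply: differentiable_continuous; apply/derivable1_diffP; have [] := dP x x0.
Qed.

(** The constant collects one [e] for each of the two boundary pairings, (1 + k') e for the L^1
    error of [P'] under the occupation bound, and D e for replacing [W] by [P] in the departures. *)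
Let dist_combination (p p' q q' w w' a b k e k' D : R) : p = q + a - b + k ->
  `|p - w| <= e -> `|q - w'| <= e -> `|a - b| <= (1 + k') * e + e * D ->
  `|w - (w' + k)| <= (3 + k' + D) * e.
Proof.
move=> E; rewrite !ler_norml => /andP[? ?] /andP[? ?] /andP[? ?].
by apply/andP; split; lra.
Qed.

(** Tested against P(x) F(x - s), the equation keeps the time integral of P' - h P = (P' - h W) - h
    (P - W), times F. The first part is small by the occupation bound, the second by [e] times the
    finite departures. The condition on [M] makes F(x - s) vanish for x > M and s <= t + d. *)
Lemma renewal_smooth F (F' : R -> R) b d M t : 0 <= t -> 0 < d -> ages G M -> b + t + d <= M ->
  (forall x, is_derive x 1 F (F' x)) -> continuous F' ->
  (forall x, 0 <= F x <= 1) -> (forall x, b <= x -> F x = 0) ->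
  pairing (fun x => W x * F (x - t)) (nu t) =
  pairing (fun x => W x * F x) nu0 + \int[stieltjes K]_(s in `[0, t]) F (- s).
Proof.
move=> t0 d0 AM btM dF cF' F01 Fb; have M0 := AM.1.
have Kt0 : 0 <= K t by have [_ + _] := KD; apply.
pose D := fine (departures g nu t).
have dep0 : (0 <= departures g nu t)%E.
  apply: integral_ge0 => s _; apply: integral_ge0 => x Ax.
  by rewrite lee_fin (hazard_ge0 hG).
have D0 : 0 <= D by exact: fine_ge0.
have DE : departures g nu t = D%:E by rewrite fineK// ge0_fin_numE// depfin.
apply/eqP; rewrite -subr_eq0 -normr_le0; apply/ler_addgt0Pr => e' e'0; rewrite add0r.
pose C := 3 + K t + D; have C0 : 0 < C by rewrite /C; lra.
have -> : e' = C * (e' / C) by rewrite mulrCA divff ?mulr1// gt_eqF.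
have : 0 < e' / C by rewrite divr_gt0.
move: (e' / C) => e e0 {e' e'0}.
have [P [P' [dP cP' P'0 P0 [PW PhW]]]] := survival_approx hG AM e0.
have mF : measurable_fun setT (F : measurableTypeR R -> R).
  apply: continuous_measurable_fun => x; apply: differentiable_continuous.
  by apply/derivable1_diffP; have [] := dF x.
have mFs s : measurable_fun (ages G) (fun x : measurableTypeR R => F (x - s)).
  by apply: measurable_funTS; apply: (measurableT_comp mF); exact: measurable_funB.
have mP := measurable_derivable dP.
have mP' : measurable_fun (ages G : set (measurableTypeR R)) P'.
  by apply: measurable_funTS; exact: continuous_measurable_fun.
have mW := measurable_on_ages (measurable_inv_survival hG).
have mh := measurable_on_ages (measurable_hazard hG).
have F0 s x : s <= t + d -> M < x -> F (x - s) = 0.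
  by move=> sd Mx; apply: Fb; lra.
have supp x s : ages G x -> 0 <= s -> s <= t + d -> M < x -> P x * F (x - s) = 0.
  by move=> _ _ sd Mx; rewrite F0 ?mulr0.
have E := @transport_identity R G g nu nu0 K P P' F F' M d t tr t0 d0 AM dP
  (fun x _ => cP' x) dF cF' supp.
have PWF x s : ages G x -> 0 <= s -> s <= t -> `|P x * F (x - s) - W x * F (x - s)| <= e.
  move=> Ax s0 st; have [xM|Mx] := leP x M; last first.
    rewrite F0 ?mulr0 ?subrr ?normr0 ?(ltW e0)//; lra.
  have /andP[f0 f1] := F01 (x - s).
  rewrite -mulrBl normrM (ger0_norm f0) -[leRHS]mulr1.
  by apply: ler_pM => //; have [] := PW x Ax.1 xM.
have WFb s x : ages G x -> 0 <= s -> s <= t -> `|W x * F (x - s)| <= W M.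
  move=> Ax s0 st; have WM := inv_survival_gt0 hG AM.
  have [xM|Mx] := leP x M; last first.
    rewrite F0 ?mulr0 ?normr0 ?(ltW WM)//; lra.
  have /andP[f0 f1] := F01 (x - s); have Wx := inv_survival_gt0 hG Ax.
  rewrite normrM !ger0_norm// ?(ltW Wx)// -[leRHS]mulr1.
  apply: ler_pM => //; first exact: ltW.
  by apply: (inv_survival_nd hG) => //; exact: Ax.1.
have Et : `|pairing (fun x => P x * F (x - t)) (nu t) -
            pairing (fun x => W x * F (x - t)) (nu t)| <= e.
  apply: (@pairing_dist _ _ _ _ _ _ (W M)) => //; rewrite ?(ltW e0) ?nu1//.
  - exact: (measurable_funM mP (mFs t)).
  - exact: (measurable_funM mW (mFs t)).
  - by move=> x Ax; exact: WFb.
  - by move=> x Ax; exact: PWF.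
have E0 : `|pairing (fun x => P x * F x) nu0 - pairing (fun x => W x * F x) nu0| <= e.
  have mF0 : measurable_fun (ages G : set (measurableTypeR R)) F by exact: measurable_funTS.
  apply: (@pairing_dist _ _ _ _ _ _ (W M)) => //; rewrite ?(ltW e0)//.
  - exact: (measurable_funM mP mF0).
  - exact: (measurable_funM mW mF0).
  - by move=> x Ax; have := WFb 0 x Ax (lexx 0) t0; rewrite subr0.
  - by move=> x Ax; have := PWF x 0 Ax (lexx 0) t0; rewrite subr0.
have EI : `|\int[leb]_(s in `[0, t]) pairing (fun x => P' x * F (x - s)) (nu s) -
    \int[leb]_(s in `[0, t]) pairing (fun x => h x * (P x * F (x - s))) (nu s)| <=
    (1 + K t) * e + e * D.
  have P1 x : 0 <= x -> x <= M -> 0 <= P x.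
    by move=> x0 xM; apply: (le_trans ler01); have [] := PW x x0 xM.
  (* Nonnegativity of [P] is at hand on [0, M] only; beyond [M] the factor [F] vanishes, so the
     positive part gives the same integrand. *)
  pose Pp x := Num.max (P x) 0.
  have PpF x s : ages G x -> 0 <= s -> s <= t -> h x * (P x * F (x - s)) = h x * Pp x * F (x - s).
    move=> Ax s0 st; have [xM|Mx] := leP x M.
      by rewrite /Pp max_l ?P1 ?Ax.1// mulrA.
    by rewrite F0 ?mulr0//; lra.
  rewrite [X in _ - X](@eq_Rintegral _ _ _ leb _
      (fun s => pairing (fun x => h x * Pp x * F (x - s)) (nu s))); last first.
    move=> s; rewrite inE/= in_itv/= => /andP[s0 st].
    by apply: pairing_eq => x Ax; exact: PpF.
  pose a := (fun x : R => `|P' x - h x * W x|) \_ `[0, M]%classic.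
  have a0 x : 0 <= a x by rewrite /a patchE; case: ifPn.
  have mP'hW : measurable_fun (`[0, M]%classic : set (measurableTypeR R))
      (fun x => `|P' x - h x * W x|).
    apply: measurableT_comp => //; apply: measurable_funB.
      by apply: measurable_funTS; exact: continuous_measurable_fun.
    by apply: measurable_funM; [move: mh|move: mW];
      apply: measurable_funS => //; exact: ages_itv.
  have ma : measurable_fun setT (a : measurableTypeR R -> R).
    by apply/(measurable_restrictT _ _).1 => //; exact: measurable_itv.
  (* A bound for |P' - h P| on [0, M], where |P - W| <= e. *)
  pose v x := a x + e * h x.
  have h0 x : ages G x -> 0 <= h x by exact: (hazard_ge0 hG).
  have Pp0 x : 0 <= Pp x by rewrite /Pp le_max lexx orbT.
  have v0 x : ages G x -> 0 <= v x.
    by move=> Ax; rewrite addr_ge0 ?a0// mulr_ge0 ?h0 ?(ltW e0).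
  have hPF0 x y : ages G x -> 0 <= h x * Pp x * F y.
    by move=> Ax; have /andP[? _] := F01 y; rewrite mulr_ge0// mulr_ge0 ?h0.
  have mPp : measurable_fun (ages G : set (measurableTypeR R)) Pp by exact: measurable_maxr.
  have mhPp := measurable_funM mh mPp.
  have meh : measurable_fun (ages G : set (measurableTypeR R)) (fun x => e * h x).
    exact: measurable_funM.
  have mv : measurable_fun (ages G : set (measurableTypeR R)) v.
    by apply: measurable_funD => //; exact: measurable_funTS.
  have mc1 : measurable_fun setT (cst 1 : measurableTypeR R -> R) by exact: measurable_cst.
  have mJ (u : R -> R) : measurable_fun (ages G : set (measurableTypeR R)) u ->
      (forall x, ages G x -> 0 <= u x) ->
      measurable_fun (`[0, t]%classic : set (measurableTypeR R))
        (fun s => \int[nu s]_(x in ages G) (u x)%:E)%E.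
    move=> mu u0; have := @measurable_translated_pairing R _ nu mA nuc nu1 u (cst 1) t mu u0 mc1 (fun=> ler01).
    by apply: eq_measurable_fun => s _; apply: eq_integral => x _; rewrite mulr1.
  have mI : measurable (`[0, t]%classic : set (measurableTypeR R)) by exact: measurable_itv.
  have EcH c : 0 <= c -> (\int[leb]_(s in `[0%R, t]) \int[nu s]_(x in ages G) (c * h x)%:E =
      c%:E * D%:E)%E.
    move=> c0; rewrite -DE /departures -ge0_integralZl//; last 2 first.
    - exact: mJ.
    - by move=> s _; apply: integral_ge0 => x Ax; rewrite lee_fin h0.
    by apply: eq_integral => s _; rewrite -ge0_integralZl//; exact/measurable_EFinP.
  apply: (@iterated_pairing_dist _ _ _ mA nuc nu1 _ _ _ v) => //.
  - by move=> x Ax; rewrite mulr_ge0 ?h0 ?Pp0.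
  - by move=> x; have /andP[] := F01 x.
  - move=> x s Ax s0 st; have [xM|Mx] := leP x M; last first.
      rewrite !F0 ?mulr0 ?subrr ?normr0 ?v0//; lra.
    have /andP[f0 f1] := F01 (x - s); have [_ PWx] := PW x Ax.1 xM.
    rewrite -mulrBl normrM (ger0_norm f0) -[leRHS]mulr1; apply: ler_pM => //.
    rewrite /Pp max_l ?P1 ?Ax.1// (_ : _ - _ = (P' x - h x * W x) - h x * (P x - W x)); last by ring.
    apply: le_trans (ler_normB _ _) _; rewrite /v /a patchE mem_set/= ?in_itv/= ?Ax.1//.
    by rewrite lerD2l normrM (ger0_norm (h0 _ Ax)) mulrC ler_wpM2r ?h0.
  (* On [0, M], P <= W + e <= W M + e, so the integral is at most a multiple of the finite
     departures. *)
  - have WMe : 0 <= W M + e by rewrite addr_ge0 ?(ltW e0) ?ltW// (inv_survival_gt0 hG).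
    apply: (@le_lt_trans _ _ ((W M + e)%:E * D%:E)%E); last by rewrite -EFinM ltry.
    rewrite -EcH//; apply: ge0_le_integral => //.
    + by move=> s _; apply: integral_ge0 => x Ax; rewrite lee_fin hPF0.
    + apply: measurable_translated_pairing => //.
      * by move=> x Ax; rewrite mulr_ge0 ?h0 ?Pp0.
      * by move=> x; have /andP[] := F01 x.
    + apply: mJ; first exact: measurable_funM.
      by move=> x Ax; rewrite mulr_ge0 ?h0.
    + move=> s /=; rewrite in_itv/= => /andP[s0 st]; apply: ge0_le_integral => //.
      * by move=> x Ax; rewrite lee_fin hPF0.
      * by apply/measurable_EFinP; exact: (measurable_funM mhPp (mFs s)).
      * by apply/measurable_EFinP; exact: measurable_funM.
      * move=> x Ax; rewrite lee_fin; have [xM|Mx] := leP x M; last first.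
          have -> : F (x - s) = 0 by apply: F0 => //; lra.
          by rewrite mulr0 mulr_ge0 ?h0.
        have /andP[f0 f1] := F01 (x - s); have [_ PWx] := PW x Ax.1 xM.
        rewrite -mulrA mulrC ler_wpM2r ?h0// -[leRHS]mulr1 ler_pM//.
        rewrite /Pp max_l ?P1 ?Ax.1//.
        have := inv_survival_nd hG Ax.1 xM AM.
        by move: PWx; rewrite ler_norml => /andP[_]; lra.
  - rewrite (_ : (\int[leb]_(s in _) _)%E =
        (\int[leb]_(s in `[0%R, t]) \int[nu s]_(x in ages G) (a x)%:E + e%:E * D%:E)%E).
      rewrite EFinD -EFinM leeD2r//.
      rewrite (_ : (\int[leb]_(s in _) _)%E =
          (\int[leb]_(s in `[0%R, t]) \int[nu s]_x (a x)%:E)%E); last first.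
        apply: eq_integral => s _; rewrite integral_mkcond; apply: eq_integral => x _.
        rewrite patchE; case: ifPn => // /negP nAx.
        rewrite /a patchE ifF//; apply/negP; rewrite inE => Ix; apply: nAx.
        by rewrite inE; exact: ages_itv Ix.
      apply: le_trans (occupancy_fun hG nuc nu1 nu01 KD tr AM t0 _ _ _) _ => //.
      + exact/measurable_EFinP.
      + move=> x nx; rewrite /a patchE ifF//; apply/negP; rewrite inE/= in_itv/=.
        exact: nx.
      rewrite EFinM; apply: lee_pmul => //.
      + by rewrite lee_fin addr_ge0.
      + by apply: integral_ge0 => x _; rewrite lee_fin a0.
      apply: le_trans PhW; rewrite [leRHS]integral_mkcond le_eqVlt; apply/orP; left; apply/eqP.
      by apply: eq_integral => x _; rewrite /a restrict_EFin.
    rewrite -EcH ?(ltW e0)// -ge0_integralD//.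
    + apply: eq_integral => s _; rewrite -ge0_integralD//.
      * by move=> x Ax; rewrite lee_fin a0.
      * by apply/measurable_EFinP/measurable_funTS.
      * by move=> x Ax; rewrite lee_fin mulr_ge0 ?h0 ?(ltW e0).
      * exact/measurable_EFinP.
    + by move=> s _; apply: integral_ge0 => x _; rewrite lee_fin a0.
    + by apply: mJ => //; exact: measurable_funTS.
    + by move=> s _; apply: integral_ge0 => x Ax; rewrite lee_fin mulr_ge0 ?h0 ?(ltW e0).
    + by apply: mJ => // x Ax; rewrite mulr_ge0 ?h0 ?(ltW e0).
have EK : \int[stieltjes K]_(s in `[0, t]) (P 0 * F (- s)) =
    \int[stieltjes K]_(s in `[0, t]) F (- s).
  by apply: eq_Rintegral => s _; rewrite P0 mul1r.
rewrite EK in E.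
exact: dist_combination E Et E0 EI.
Qed.

End renewal.

Section bounded_convergence.
Context d (T : measurableType d) (R : realType) (mu : {measure set T -> \bar R}).
Variables (D P : set T).
Hypotheses (mD : measurable D) (mP : measurable P) (muD : (mu D < +oo)%E).

Lemma Rintegral_restrict_cvg (f_ : (T -> R)^nat) (f : T -> R) (B : R) :
  (forall n, measurable_fun D (f_ n)) -> measurable_fun D f ->
  (forall n x, D x -> `|f_ n x| <= B) ->
  (forall x, D x -> f_ n x @[n --> \oo] --> (f \_ P) x) ->
  \int[mu]_(x in D) f_ n x @[n --> \oo] --> \int[mu]_(x in D `&` P) f x.
Proof.
move=> mf_ mf fB fP; rewrite Rintegral_mkcondr.
have mfP : measurable_fun D (f \_ P).
  by apply/measurable_restrict => //; apply: measurable_funS mf => //; exact: subIsetl.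
have limB x : D x -> `|(f \_ P) x| <= B.
  move=> Dx; apply: (ler_cvg_to (cvg_norm (fP x Dx)) (cvg_cst B)).
  by apply: nearW => n; exact: fB.
rewrite /Rintegral; apply: fine_cvg; rewrite fineK; last first.
  apply: integrable_fin_num => //; apply: measurable_bounded_integrable => //.
  exists B; split; first exact: num_real.
  by move=> N BN x Dx; exact: le_trans (limB x Dx) (ltW BN).
apply: (dominated_cvg mD (g := cst B%:E)) => //.
- by move=> n; apply/measurable_EFinP; exact: mf_.
- by move=> x Dx; apply: cvg_EFin; [exact: nearW|exact: fP].
- apply: measurable_bounded_integrable => //.
  by exists `|B|; split; [exact: num_real|move=> N BN x _ /=; exact: ltW].
Qed.

End bounded_convergence.

Section renewal_equation.
Context {R : realType}.
Variables (G g : R -> R) (nu : R -> measOn (ages G)) (nu0 : measOn (ages G)).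
Variable K : R -> R.
Hypothesis hG : service_cdf G g.
Hypothesis nuc : cont_path nu.
Hypothesis nu1 : forall t, 0 <= t -> (nu t setT <= 1)%E.
Hypothesis nu01 : (nu0 setT <= 1)%E.
Hypothesis KD : Dup K.
Hypothesis K0 : K 0 = 0.
Hypothesis tr : transport_eq g nu nu0 K.
Hypothesis depfin : forall t, 0 <= t -> (departures g nu t < +oo)%E.
Implicit Types (F : R -> R) (x s t M a b c d e : R).
Local Notation leb := (@lebesgue_measure R).
Local Notation W := (inv_survival G).

Let mA := measurable_ages G.

(* Smooth approximations, from below, of the indicator of the open half-line
   below b *)
Let F_ b (n : nat) a := cutoff ((a - b) * n.+1%:R + 1).
Let F'_ b (n : nat) a := cutoff' ((a - b) * n.+1%:R + 1) * n.+1%:R.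

Let is_derive_F b n a : is_derive a 1 (F_ b n) (F'_ b n a).
Proof.
pose k : R := n.+1%:R.
have d0 : is_derive a 1 (fun y => (y - b) * k) k.
  apply: (is_derive_eq (is_deriveM (is_deriveB (is_derive_id a 1) (is_derive_cst b a 1)) (is_derive_cst k a 1))).
  by rewrite /GRing.scale/=; ring.
have d1 : is_derive a 1 (fun y => (y - b) * k + 1) k.
  by apply: (is_derive_eq (is_deriveD d0 (is_derive_cst (1 : R) a 1))); rewrite addr0.
exact: (@is_derive1_comp _ cutoff _ a _ _ (is_derive_cutoff _) d1).
Qed.

Let continuous_F' b n : continuous (F'_ b n).
Proof.
move=> a; apply: cvgM; last exact: cvg_cst.
apply: (@continuous_comp _ _ _ (fun y => (y - b) * n.+1%:R + 1) cutoff'); last exact: continuous_cutoff'.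
apply: cvgD; last exact: cvg_cst.
by apply: cvgM; [apply: cvgB; [exact: cvg_id|exact: cvg_cst]|exact: cvg_cst].
Qed.

Let F01 b n a : 0 <= F_ b n a <= 1. Proof. exact: cutoff_itv01. Qed.

Let F_ge b n a : b <= a -> F_ b n a = 0.
Proof. by move=> ba; apply: cutoff_ge1; rewrite lerDr mulr_ge0// subr_ge0. Qed.

Let F_cvg b a (w : R) : w * F_ b n a @[n --> \oo] --> (if a < b then w else 0).
Proof.
have [ab|ba] := ltP a b; last first.
  rewrite (_ : (fun n => _) = cst 0); first exact: cvg_cst.
  by apply/funext => n /=; rewrite F_ge// mulr0.
apply: (@cvg_trans _ ((cst w : nat -> R) n @[n --> \oo])); last exact: cvg_cst.
apply: near_eq_cvg; near=> n.
rewrite /= /F_ cutoff_le0 ?mulr1//.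
rewrite -lerBrDr sub0r lerNr -mulNr opprB mulrC -ler_pdivrMr ?subr_gt0// mul1r.
apply: (@le_trans _ _ n%:R); last by rewrite ler_nat.
by near: n; exact: nbhs_infty_ger.
Unshelve. all: by end_near. Qed.

Let measurable_F b n s : measurable_fun setT (fun x : measurableTypeR R => F_ b n (x - s)).
Proof.
apply: (measurableT_comp (f := F_ b n)); last exact: measurable_funB.
apply: continuous_measurable_fun => x; apply: differentiable_continuous.
by apply/derivable1_diffP; have [] := is_derive_F b n x.
Qed.

(** The profile tends to the indicator of the half-line below b = c - t. Along the flow this selects
    ages below [c] at time [t], ages below c - t at time 0, and entries at times s > t - c. *)
Lemma renewal t c : 0 <= t -> ages G c ->
  \int[nu t]_(x in `[0, c[) W x =
  \int[nu0]_(x in `[0, c - t[) W x + (K t - K (Num.max (t - c) 0)).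
Proof.
move=> t0 Ac; have [M cM AM] := ages_larger Ac; have c0 := Ac.1.
pose b := c - t; pose d := M - c; have d0 : 0 < d by rewrite subr_gt0.
have E n := @renewal_smooth R G g nu nu0 K hG nuc nu1 nu01 KD tr depfin
  (F_ b n) (F'_ b n) b d M t t0 d0 AM (_ : b + t + d <= M) (is_derive_F b n)
  (@continuous_F' b n) (F01 b n) (@F_ge b n).
have {}E n : pairing (fun x => W x * F_ b n (x - t)) (nu t) =
  pairing (fun x => W x * F_ b n x) nu0 + \int[stieltjes K]_(s in `[0, t]) F_ b n (- s).
  by apply: E; rewrite /b /d; lra.
have mW : measurable_fun (ages G : set (measurableTypeR R)) W.
  by apply: measurable_funS (measurable_inv_survival hG); [exact: measurable_itv|exact: ages_Rplus].
have cut x s n : ages G x -> 0 <= s -> s <= t -> `|W x * F_ b n (x - s)| <= W M.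
  move=> Ax s0 st; have WM := inv_survival_gt0 hG AM.
  have [xM|Mx] := leP x M; last first.
    rewrite F_ge ?mulr0 ?normr0 ?(ltW WM)// /b; lra.
  have /andP[f0 f1] := F01 b n (x - s); have Wx := inv_survival_gt0 hG Ax.
  rewrite normrM !ger0_norm// ?(ltW Wx)// -[leRHS]mulr1.
  apply: ler_pM => //; first exact: ltW.
  by apply: (inv_survival_nd hG) => //; exact: Ax.1.
have fin (m : measOn (ages G)) : (m (ages G) < +oo)%E by rewrite ltey_eq fin_num_measure.
have agesI c' : c' <= c -> ages G `&` `[0, c'[%classic = `[0, c'[%classic.
  move=> cc; apply/setIidr => x /=; rewrite in_itv/= => /andP[x0 xc].
  by apply: (ages_itv Ac); rewrite /= in_itv/= x0; lra.
have mIco c' : measurable (`[0, c'[%classic : set (measurableTypeR R)) by exact: measurable_itv.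
have L1 : pairing (fun x => W x * F_ b n (x - t)) (nu t) @[n --> \oo] -->
    \int[nu t]_(x in `[0, c[) W x.
  rewrite -(agesI c)//; apply: (@Rintegral_restrict_cvg _ _ _ _ _ _ _ _ _ _ _ (W M)) => //.
  - exact: fin.
  - by move=> n; apply: measurable_funM => //; apply: measurable_funTS; exact: measurable_F.
  - by move=> n x Ax; exact: cut.
  - move=> x Ax; rewrite patchE mem_setE in_itv/= Ax.1/=.
    have := @F_cvg b (x - t) (W x); rewrite /b (_ : (x - t < c - t) = (x < c))//.
    by rewrite ltrD2r.
have L2 : pairing (fun x => W x * F_ b n x) nu0 @[n --> \oo] -->
    \int[nu0]_(x in `[0, b[) W x.
  rewrite -(agesI b); last by rewrite /b; lra.
  apply: (@Rintegral_restrict_cvg _ _ _ _ _ _ _ _ _ _ _ (W M)) => //.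
  - exact: fin.
  - move=> n; apply: measurable_funM => //; apply: measurable_funTS.
    by apply: eq_measurable_fun (measurable_F b n 0) => x _; rewrite subr0.
  - by move=> n x Ax; have := @cut x 0 n Ax (lexx 0) t0; rewrite subr0.
  - by move=> x Ax; rewrite patchE mem_setE in_itv/= Ax.1/=; exact: F_cvg.
have mI : measurable (`[0, t]%classic : set (measurableTypeR R)) by exact: measurable_itv.
have mray : measurable (`]- b, +oo[%classic : set (measurableTypeR R)) by exact: measurable_itv.
have L3 : \int[stieltjes K]_(s in `[0, t]) F_ b n (- s) @[n --> \oo] -->
    \int[stieltjes K]_(s in `[0, t]%classic `&` `]- b, +oo[%classic) 1.
  apply: (@Rintegral_restrict_cvg _ _ _ _ _ _ _ _ _ _ _ 1) => //.
  - by rewrite stieltjes_itvcc// ltry.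
  - move=> n; apply: measurable_funTS.
    have -> : (fun s => F_ b n (- s)) = (fun x => F_ b n (x - 0)) \o -%R.
      by apply/funext => s /=; rewrite subr0.
    by apply: measurableT_comp; first exact: measurable_F.
  - by move=> n s _; have /andP[? ?] := F01 b n (- s); rewrite ger0_norm.
  - move=> s _; rewrite patchE mem_setE in_itv/= andbT ltrNl.
    by under eq_fun do rewrite -[F_ _ _ _]mul1r; exact: F_cvg.
have E3 : \int[stieltjes K]_(s in `[0, t]%classic `&` `]- b, +oo[%classic) 1 =
    K t - K (Num.max (t - c) 0).
  rewrite Rintegral_cst ?mul1r; last exact: measurableI.
  (* For t < c all of [0, t] is selected, including the mass [K 0] that the Stieltjes measure puts
     at 0; this mass is 0. *)
  have [ct|tc] := leP 0 (t - c); last first.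
    rewrite K0 subr0 (_ : _ `&` _ = `[0, t]%classic) ?stieltjes_itvcc//.
    apply/setIidl => s /=; rewrite !in_itv/= andbT => /andP[s0 _].
    by rewrite /b; lra.
  rewrite (_ : _ `&` _ = `](t - c), t]%classic) ?stieltjes_itvoc//; first by lra.
  apply/seteqP; split => s /=; rewrite !in_itv/= andbT /b opprB.
    by move=> [/andP[_ ->] ->].
  by move=> /andP[cs st]; rewrite cs st andbT; split => //; lra.
rewrite -E3.
apply: (@cvg_unique _ _ (pairing (fun x => W x * F_ b n (x - t)) (nu t) @[n --> \oo])) => //.
rewrite (_ : (fun n => pairing _ (nu t)) = (fun n => pairing (fun x => W x * F_ b n x) nu0
  + \int[stieltjes K]_(s in `[0, t]) F_ b n (- s))); last exact/funext.
exact: cvgD.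
Qed.

End renewal_equation.

(** * Comparison of two service processes *)

Section survival_mass.
Context {R : realType}.
Variables (G g : R -> R).
Hypothesis hG : service_cdf G g.
Implicit Types (m : measOn (ages G)) (x y c e k S : R).
Local Notation leb := (@lebesgue_measure R).
Local Notation W := (inv_survival G).

Definition weighted_mass m y : R := \int[m]_(x in `[0, y[) W x.

Let measurable_W_ico c : ages G c ->
  measurable_fun (`[0, c[%classic : set (measurableTypeR R)) W.
Proof.
move=> Ac; apply: measurable_funS (measurable_inv_survival hG); first exact: measurable_itv.
by move=> x; rewrite /Rplus/= !in_itv/= andbT => /andP[].
Qed.

Let W_ico c x : ages G c -> 0 <= x -> x < c -> 0 < W x <= W c.
Proof.
move=> Ac x0 xc; have Ax : ages G x by apply: (ages_itv Ac); rewrite /= in_itv/= x0 ltW.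
by rewrite (inv_survival_gt0 hG Ax) (inv_survival_nd hG x0 (ltW xc) Ac).
Qed.

Lemma integrable_weight m c : ages G c -> m.-integrable `[0, c[ (EFin \o W).
Proof.
move=> Ac; apply: measurable_bounded_integrable => //.
- by rewrite ltey_eq fin_num_measure.
- exact: measurable_W_ico.
exists (W c); split; first exact: num_real.
move=> N cN x /=; rewrite in_itv/= => /andP[x0 xc].
have /andP[W0 Wc] := W_ico Ac x0 xc; rewrite ger0_norm ?(ltW W0)//.
exact: le_trans Wc (ltW cN).
Qed.

Lemma weighted_massE m c : ages G c ->
  (weighted_mass m c)%:E = (\int[m]_(x in `[0%R, c[) (W x)%:E)%E.
Proof.
by move=> Ac; rewrite /weighted_mass /Rintegral fineK// integrable_fin_num// integrable_weight.
Qed.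

Lemma weighted_mass_nd m c x y : ages G c -> x <= y -> y <= c ->
  weighted_mass m x <= weighted_mass m y.
Proof.
move=> Ac xy yc; have sub : `[0, x[%classic `<=` `[0, y[%classic.
  by move=> z /=; rewrite !in_itv/= => /andP[-> /lt_le_trans]; apply.
have sub' : `[0, y[%classic `<=` `[0, c[%classic.
  by move=> z /=; rewrite !in_itv/= => /andP[-> /lt_le_trans]; apply.
have i1 : m.-integrable `[0, y[ (EFin \o W).
  by apply: integrableS (integrable_weight m Ac).
have i2 : m.-integrable `[0, x[ (EFin \o W) by apply: integrableS i1.
rewrite -lee_fin /weighted_mass /Rintegral !fineK ?integrable_fin_num//.
apply: ge0_subset_integral => //.
- exact: measurable_int i1.
- move=> z /= /sub' /=; rewrite in_itv/= => /andP[z0 zc].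
  by rewrite lee_fin; have /andP[/ltW] := W_ico Ac z0 zc.
Qed.

Lemma weighted_mass_ge0 m c x : ages G c -> x <= c -> 0 <= weighted_mass m x.
Proof.
move=> Ac xc; apply: Rintegral_ge0 => z /=; rewrite in_itv/= => /andP[z0 zx].
by have /andP[/ltW] := W_ico Ac z0 (lt_le_trans zx xc).
Qed.

Lemma measurable_weighted_mass m c : ages G c ->
  measurable_fun (`[0, c]%classic : set (measurableTypeR R)) (weighted_mass m).
Proof.
move=> Ac; apply: (eq_measurable_fun (fun y : measurableTypeR R => weighted_mass m (Num.min y c))).
  by move=> y; rewrite inE/= in_itv/= => /andP[_ yc]; rewrite min_l.
apply: nondecreasing_measurable; first exact: measurable_itv.
move=> x y xy; apply: (@weighted_mass_nd m c) => //; last by rewrite ge_min lexx orbT.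
by rewrite le_min !ge_min xy lexx orbT.
Qed.

(** Integrate 1 = (1 - G x) W x = (1 - G c) W x + W x int_]x, c] g over [0, c[ and exchange the
    integrals by Tonelli. *)
Lemma mass_survival m c : ages G c ->
  (m `[0%R, c[%classic = ((1 - G c) * weighted_mass m c)%:E +
    \int[leb]_(y in `[0%R, c]) (g y * weighted_mass m y)%:E)%E.
Proof.
have [mg g0 _ _] := hG; move=> Ac; have c0 := Ac.1.
pose w : R -> R := W \_ `[0, c[%classic.
pose gc : R -> R := g \_ `[0, c]%classic.
pose f (p : measurableTypeR R * measurableTypeR R) := (w p.1 * gc p.2 * (p.1 < p.2)%R%:R)%:E.
have w0 x : 0 <= w x.
  rewrite /w patchE; case: ifPn => //; rewrite inE/= in_itv/= => /andP[x0 xc].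
  by have /andP[/ltW] := W_ico Ac x0 xc.
have gc0 x : 0 <= gc x.
  by rewrite /gc patchE; case: ifPn => //; rewrite inE/= in_itv/= => /andP[/g0].
have mw : measurable_fun setT (w : measurableTypeR R -> R).
  by apply/(measurable_restrictT _ _).1; [exact: measurable_itv|exact: measurable_W_ico].
have mgc : measurable_fun setT (gc : measurableTypeR R -> R).
  apply/(measurable_restrictT _ _).1; first exact: measurable_itv.
  by apply: measurable_funS mg; [exact: measurable_itv|exact: itv_Rplus].
have f0 p : (0 <= f p)%E by rewrite lee_fin !mulr_ge0.
have mf : measurable_fun setT f.
  apply/measurable_EFinP; apply: measurable_funM; first apply: measurable_funM.
  - exact: (measurableT_comp mw).
  - exact: (measurableT_comp mgc).
  - apply: (measurableT_comp (f := fun b : bool => b%:R : R)) => //.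
    exact: measurable_fun_ltr.
have mIco : measurable (`[0, c[%classic : set (measurableTypeR R)) by exact: measurable_itv.
have mIcc : measurable (`[0, c]%classic : set (measurableTypeR R)) by exact: measurable_itv.
have E := @fubini_tonelli _ _ (measurableTypeR R) (measurableTypeR R) R m leb f mf f0.
have E1 x : (\int[leb]_y f (x, y) = (w x * (G c - G x))%:E)%E.
  rewrite /f/= /w patchE; case: ifPn; last first.
    by move=> _; rewrite mul0r; apply: integral0_eq => y _; rewrite !mul0r.
  rewrite inE/= in_itv/= => /andP[x0 xc].
  have := cdf_increment hG x0 (ltW xc).
  move=> Gc; have {}Gc : (\int[leb]_(z in `]x, c]) (g z)%:E = (G c - G x)%:E)%E.
    by rewrite EFinB Gc addeAC subee// add0e.
  rewrite EFinM -Gc -ge0_integralZl//; last 3 first.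
  - apply/measurable_EFinP; apply: measurable_funS mg; first exact: measurable_itv.
    by move=> z; rewrite /Rplus/= !in_itv/= andbT => /andP[/ltW/(le_trans x0)].
  - by move=> z /=; rewrite in_itv/= => /andP[xz _]; rewrite lee_fin g0// (le_trans x0 (ltW xz)).
  - by rewrite lee_fin; have /andP[/ltW] := W_ico Ac x0 xc.
  rewrite [RHS]integral_mkcond; apply: eq_integral => y _.
  rewrite /gc !patchE !mem_setE !in_itv/=; case: (ltP x y) => xy; rewrite ?andbF ?mulr0//=.
  rewrite mulr1 (le_trans x0 (ltW xy))/=; case: ifPn => yc; rewrite ?mulr0//.
have E2 y : (\int[m]_x f (x, y) = (gc y * weighted_mass m y)%:E)%E.
  rewrite /f/= /gc patchE; case: ifPn; last first.
    by move=> _; rewrite mul0r; apply: integral0_eq => x _; rewrite mulr0 mul0r.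
  rewrite inE/= in_itv/= => /andP[y0 yc].
  have Ay : ages G y by apply: (ages_itv Ac); rewrite /= in_itv/= y0.
  rewrite EFinM weighted_massE// -ge0_integralZl//; last 3 first.
  - by apply/measurable_EFinP; exact: measurable_W_ico.
  - by move=> z /=; rewrite in_itv/= => /andP[z0 zy]; rewrite lee_fin; have /andP[/ltW] := W_ico Ay z0 zy.
  - by rewrite lee_fin g0.
  rewrite [RHS]integral_mkcond; apply: eq_integral => x _.
  rewrite /w !patchE !mem_setE !in_itv/=; case: (ltP x y) => xy; last by rewrite mulr0 andbF.
  rewrite (lt_le_trans xy yc) !andbT mulr1; case: ifPn => x0.
    by rewrite EFinM muleC.
  by rewrite mul0r.
have G1 x : 0 <= x -> x < c -> 0 <= G c - G x.
  by move=> x0 xc; rewrite subr_ge0 (cdf_nondecreasing hG)// ltW.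
have E3 : (\int[m]_(x in `[0%R, c[) (W x * (G c - G x))%:E =
    \int[leb]_(y in `[0%R, c]) (g y * weighted_mass m y)%:E)%E.
  rewrite [LHS]integral_mkcond [RHS]integral_mkcond.
  transitivity (\int[m]_x \int[leb]_y f (x, y))%E.
    apply: eq_integral => x _; rewrite E1 /w !patchE; case: ifPn => // _.
    by rewrite mul0r.
  rewrite E; apply: eq_integral => y _; rewrite E2 /gc !patchE; case: ifPn => // _.
  by rewrite mul0r.
rewrite -E3 EFinM weighted_massE// -ge0_integralZl//; last 3 first.
- by apply/measurable_EFinP; exact: measurable_W_ico.
- by move=> x /=; rewrite in_itv/= => /andP[x0 xc]; rewrite lee_fin; have /andP[/ltW] := W_ico Ac x0 xc.
- by rewrite lee_fin subr_ge0 ltW// (cdf_lt1 hG).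
have mG : measurable_fun (`[0, c[%classic : set (measurableTypeR R)) G.
  apply: measurable_funS (measurable_cdf hG); first exact: measurable_itv.
  by move=> x; rewrite /Rplus/= !in_itv/= andbT => /andP[].
rewrite -ge0_integralD//; last 4 first.
- move=> x /=; rewrite in_itv/= => /andP[x0 xc]; rewrite lee_fin mulr_ge0//.
    by rewrite subr_ge0 ltW// (cdf_lt1 hG).
  by have /andP[/ltW] := W_ico Ac x0 xc.
- by apply/measurable_EFinP/measurable_funM => //; exact: measurable_W_ico.
- move=> x /=; rewrite in_itv/= => /andP[x0 xc]; rewrite lee_fin mulr_ge0 ?G1//.
  by have /andP[/ltW] := W_ico Ac x0 xc.
- apply/measurable_EFinP/measurable_funM; first exact: measurable_W_ico.
  exact: measurable_funB.
transitivity (\int[m]_(x in `[0%R, c[) cst 1%E x)%E; first by rewrite integral_cst// mul1e.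
apply: eq_integral => x; rewrite inE/= in_itv/= => /andP[x0 xc].
rewrite -EFinM -EFinD; congr EFin.
have -> : (1 - G c) * W x + W x * (G c - G x) = (1 - G x) * W x by ring.
rewrite /inv_survival mulfV// subr_eq0 eq_sym lt_eqF// (cdf_lt1 hG)//.
by apply: (ages_itv Ac); rewrite /= in_itv/= x0 ltW.
Qed.

Lemma integrable_weighted_density m c : ages G c ->
  leb.-integrable `[0, c] (EFin \o (fun y => g y * weighted_mass m y)).
Proof.
have [mg g0 _ _] := hG; move=> Ac; apply/integrableP; split.
  apply/measurable_EFinP/measurable_funM; last exact: measurable_weighted_mass.
  by apply: measurable_funS mg; [exact: measurable_itv|exact: itv_Rplus].
apply: (@le_lt_trans _ _ (m `[0%R, c[%classic)); last first.
  by rewrite ltey_eq fin_num_measure.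
rewrite (mass_survival m Ac).
rewrite (_ : (\int[leb]_(x in _) _)%E =
  (\int[leb]_(y in `[0%R, c]) (g y * weighted_mass m y)%:E)%E).
  rewrite leeDr// lee_fin mulr_ge0//; first by rewrite subr_ge0 ltW// (cdf_lt1 hG).
  exact: (@weighted_mass_ge0 m c).
apply: eq_integral => y; rewrite inE/= in_itv/= => /andP[y0 yc].
by rewrite ger0_norm// mulr_ge0 ?g0// (@weighted_mass_ge0 m c).
Qed.

Lemma mass_survivalR m c : ages G c ->
  fine (m `[0, c[%classic) = (1 - G c) * weighted_mass m c +
    \int[leb]_(y in `[0, c]) (g y * weighted_mass m y).
Proof.
move=> Ac; rewrite (mass_survival m Ac) fineD//.
by rewrite integrable_fin_num//; exact: integrable_weighted_density.
Qed.

Lemma mass_eq m1 m2 c : ages G c ->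
  (forall y, 0 <= y -> y <= c -> weighted_mass m1 y = weighted_mass m2 y) ->
  m1 `[0, c[%classic = m2 `[0, c[%classic.
Proof.
move=> Ac E; rewrite !(mass_survival _ Ac) E ?Ac.1//; congr (_ + _)%E.
by apply: eq_integral => y; rewrite inE/= in_itv/= => /andP[y0 yc]; rewrite E.
Qed.

(** Since k = (1 - G c) k + int_0^c g k, the quantity is the integral over [0, c] of [g] times the
    weighted difference minus [k]; beyond [e] this integrand vanishes, and int_0^e g = G e. *)
Lemma mass_increment m1 m2 c e k S : ages G c -> 0 <= e -> e <= c -> 0 <= S ->
  (forall y, 0 <= y -> y <= c ->
    `|weighted_mass m1 y - weighted_mass m2 y - k| <= S) ->
  (forall y, e <= y -> y <= c -> weighted_mass m1 y - weighted_mass m2 y = k) ->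
  `|fine (m1 `[0, c[%classic) - fine (m2 `[0, c[%classic) - k| <= G e * S.
Proof.
have [mg g0 _ _] := hG; move=> Ac e0 ec S0 Hle Heq; have c0 := Ac.1.
have i1 := integrable_weighted_density m1 Ac; have i2 := integrable_weighted_density m2 Ac.
have mI : measurable (`[0, c]%classic : set (measurableTypeR R)) by exact: measurable_itv.
have ig := integrable_density hG c0.
have ik : leb.-integrable `[0, c] (EFin \o (fun y => k * g y)) := integrableZl mI k ig.
have i12 : leb.-integrable `[0, c]
    (EFin \o (fun y => g y * weighted_mass m1 y - g y * weighted_mass m2 y)) := integrableB mI i1 i2.
pose d y := g y * weighted_mass m1 y - g y * weighted_mass m2 y - k * g y.
have id : leb.-integrable `[0, c] (EFin \o d) := integrableB mI i12 ik.
have E : fine (m1 `[0, c[%classic) - fine (m2 `[0, c[%classic) - k =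
    \int[leb]_(y in `[0, c]) d y.
  rewrite /d !RintegralB// RintegralZl// !mass_survivalR//.
  have -> : \int[leb]_(y in `[0, c]) g y = G c.
    by have [_ _ GE _] := hG; rewrite /Rintegral -GE.
  have := Heq c ec (lexx c); move: (\int[leb]_(y in _) _) => I1.
  move: (\int[leb]_(y in _) _) => I2 Ek; move: Ek => /eqP; rewrite subr_eq => /eqP ->; ring.
rewrite E; apply: le_trans (le_normr_Rintegral mI id) _.
have [_ _ GE _] := hG.
rewrite -lee_fin /Rintegral fineK; last first.
  by apply: integrable_fin_num => //; exact: (@integrable_norm _ _ _ leb _ d).
rewrite EFinM GE// muleC -ge0_integralZl//; last 2 first.
- apply/measurable_EFinP; apply: measurable_funS mg; [exact: measurable_itv|exact: itv_Rplus].
- by move=> y /=; rewrite in_itv/= => /andP[/g0].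
have dE y : 0 <= y -> y <= c -> `|d y| = g y * `|weighted_mass m1 y - weighted_mass m2 y - k|.
  move=> y0 yc; rewrite /d (_ : _ - _ - _ = g y * (weighted_mass m1 y - weighted_mass m2 y - k)); last by ring.
  by rewrite normrM ger0_norm ?g0.
have sub : `[0, e]%classic `<=` (`[0, c]%classic : set R).
  by move=> y /=; rewrite !in_itv/= => /andP[-> /le_trans]; apply.
have -> : (\int[leb]_(y in `[0%R, c]) `|d y|%:E = \int[leb]_(y in `[0%R, e]) `|d y|%:E)%E.
  rewrite -(setIidr sub) integral_mkcondr; apply: eq_integral => y.
  rewrite inE/= in_itv/= => /andP[y0 yc]; rewrite patchE mem_setE in_itv/= y0/=.
  case: ifPn => // /negP ye; rewrite dE// Heq ?subrr ?normr0 ?mulr0//.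
  by rewrite leNgt; apply/negP => /ltW.
apply: ge0_le_integral => //.
- apply/measurable_EFinP; apply: measurableT_comp => //.
  apply: measurable_funS mI sub _; apply/measurable_EFinP; exact: (measurable_int _ id).
- apply/measurable_EFinP; apply: measurable_funM; first exact: measurable_cst.
  by apply: measurable_funS mg; [exact: measurable_itv|exact: itv_Rplus].
- move=> y /=; rewrite in_itv/= => /andP[y0 ye]; have yc := le_trans ye ec.
  by rewrite -EFinM lee_fin dE// mulrC ler_wpM2r ?g0// Hle.
Qed.

End survival_mass.

Section measures_on_rays.
Context {R : realType}.
Implicit Types (m : {finite_measure set (measurableTypeR R) -> \bar R}) (x y : R).

Lemma measure_eq_open_rays m1 m2 :
  (forall x, m1 `]-oo, x[%classic = m2 `]-oo, x[%classic) -> measure_eq m1 m2.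
Proof.
move=> m12 A mA.
apply: (@g_sigma_algebra_measure_unique _ R (measurableTypeR R) (@RGenInftyO.G R) _
  (fun n => `]-oo, n%:R[%classic) _ _ m1 m2) => //.
- by move=> _ [x ->]; exact: measurable_itv.
- by move=> n; exists n%:R.
- rewrite -subTset => x _; exists (Num.truncn x).+1 => //=.
  by rewrite in_itv/= truncnS_gt.
- move=> _ _ [x ->] [y ->]; exists (Num.min x y); apply/seteqP; split => z /=;
    by rewrite !in_itv/= lt_min => /andP.
- by move=> _ [x ->]; exact: m12.
- by move=> n; rewrite ltey_eq fin_num_measure.
- have E : @measurable _ (measurableTypeR R) = <<s @RGenInftyO.G R >>.
    exact: RGenInftyO.measurableE.
  by rewrite -E.
Qed.

Lemma measure_eq_closed_rays m1 m2 :
  (forall x, m1 `]-oo, x]%classic = m2 `]-oo, x]%classic) -> measure_eq m1 m2.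
Proof.
move=> m12; apply: measure_eq_open_rays => x.
pose A n : set R := `]-oo, x - n.+1%:R^-1]%classic.
have AE : `]-oo, x[%classic = \bigcup_n A n.
  apply/seteqP; split => y /=.
    rewrite in_itv/= => yx; exists (Num.truncn (x - y)^-1) => //.
    rewrite /A/= in_itv/= lerBrDr addrC -lerBrDr invf_ple ?posrE ?subr_gt0//.
    exact/ltW/truncnS_gt.
  by move=> [n _]; rewrite /A /= !in_itv/= => /le_lt_trans; apply; rewrite ltrBlDr ltrDl.
have mA n : measurable (A n : set (measurableTypeR R)) by exact: measurable_itv.
have ndA : nondecreasing_seq A.
  move=> n k nk; apply/subsetPset => y; rewrite /A/= !in_itv/= => /le_trans; apply.
  by rewrite lerB// lef_pV2 ?posrE// ler_nat.
have c1 := nondecreasing_cvg_mu (mu := m1) mA (bigcupT_measurable _ mA) ndA.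
have c2 := nondecreasing_cvg_mu (mu := m2) mA (bigcupT_measurable _ mA) ndA.
rewrite AE -(cvg_lim _ c1)// -(cvg_lim _ c2)//.
by apply: congr_lim; apply/funext => n; exact: m12.
Qed.

End measures_on_rays.

Section ages_exhaustion.
Context {R : realType}.
Variables (G g : R -> R).
Hypothesis hG : service_cdf G g.
Implicit Types (m : measOn (ages G)) (x y c e : R).

(** Having a density, [G] is continuous with G 0 = 0, hence below 1 near 0. *)
Lemma ages_pos : exists2 e, 0 < e & ages G e.
Proof.
have [x x0 Gx] : exists2 x, 0 < x & G x < 1.
  have /(continuous_within_itvP _ ltr01)[_ + _] := cdf_continuous hG ler01.
  rewrite (cdf0 hG) => /cvgrPdist_lt/(_ 1 ltr01) G0.
  have : \forall x \near (0:R)^'+, 0 < x /\ `|0 - G x| < 1.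
    by apply: filterS2 G0 (nbhs_right_gt 0) => x.
  move=> /filter_ex[x [x0]]; rewrite sub0r normrN => /(le_lt_trans (ler_norm _)) Gx.
  by exists x.
exists (x / 2); first by rewrite divr_gt0.
split; first by rewrite divr_ge0 ?ltW.
apply: (@lt_le_trans _ _ x%:E); first by rewrite lte_fin ltr_pdivrMr// ltr_pMr// ltr1n.
by apply: ereal_sup_ubound; exists x => //; split => //; exact: ltW.
Qed.

Lemma ages_exhaust : exists c_ : nat -> R, [/\ forall n, ages G (c_ n),
  nondecreasing_seq c_ & forall x, ages G x -> exists n, x < c_ n].
Proof.
have [e e0 [_ eH]] := ages_pos; rewrite /ages.
move: eH; case: (Hs G) => [r|_|//].
  rewrite lte_fin => er; have r0 : 0 < r by exact: lt_trans er.
  exists (fun n => r - r / n.+1%:R); split.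
  - move=> n; split; first by rewrite subr_ge0 ler_pdivrMr// ler_peMr ?(ltW r0) ?ler1n.
    by rewrite lte_fin ltrBlDr ltrDl divr_gt0.
  - move=> n k nk; rewrite lerB// ler_wpM2l ?(ltW r0)// lef_pV2 ?posrE//.
    by rewrite ler_nat.
  - move=> x [x0]; rewrite lte_fin => xr; exists (Num.truncn (r / (r - x))).
    rewrite ltrBrDr addrC -ltrBrDr ltr_pdivrMr// mulrC -ltr_pdivrMr ?subr_gt0//.
    exact: truncnS_gt.
exists (fun n => n%:R); split.
- by move=> n; split; [exact: ler0n|rewrite ltry].
- by move=> n k nk; rewrite ler_nat.
- by move=> x _; exists (Num.truncn x).+1; exact: truncnS_gt.
Qed.

Lemma mass_exhaust : exists c_ : nat -> R, [/\ forall n, ages G (c_ n),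
  (forall x, ages G x -> \forall n \near \oo, x < c_ n) &
  forall m, m `[0, c_ n[%classic @[n --> \oo] --> m (ages G)].
Proof.
have [c_ [cA cnd cx]] := ages_exhaust; exists c_; split => //.
  move=> x /cx[n xn]; exists n => // k /= nk; exact: lt_le_trans (cnd _ _ nk).
move=> m; have E : ages G = \bigcup_n `[0, c_ n[%classic.
  apply/seteqP; split => x.
    by move=> Ax; have [n xn] := cx x Ax; exists n => //=; rewrite in_itv/= Ax.1.
  move=> [n _] /=; rewrite in_itv/= => /andP[x0 xc].
  by apply: (ages_itv (cA n)); rewrite /= in_itv/= x0 ltW.
have := @nondecreasing_cvg_mu _ _ _ m (fun n => `[0, c_ n[%classic : set (measurableTypeR R)).
rewrite -E; apply.
- by move=> n; exact: measurable_itv.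
- by rewrite E; apply: bigcupT_measurable => n; exact: measurable_itv.
- move=> n k nk; apply/subsetPset => x /=; rewrite !in_itv/= => /andP[-> xc].
  exact: lt_le_trans (cnd _ _ nk).
Qed.

Lemma measure_eq_ages m1 m2 :
  (forall c, ages G c -> m1 `[0, c[%classic = m2 `[0, c[%classic) -> measure_eq m1 m2.
Proof.
move=> m12; apply: measure_eq_open_rays => x.
have mA := measurable_ages G.
have mray : measurable (`]-oo, x[%classic : set (measurableTypeR R)) by exact: measurable_itv.
rewrite -!(measOn_setI mA _ mray).
have [Ax|nAx] := pselect (ages G x).
  rewrite (_ : _ `&` _ = `[0, x[%classic) ?m12//.
  apply/seteqP; split => y /=; rewrite !in_itv/=; first by move=> [-> [->]].
  move=> /andP[y0 yx]; split => //; apply: (ages_itv Ax); rewrite /= in_itv/= y0 ltW//.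
have [x0|x0] := ltP x 0.
  rewrite (_ : _ `&` _ = set0) ?measure0//; apply/seteqP; split => y //=.
  by rewrite in_itv/= => -[yx [y0 _]]; move: (le_lt_trans y0 yx); rewrite ltNge ltW.
rewrite (_ : _ `&` _ = ages G).
  have [c_ [cA _ cm]] := mass_exhaust.
  rewrite -(cvg_lim _ (cm m1))// -(cvg_lim _ (cm m2))//.
  by apply: congr_lim; apply/funext => n; exact: m12.
apply/setIidr => y Ay /=; rewrite in_itv/= ltNge; apply/negP => xy; apply: nAx.
by apply: (ages_itv Ay); rewrite /= in_itv/= x0.
Qed.

End ages_exhaustion.

(** * Consequences of the renewal equation for the age process *)

Section service_dynamics.
Context {R : realType}.
Variables (G g : R -> R) (nu0 : measOn (ages G)).
Hypothesis hG : service_cdf G g.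
Hypothesis nu01 : (nu0 setT <= 1)%E.
Implicit Types (nu : R -> measOn (ages G)) (K : R -> R) (m : measOn (ages G)) (x s t u c e z : R).
Local Notation W := (inv_survival G).

Definition service_dynamics nu K :=
  [/\ cont_path nu, forall t, 0 <= t -> (nu t setT <= 1)%E, Cup K /\ K 0 = 0,
      transport_eq g nu nu0 K & forall t, 0 <= t -> (departures g nu t < +oo)%E].

Lemma weighted_mass_renewal nu K t c : service_dynamics nu K -> 0 <= t -> ages G c ->
  weighted_mass (nu t) c = weighted_mass nu0 (c - t) + (K t - K (Num.max (t - c) 0)).
Proof.
move=> [nuc nu1 [KC K0] tr dep] t0 Ac.
exact: (renewal hG nuc nu1 nu01 (Cup_Dup KC) K0 tr dep t0 Ac).
Qed.

Local Notation busy nu t := (pairing (cst 1) (nu t)).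

Section two_solutions.
Variables (nu1 nu2 : R -> measOn (ages G)) (K1 K2 : R -> R).
Hypotheses (sd1 : service_dynamics nu1 K1) (sd2 : service_dynamics nu2 K2).

Lemma weighted_mass_diff t c : 0 <= t -> ages G c ->
  weighted_mass (nu1 t) c - weighted_mass (nu2 t) c =
  (K1 t - K2 t) - (K1 (Num.max (t - c) 0) - K2 (Num.max (t - c) 0)).
Proof.
by move=> t0 Ac; rewrite (weighted_mass_renewal sd1)// (weighted_mass_renewal sd2)//; ring.
Qed.

Lemma ages_law_unique t : 0 <= t -> (forall s, 0 <= s -> s <= t -> K1 s = K2 s) ->
  measure_eq (nu1 t) (nu2 t).
Proof.
move=> t0 K12; apply: (measure_eq_ages hG) => c Ac; apply: (mass_eq hG Ac) => y y0 yc.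
have Ay : ages G y by apply: (ages_itv Ac); rewrite /= in_itv/= y0.
apply/eqP; rewrite -subr_eq0 weighted_mass_diff// !K12 ?subrr ?lexx//.
  by rewrite le_max lexx orbT.
by rewrite ge_max t0 andbT gerBl.
Qed.

Lemma busy_increment u e t S : 0 <= u -> 0 <= e -> ages G e -> 0 <= S ->
  (forall s, 0 <= s -> s <= u -> K1 s = K2 s) -> u <= t -> t <= u + e ->
  (forall s, u <= s -> s <= t -> `|K1 s - K2 s| <= S) ->
  `|(busy nu1 t - busy nu2 t) - (K1 t - K2 t)| <= G e * S.
Proof.
move=> u0 e0 Ae S0 K12 ut tue KS; have t0 := le_trans u0 ut.
have [c_ [cA cx cm]] := mass_exhaust hG.
pose f n := `|fine (nu1 t `[0, c_ n[%classic) - fine (nu2 t `[0, c_ n[%classic) - (K1 t - K2 t)|.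
have fin (m : measOn (ages G)) :
    fine (m `[0, c_ n[%classic) @[n --> \oo] --> fine (m (ages G)).
  by apply: fine_cvg; rewrite fineK ?fin_num_measure//; exact: measurable_ages.
have cf : f n @[n --> \oo] --> `|busy nu1 t - busy nu2 t - (K1 t - K2 t)|.
  have mA := measurable_ages G.
  by rewrite !pairing_cst1//; apply: cvg_norm; apply: cvgB; [apply: cvgB; exact: fin|exact: cvg_cst].
apply: (ler_cvg_to cf (cvg_cst (G e * S))).
apply: filterS (cx e Ae) => n ec; apply: (mass_increment hG (cA n) e0 (ltW ec) S0).
  move=> y y0 yc; have Ay : ages G y by apply: (ages_itv (cA n)); rewrite /= in_itv/= y0.
  rewrite weighted_mass_diff// addrAC subrr add0r normrN.
  have m0 : 0 <= Num.max (t - y) 0 by rewrite le_max lexx orbT.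
  have mt : Num.max (t - y) 0 <= t by rewrite ge_max t0 andbT gerBl.
  have [ms|sm] := leP u (Num.max (t - y) 0); first exact: KS.
  by rewrite K12 ?subrr ?normr0// ltW.
move=> y ey yc; have y0 := le_trans e0 ey.
have Ay : ages G y by apply: (ages_itv (cA n)); rewrite /= in_itv/= y0.
rewrite weighted_mass_diff// (K12 (Num.max _ _)) ?subrr ?subr0//.
  by rewrite le_max lexx orbT.
by rewrite ge_max u0 andbT; lra.
Qed.

Let sign_bound (k b d : R) : k * b <= 0 -> `|b - k| <= d -> `|k| <= d.
Proof.
rewrite !ler_norml => kb /andP[? ?]; apply/andP; split; nra.
Qed.

(* Every customer entering service increases the number of busy servers, and
   within e time units at most a fraction G e of them leaves again. *)
Lemma entries_unique u e : 0 <= u -> 0 <= e -> ages G e ->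
  (forall s, 0 <= s -> s <= u -> K1 s = K2 s) ->
  (forall t, u <= t -> t <= u + e -> (K1 t - K2 t) * (busy nu1 t - busy nu2 t) <= 0) ->
  forall t, 0 <= t -> t <= u + e -> K1 t = K2 t.
Proof.
move=> u0 e0 Ae K12 KB t t0 tue.
have [_ _ [[cK1 _ _] _] _ _] := sd1; have [_ _ [[cK2 _ _] _] _ _] := sd2.
have ue : u <= u + e by rewrite lerDl.
have cD : {within `[u, u + e], continuous (fun s => `|K1 s - K2 s|)}.
  have cB : cont_path (fun s => K1 s - K2 s) by exact: cont_pathB.
  apply: (@continuous_subspaceW _ _ _ Rplus).
    by move=> s; rewrite /Rplus/= !in_itv/= andbT => /andP[/(le_trans u0)].
  by move=> s; apply: cvg_norm; exact: cB.
(* At a maximum point [s] of |K1 - K2| on the window, the supremum bounding the increment is the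
   value at [s] itself; the opposite signs then give |K1 s - K2 s| <= G e |K1 s - K2 s| with G e <
   1. *)
have [s] := EVT_max ue cD.
rewrite in_itv/= => /andP[us sue] smax.
have B := @busy_increment u e s `|K1 s - K2 s| u0 e0 Ae (normr_ge0 _) K12 us sue.
have {}B : `|K1 s - K2 s| <= G e * `|K1 s - K2 s|.
  apply: (@sign_bound _ (busy nu1 s - busy nu2 s)); first exact: KB.
  by apply: B => r ur rs; apply: smax; rewrite in_itv/= ur (le_trans rs).
have Ks : `|K1 s - K2 s| <= 0.
  have G1 := cdf_lt1 hG Ae.
  have : (1 - G e) * `|K1 s - K2 s| <= 0 by rewrite mulrBl mul1r subr_le0.
  by rewrite pmulr_rle0 ?subr_gt0.
have [tu|ut] := leP t u; first exact: K12.
apply/eqP; rewrite -subr_eq0 -normr_le0; apply: le_trans Ks.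
by apply: smax; rewrite in_itv/= (ltW ut).
Qed.

End two_solutions.

Lemma weighted_mass_increment m c x y : ages G c -> x <= y -> y <= c ->
  weighted_mass m y - weighted_mass m x = \int[m]_(z in `[Num.max x 0, y[) W z.
Proof.
move=> Ac xy yc.
have i1 : m.-integrable `[0, y[ (EFin \o W).
  apply: integrableS (integrable_weight hG m Ac) => //.
  by move=> z /=; rewrite !in_itv/= => /andP[-> /lt_le_trans]; apply.
have [y0|y0] := ltP y 0.
  rewrite /weighted_mass !(@set_itv_ge _ _ _ _ (_ : ~~ (_ < _)%O)) ?bnd_simp -?leNgt.
  rewrite !Rintegral_set0 subrr//.
  by rewrite le_max (ltW y0) orbT.
  exact: le_trans xy (ltW y0).
  exact: ltW.
have E : `[0, y[%classic = `[0, x[%classic `|` `[Num.max x 0, y[%classic :> set R.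
  apply/seteqP; split => z /=; rewrite !in_itv/= ge_max.
    by move=> /andP[z0 zy]; rewrite z0 zy/=; case: (ltP z x) => zx; [left|right].
  by move=> [/andP[-> /lt_le_trans]|/andP[/andP[_ ->] ->]//]; apply.
rewrite /weighted_mass {1}E Rintegral_setU//; first by rewrite addrC addKr.
  by rewrite -E.
apply/disj_setPS => z /= [] /=; rewrite !in_itv/= ge_max => /andP[_ zx] /andP[/andP[xz _] _].
by move: (lt_le_trans zx xz); rewrite ltxx.
Qed.

(** By the renewal equation, the [W]-mass of [z, z + d[ at time [t] is the initial [W]-mass of [z -
    t, z - t + d[ on the half-line plus the entries in a time interval of length at most [d]. Both
    vanish with [d], as [nu0] is atomless and [K] continuous, and W >= 1 bounds the atom by the
    [W]-mass. *)
Lemma service_atomless nu K t z : service_dynamics nu K -> atomless nu0 -> 0 <= t ->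
  ages G z -> nu t [set z] = 0%E.
Proof.
move=> sd at0 t0 Az; have [_ _ [[cK _ Knd] _] _ _] := sd; have z0 := Az.1.
have [c zc Ac] := ages_larger Az; have c0 := Ac.1.
pose d n := (c - z) / n.+1%:R.
have d0 n : 0 < d n by rewrite divr_gt0// subr_gt0.
have dc n : z + d n <= c.
  by rewrite -lerBrDl ler_pdivrMr// ler_peMr ?ler1n// subr_ge0 ltW.
have cd : d n @[n --> \oo] --> 0.
  rewrite -[X in _ --> X](mulr0 (c - z)); apply: cvgM; first exact: cvg_cst.
  exact: cvg_harmonic.
have Wc : 0 < W c by exact: (inv_survival_gt0 hG).
pose A n : set (measurableTypeR R) := `[z - t, z - t + d n[%classic.
(* The factor [W c] bounds [W] on the ages involved, trading the initial [W]-mass for an initial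
   mass. *)
pose up n := W c * fine (nu0 (A n)) + (K (Num.max (t - z) 0) - K (Num.max (t - z - d n) 0)).
have key n : fine (nu t [set z]) <= up n.
  have zd : z <= z + d n by rewrite lerDl ltW.
  have Azd : ages G (z + d n) by apply: (ages_itv Ac); rewrite /= in_itv/= dc (le_trans z0).
  have E : weighted_mass (nu t) (z + d n) - weighted_mass (nu t) z =
      (weighted_mass nu0 (z - t + d n) - weighted_mass nu0 (z - t))
      + (K (Num.max (t - z) 0) - K (Num.max (t - z - d n) 0)).
    rewrite !(weighted_mass_renewal sd)//.
    rewrite (_ : t - (z + d n) = t - z - d n); last by ring.
    by rewrite (_ : z + d n - t = z - t + d n); ring.
  have ztd : z - t <= z - t + d n by rewrite lerDl ltW.
  have ztc : z - t + d n <= c by have := dc n; lra.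
  rewrite (weighted_mass_increment _ Ac zd (dc n)) (weighted_mass_increment _ Ac ztd ztc) in E.
  rewrite (max_l z0) in E.
  have mW : measurable_fun (`[0, c[%classic : set (measurableTypeR R)) W.
    apply: measurable_funS (measurable_inv_survival hG); first exact: measurable_itv.
    by move=> x; rewrite /Rplus/= !in_itv/= andbT => /andP[].
  have W1 x : 0 <= x -> x < c -> 1 <= W x <= W c.
    move=> x0 xc; have Ax : ages G x by apply: (ages_itv Ac); rewrite /= in_itv/= x0 ltW.
    rewrite (inv_survival_nd hG x0 (ltW xc) Ac) andbT.
    by rewrite -(inv_survival0 hG) (inv_survival_nd hG (lexx 0) x0 Ax).
  apply: (@le_trans _ _ (\int[nu t]_(x in `[z, z + d n[) W x)).
    have sub : `[z, z + d n[%classic `<=` (`[0, c[%classic : set R).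
      move=> x /=; rewrite !in_itv/= => /andP[zx xd].
      by rewrite (le_trans z0 zx) (lt_le_trans xd (dc n)).
    have iW : (nu t).-integrable `[z, z + d n[ (EFin \o W).
      exact: integrableS (integrable_weight hG (nu t) Ac).
    rewrite -lee_fin /Rintegral !fineK ?fin_num_measure ?integrable_fin_num//.
    apply: (@le_trans _ _ (\int[nu t]_(x in `[z, (z + d n)%R[) cst 1%E x)%E).
      rewrite integral_cst// mul1e; apply: le_measure; rewrite ?inE//.
      by move=> _ ->; rewrite /= in_itv/= lexx ltrDl d0.
    apply: ge0_le_integral => //.
      exact: measurable_int iW.
    by move=> x /sub /=; rewrite in_itv/= => /andP[x0 xc]; rewrite lee_fin; have /andP[] := W1 x x0 xc.
  rewrite E /up lerD2r.
  have sub : `[Num.max (z - t) 0, z - t + d n[%classic `<=` (`[0, c[%classic : set R).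
    move=> x /=; rewrite !in_itv/= ge_max => /andP[/andP[_ ->] xd]/=.
    exact: lt_le_trans xd ztc.
  have iW : nu0.-integrable `[Num.max (z - t) 0, z - t + d n[ (EFin \o W).
    exact: integrableS (integrable_weight hG nu0 Ac).
  rewrite -lee_fin /Rintegral EFinM !fineK ?fin_num_measure ?integrable_fin_num//; last exact: measurable_itv.
  apply: (@le_trans _ _ (\int[nu0]_(x in `[(Num.max (z - t) 0)%R, (z - t + d n)%R[) cst (W c)%:E x)%E).
    apply: ge0_le_integral => //.
    - move=> x /sub /=; rewrite in_itv/= => /andP[x0 xc]; rewrite lee_fin.
      by have /andP[/(le_trans ler01)] := W1 x x0 xc.
    - exact: measurable_int iW.
    - move=> x /sub /=; rewrite in_itv/= => /andP[x0 xc]; rewrite lee_fin.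
      by have /andP[_] := W1 x x0 xc.
  rewrite integral_cst// lee_pmul2l ?lte_fin//; apply: le_measure; rewrite ?inE//.
    exact: measurable_itv.
  by move=> x; rewrite /A/= !in_itv/= ge_max => /andP[/andP[-> _] ->].
have cup : up n @[n --> \oo] --> W c * 0 + (K (Num.max (t - z) 0) - K (Num.max (t - z) 0)).
  apply: cvgD.
    apply: cvgM; first exact: cvg_cst.
    rewrite -(_ : fine (nu0 [set z - t]) = 0); last by rewrite at0.
    apply: fine_cvg; rewrite fineK ?fin_num_measure//.
    have AE : [set z - t] = \bigcap_n A n.
      apply/seteqP; split => x.
        by move=> -> n _; rewrite /A/= in_itv/= lexx ltrDl d0.
      move=> Ax; apply/eqP; rewrite eq_le andbC.
      have := Ax 0%N Logic.I; rewrite /A/= in_itv/= => /andP[-> _]/=.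
      rewrite -[leRHS]addr0.
      apply: (ler_cvg_to (cvg_cst x) (cvgD (cvg_cst (z - t)) cd)).
      by apply: nearW => n; have := Ax n Logic.I; rewrite /A/= in_itv/= => /andP[_ /ltW].
    rewrite AE; apply: nonincreasing_cvg_mu.
    - by rewrite ltey_eq fin_num_measure//; exact: measurable_itv.
    - by move=> n; exact: measurable_itv.
    - by rewrite -AE; exact: measurable_set1.
    - move=> n k nk; apply/subsetPset => x; rewrite /A/= !in_itv/= => /andP[-> xd]/=.
      apply: (lt_le_trans xd); rewrite lerD2l /d ler_wpM2l ?subr_ge0 ?(ltW zc)//.
      by rewrite lef_pV2 ?posrE// ler_nat.
  apply: cvgB; first exact: cvg_cst.
  have cKm := cont_path_max0 cK.
  have L : t - z - d n @[n --> \oo] --> t - z - 0.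
    by apply: cvgB; [exact: cvg_cst|exact: cd].
  rewrite subr0 in L.
  exact: (@cvg_comp _ _ _ (fun n => t - z - d n) (fun s => K (Num.max s 0)) _ _ _ L (cKm (t - z))).
apply/eqP; rewrite -measure_le0 -[leLHS]fineK ?fin_num_measure//.
rewrite lee_fin -[leRHS](_ : W c * 0 + (K (Num.max (t - z) 0) - K (Num.max (t - z) 0)) = 0); last first.
  by rewrite mulr0 add0r subrr.
apply: (ler_cvg_to (cvg_cst _) cup); exact: nearW.
Qed.

End service_dynamics.

(** * Service rate while the servers are busy *)

Section service_rate.
Context {R : realType}.
Variables (G g : R -> R) (nu0 : measOn (ages G)).
Hypothesis hG : service_cdf G g.
Hypothesis nu01 : (nu0 setT <= 1)%E.
Variables (nu : R -> measOn (ages G)) (K : R -> R).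
Hypothesis sd : service_dynamics g nu0 nu K.
Implicit Types (x s t r u c e z m : R).
Local Notation leb := (@lebesgue_measure R).
Local Notation h := (hazard G g).
Local Notation busy t := (pairing (cst 1) (nu t)).

Let mA := measurable_ages G.

(** If all rational half-balls whose full ball avoids the zeros of [g] were null, the ages would be
    a countable union of null sets: these half-balls and single points, which are null by absence of
    atoms. On the compact full ball, assumption (A) bounds [g] below; the half-radius leaves room
    for a tent function. *)
Lemma positive_density_ball u : assumptionA g nu0 -> 0 <= u -> (0%R < nu u (ages G))%E ->
  exists m r, [/\ 0 < r, (0 < nu u `](m - r / 2)%R, (m + r / 2)%R[%classic)%E &
    exists2 e, 0 < e & forall x, `|x - m| <= r -> ages G x /\ e <= g x].
Proof.
rewrite /assumptionA; set Z := [set x | _]; move=> [finZ gC at0] u0 nupos.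
pose good (m r : R) := 0 < r /\ forall x, `|x - m| <= r -> ages G x /\ ~ Z x.
suff [m [r [gmr pos]]] : exists m r, good m r /\ (0 < nu u `](m - r / 2)%R, (m + r / 2)%R[%classic)%E.
  exists m, r; split => //; first exact: gmr.1.
  have sub : `[m - r, m + r]%classic `<=` ages G `\` Z.
    move=> x /=; rewrite in_itv/= -ler_distlC distrC => xm; split;
    by have [] := gmr.2 x xm.
  have [e e0 He] := gC _ (@segment_compact _ (m - r) (m + r)) sub.
  exists e => // x xm; split; first by have [] := gmr.2 x xm.
  by apply: He; rewrite /= in_itv/= -ler_distlC distrC.
apply: contrapT => none.
pose F (k : nat) : set (measurableTypeR R) := if unpickle k is Some (m, r) then
  if `[< good (ratr m) (ratr r) >] then `](ratr m - ratr r / 2), (ratr m + ratr r / 2)[%classic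
  else set0 else set0.
have F0 k : (nu u).-negligible (F k).
  rewrite /F; case: unpickle => [[m r]|]; last exact: negligible_set0.
  case: asboolP => [gmr|_]; last exact: negligible_set0.
  apply/negligibleP; first exact: measurable_itv.
  apply/eqP; rewrite -measure_le0 leNgt; apply/negP => pos; apply: none.
  by exists (ratr m), (ratr r).
have /finite_seqP[sz ZE] := finZ.
(* Past the end of the list, [nth] returns the default 0: this also covers the age 0, around which
   no ball fits into the ages. *)
pose M k : set (measurableTypeR R) := [set nth 0 sz k].
have M0 k : (nu u).-negligible (M k).
  apply/negligibleP; first exact: measurable_set1.
  apply: (service_atomless hG nu01 sd at0 u0).
  have [ks|ks] := ltnP k (size sz); last first.
    by rewrite nth_default//; have [e e0 Ae] := ages_pos hG; apply: (ages_itv Ae); rewrite /= in_itv/= lexx ltW.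
  have : Z (nth 0 sz k) by rewrite ZE /=; exact: mem_nth.
  by case.
have : (nu u).-negligible (ages G).
  apply: (@negligibleS _ _ _ _ (\bigcup_k (F k) `|` \bigcup_k M k)); last first.
    by apply: negligibleU; exact: negligible_bigcup.
  move=> x Ax; have [Zx|nZx] := pselect (Z x).
    right; move: Zx; rewrite ZE /= => xs; exists (index x sz) => //.
    by rewrite /M/= nth_index.
  have [->|x0] := eqVneq x 0.
    by right; exists (size sz) => //; rewrite /M/= nth_default.
  left; have {}x0 : 0 < x by rewrite lt_neqAle eq_sym x0 Ax.1.
  have [y xy Ay] := ages_larger Ax.
  have oO : open (`]0, y[%classic `&` ~` Z).
    apply: openI; first exact: itv_open.
    rewrite openC; apply: (iffLR accessible_finite_set_closed); last exact: finZ.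
    exact/hausdorff_accessible/Rhausdorff.
  have : nbhs x (`]0, y[%classic `&` ~` Z).
    by apply: open_nbhs_nbhs; split => //; split => //=; rewrite in_itv/= x0.
  move=> /nbhs_ballP[d /= d0 dO].
  have d4 : 0 < d / 4 by rewrite divr_gt0.
  (* With [m] within r / 2 of [x], the ball of radius [r] about [m] stays within 3 r / 2 < d of
     [x]. *)
  have [r /=] := rat_in_itvoo d4; rewrite in_itv/= => /andP[r0 rd].
  have xr : x - ratr r / 2 < x by rewrite ltrBlDr ltrDl divr_gt0.
  have [m /=] := rat_in_itvoo xr; rewrite in_itv/= => /andP[rm mx].
  have gmr : good (ratr m) (ratr r).
    split => // z zm; have [] : (`]0, y[%classic `&` ~` Z) z.
      apply: dO; rewrite /ball/=; move: zm; rewrite ler_norml ltr_norml => /andP[? ?].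
      by apply/andP; split; lra.
    move=> /=; rewrite in_itv/= => /andP[z0 zy] nZ; split => //.
    by apply: (ages_itv Ay); rewrite /= in_itv/= !ltW.
  exists (pickle (m, r)); first by [].
  rewrite /F pickleK (asboolT gmr) /=.
  by rewrite in_itv/=; apply/andP; split; lra.
move=> /(measure_negligible mA) n0.
by move: nupos; rewrite n0 ltxx.
Qed.

(** The hazard rate need not be continuous, so its pairing is not controlled by weak continuity. It
    is bounded below by [e0] times a tent function supported where g >= e0, because h >= g; the
    pairing with the tent is continuous in time and positive at [u], the tent being at least 1/2 on
    the half-ball. *)
Lemma service_rate_lower u : assumptionA g nu0 -> 0 <= u -> (0%R < nu u (ages G))%E ->
  exists c e, [/\ 0 < c, 0 < e & forall s, u <= s -> s <= u + e ->
    (c%:E <= epairing h (nu s))%E].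
Proof.
move=> hA u0 nupos; have [nuc nu1 _ _ _] := sd.
have [m [r [r0 pos [e0 e00 eg]]]] := positive_density_ball hA u0 nupos.
pose f x := Num.max (1 - `|x - m| / r) 0.
have f01 x : 0 <= f x <= 1.
  rewrite /f le_max lexx orbT ge_max ler01 andbT gerBl divr_ge0 ?(ltW r0)//.
have cf : continuous f.
  move=> x; apply: (@continuous_comp _ _ _ (fun x => 1 - `|x - m| / r) (fun z => Num.max z 0)); last exact: continuous_pos.
  apply: cvgB; first exact: cvg_cst.
  apply: cvgM; last exact: cvg_cst.
  by apply: cvg_norm; apply: cvgB; [exact: cvg_id|exact: cvg_cst].
have tf : test_fun (ages G) f.
  by apply: (@bounded_test_fun _ _ _ 1) => // x; have /andP[? ?] := f01 x; rewrite ger0_norm.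
have mf : measurable_fun (ages G : set (measurableTypeR R)) f.
  by apply: measurable_funTS; exact: continuous_measurable_fun.
have ifm (n : measOn (ages G)) : n.-integrable (ages G) (EFin \o f).
  by apply: (@bounded_integrable _ _ _ mA _ 1) => // x _; have /andP[? ?] := f01 x; rewrite ger0_norm.
have EF (n : measOn (ages G)) : (pairing f n)%:E = (\int[n]_(x in ages G) (f x)%:E)%E.
  by rewrite /pairing /Rintegral fineK//; exact: (integrable_fin_num mA (ifm n)).
have fh (n : measOn (ages G)) : (e0%:E * (pairing f n)%:E <= epairing h n)%E.
  rewrite EF -ge0_integralZl//; last 3 first.
  - exact/measurable_EFinP.
  - by move=> x _; rewrite lee_fin; have /andP[] := f01 x.
  - by rewrite lee_fin ltW.
  apply: ge0_le_integral => //.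
  - by move=> x _; have /andP[? ?] := f01 x; rewrite -EFinM lee_fin mulr_ge0 ?(ltW e00).
  - by apply/measurable_EFinP/measurable_funM.
  - apply/measurable_EFinP; apply: measurable_funS (measurable_hazard hG); first exact: measurable_itv.
    exact: ages_Rplus.
  - move=> x Ax; rewrite -EFinM lee_fin; have /andP[f0 f1] := f01 x.
    have [xm|xm] := leP `|x - m| r; last first.
      rewrite /f max_r ?mulr0 ?(hazard_ge0 hG)// subr_le0 ler_pdivlMr// mul1r ltW//.
    have [_ egx] := eg x xm; have [_ g0 _ _] := hG.
    apply: (@le_trans _ _ e0); first by rewrite ler_piMr// ltW.
    apply: (le_trans egx); have Gx := cdf_lt1 hG Ax; have G0 := cdf_ge0 hG Ax.1.
    rewrite /hazard ler_pdivlMr ?subr_gt0// ler_piMr ?g0 ?Ax.1// gerBl//.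
have fpos : 0 < pairing f (nu u).
  rewrite -lte_fin EF.
  apply: (@lt_le_trans _ _ (\int[nu u]_(x in `](m - r / 2)%R, (m + r / 2)%R[) cst (2^-1)%:E x)%E).
    by rewrite integral_cst//=; apply: mule_gt0 => //; rewrite lte_fin invr_gt0.
  apply: (@le_trans _ _ (\int[nu u]_(x in `](m - r / 2)%R, (m + r / 2)%R[) (f x)%:E)%E).
    apply: ge0_le_integral => //.
    - by move=> x _; rewrite lee_fin; have /andP[] := f01 x.
    - by apply/measurable_EFinP/measurable_funTS; exact: continuous_measurable_fun.
    move=> x /=; rewrite in_itv/= => /andP[x1 x2]; rewrite lee_fin /f le_max; apply/orP; left.
    have : `|x - m| / r <= 2^-1.
      by rewrite ler_pdivrMr// mulrC ler_norml; apply/andP; split; lra.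
    lra.
  apply: ge0_subset_integral => //.
  - exact/measurable_EFinP.
  - by move=> x _; rewrite lee_fin; have /andP[] := f01 x.
  - move=> x /=; rewrite in_itv/= => /andP[x1 x2].
    have [] // := eg x _; rewrite ler_norml; apply/andP; split; lra.
have half : 0 < pairing f (nu u) / 2 by rewrite divr_gt0.
have [d d0 dP] := cont_path_ltP (pairing_cont_path nuc tf) u0 half.
exists (e0 * (pairing f (nu u) / 2)), (d / 2); split; rewrite ?mulr_gt0// ?divr_gt0// => s us sd2.
apply: le_trans (fh (nu s)); rewrite -EFinM lee_fin ler_wpM2l ?(ltW e00)//.
have s0 := le_trans u0 us.
have : `|u - s| < d by rewrite ltr_norml; apply/andP; split; lra.
by move=> /(dP s s0); rewrite ltr_norml => /andP[_]; lra.
Qed.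

Lemma departures_increment c s r : 0 <= s -> s <= r -> 0 <= c ->
  (forall t, s <= t -> t <= r -> (c%:E <= epairing h (nu t))%E) ->
  c * (r - s) <= fine (departures g nu r) - fine (departures g nu s).
Proof.
move=> s0 sr c0 cH; have [nuc nu1 _ _ dep] := sd; have r0 := le_trans s0 sr.
have H0 t : (0 <= epairing h (nu t))%E.
  by apply: integral_ge0 => x Ax; rewrite lee_fin (hazard_ge0 hG).
have fin t : 0 <= t -> departures g nu t \is a fin_num.
  by move=> t0; rewrite ge0_fin_numE ?dep//; apply: integral_ge0.
have mh : measurable_fun (ages G : set (measurableTypeR R)) h.
  by apply: measurable_funS (measurable_hazard hG); [exact: measurable_itv|exact: ages_Rplus].
have mH : measurable_fun (`[0, r]%classic : set (measurableTypeR R)) (fun t => epairing h (nu t)).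
  have mc1 : measurable_fun setT (cst 1 : measurableTypeR R -> R) by exact: measurable_cst.
  have := @measurable_translated_pairing R _ nu mA nuc nu1 h (cst 1) r mh
    (fun x => @hazard_ge0 _ _ _ hG x) mc1 (fun=> ler01).
  by apply: eq_measurable_fun => t _; apply: eq_integral => x _; rewrite mulr1.
have mI a b : measurable (`]a, b]%classic : set (measurableTypeR R)) by exact: measurable_itv.
have mJ b : measurable (`[0, b]%classic : set (measurableTypeR R)) by exact: measurable_itv.
have E : `[0, r]%classic = `[0, s]%classic `|` `]s, r]%classic :> set R.
  apply/seteqP; split => x /=; rewrite !in_itv/=.
    by move=> /andP[x0 xr]; rewrite x0 xr; case: (leP x s) => xs; [left|right].
  by move=> [/andP[-> /le_trans]|/andP[/ltW/(le_trans s0)-> ->]//]; apply.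
have : (departures g nu s + (c * (r - s))%:E <= departures g nu r)%E.
  rewrite {2}/departures E ge0_integral_setU//; last 2 first.
  - by rewrite -E.
  - apply/disj_setPS => x [] /=; rewrite !in_itv/= => /andP[_ xs] /andP[sx _].
    by move: (lt_le_trans sx xs); rewrite ltxx.
  apply: leeD2l.
  apply: (@le_trans _ _ (\int[leb]_(t in `]s, r]) cst c%:E t)%E).
    rewrite integral_cst//= lebesgue_measure_itv/= lte_fin.
    by case: ifPn => [_|/negP sr']; rewrite -?EFinB -EFinM lee_fin// ler_wpM2l//; lra.
  apply: ge0_le_integral => //.
  - by apply: measurable_funS mH => // x /=; rewrite !in_itv/= => /andP[/ltW/(le_trans s0)-> ->].
  - by move=> t /=; rewrite in_itv/= => /andP[/ltW st tr]; exact: cH.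
rewrite -(fineK (fin s s0)) -(fineK (fin r r0)) -EFinD lee_fin; lra.
Qed.

Variables (lambda : R -> R) (pi : probability (measurableTypeR R) R).
Variables (Q0 : measOn (@Rplus R)) (alpha : R -> measOn (@Rplus R)).
Hypothesis hlambda : arrival_rate lambda.
Hypothesis halpha : arrival_process Q0 lambda pi alpha.
Hypothesis hpi : patience_law pi.
Hypothesis hAB : assumptionA g nu0 \/ assumptionB pi.
Hypothesis hK : forall t, 0 <= t ->
  K t = busy t - pairing (cst 1) nu0 + fine (departures g nu t).
Variable q : R -> R.
Hypothesis hq : forall t, 0 <= t -> q t = pos_part (q t + busy t - 1).

Lemma busy_le1 t : 0 <= t -> busy t <= 1.
Proof.
have [_ nu1 _ _ _] := sd; move=> t0.
by rewrite pairing_cst1// -lee_fin fineK ?fin_num_measure// -(measOn_setT mA) nu1.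
Qed.

Lemma busy_full t : 0 <= t -> 0 < q t -> busy t = 1.
Proof.
move=> t0 qt; have := hq t0; rewrite /pos_part; have [_|qb] := leP 0 (q t + busy t - 1).
  lra.
by move=> q0; move: qt; rewrite q0 ltxx.
Qed.

Lemma busy_cont : cont_path (fun t => busy t).
Proof.
have [nuc _ _ _ _] := sd; apply: pairing_cont_path => //.
by apply: (@bounded_test_fun _ _ _ 1) => [|x]; [exact: cst_continuous|rewrite normr1].
Qed.

(* While there is a queue, all servers are busy, so that entries into service
   compensate departures; near time u these outnumber the arrivals with a
   deadline in the window. *)
Lemma entries_exceed_urgent_arrivals u : 0 <= u ->
  exists2 e0, 0 < e0 & forall e, e <= e0 -> forall x s r,
    0 <= x -> x <= u + e -> u <= s -> s <= r -> r <= u + e ->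
    (forall t, s < t -> t <= r -> 0 < q t) ->
    mass_upto alpha x r - mass_upto alpha x s <= K r - K s.
Proof.
move=> u0; have [nuc nu1 [[Kc K0 Knd] _] _ dep] := sd.
have u10 : 0 <= u + 1 by rewrite addr_ge0.
have [L L0 lL] := arrival_rate_bounded hlambda u10.
have arr e p x s r : e <= 1 -> x <= u + e -> u <= s -> s <= r -> r <= u + e ->
    0 <= x -> 0 <= p -> (pi `[0%R, e]%classic <= p%:E)%E ->
    mass_upto alpha x r - mass_upto alpha x s <= L * p * (r - s).
  move=> e1 xe us sr re x0 p0 pip; have s0 := le_trans u0 us.
  suff : 0 <= mass_upto alpha x r - mass_upto alpha x s <= L * p * (r - s) by move=> /andP[].
  apply: (arrival_increment_bounds hlambda halpha x0 s0 sr) => //.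
    move=> t st tr; apply: lL; first exact: le_trans st.
    by apply: le_trans tr (le_trans re _); rewrite lerD2l.
  apply: le_trans pip; apply: le_measure; rewrite ?inE; [exact: measurable_itv|exact: measurable_itv|].
  by move=> y /=; rewrite !in_itv/= => /andP[->] /le_trans; apply; lra.
(* Under (B), no customer arriving in a window shorter than [k] has a deadline in it: the arrival
   bound applies with p = 0. *)
case: hAB => [hA|[k k0 pik]]; last first.
  exists (Num.min 1 k); first by rewrite lt_min ltr01.
  move=> e; rewrite le_min => /andP[e1 ek] x s r x0 xe us sr re _.
  apply: (@le_trans _ _ (L * 0 * (r - s))); last first.
    by rewrite mulr0 mul0r subr_ge0 Knd// (le_trans u0).
  apply: (arr e) => //; apply: (@le_trans _ _ (pi `[0, k]%classic)); last by rewrite pik.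
  apply: le_measure; rewrite ?inE; [exact: measurable_itv|exact: measurable_itv|].
  by move=> y /=; rewrite !in_itv/= => /andP[-> /le_trans]; apply.
(* With idle capacity at [u], there is idle capacity throughout a short window, so a positive queue
   on ]s, r] forces s = r. *)
have [b1|b1] := leP 1 (busy u); last first.
  have b10 : 0 < 1 - busy u by rewrite subr_gt0.
  have [d d0 dP] := cont_path_ltP busy_cont u0 b10.
  exists (d / 2); first by rewrite divr_gt0.
  move=> e ed x s r x0 xe us sr re qpos.
  move: sr; rewrite le_eqVlt => /predU1P[->|sr]; first by rewrite !subrr.
  have r0 : 0 <= r := le_trans u0 (le_trans us (ltW sr)).
  have : `|u - r| < d by rewrite ltr_norml; apply/andP; split; lra.
  move=> /(dP r r0); rewrite (busy_full r0 (qpos r sr (lexx r))) ltr_norml => /andP[].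
  by lra.
have nupos : (0%R < nu u (ages G))%E.
  rewrite -[ltRHS]fineK ?fin_num_measure// lte_fin -pairing_cst1//.
  exact: lt_le_trans ltr01 b1.
have [c [e1 [c0 e10 ce]]] := service_rate_lower hA u0 nupos.
(* Chosen so that the rate L p of urgent arrivals is at most the service rate [c]; the 1 guards
   against L = 0. *)
have Lc : 0 < c / (L + 1) by rewrite divr_gt0// ltr_wpDl.
have [e2 e20 pie2] := patience_small hpi Lc.
exists (Num.min 1 (Num.min e1 e2)); first by rewrite !lt_min ltr01 e10.
move=> e; rewrite !le_min => /andP[el1 /andP[ee1 ee2]] x s r x0 xe us sr re qpos.
move: sr; rewrite le_eqVlt => /predU1P[->|sr]; first by rewrite !subrr.
have s0 := le_trans u0 us; have r0 : 0 <= r := le_trans s0 (ltW sr).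
apply: (@le_trans _ _ (L * (c / (L + 1)) * (r - s))).
  apply: (arr e) => //; rewrite ?(ltW sr) ?(ltW Lc)//.
  apply: le_trans pie2; apply: le_measure; rewrite ?inE; [exact: measurable_itv|exact: measurable_itv|].
  by move=> y /=; rewrite !in_itv/= => /andP[-> /le_trans]; apply.
apply: (@le_trans _ _ (c * (r - s))).
  apply: ler_wpM2r; first by rewrite subr_ge0 ltW.
  by rewrite mulrCA ler_piMr ?(ltW c0)// ler_pdivrMr ?mul1r ?lerDl// ltr_wpDl.
(* Entries are departures plus the increase of the busy mass, and that increase is nonnegative: the
   busy mass is 1 at [r] and at most 1 at [s]. *)
have := @departures_increment c s r s0 (ltW sr) (ltW c0).
rewrite !hK// (busy_full r0 (qpos r sr (lexx r))) => H.
have := busy_le1 s0.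
have {}H : c * (r - s) <= fine (departures g nu r) - fine (departures g nu s).
  apply: H => t st tr; apply: ce; first exact: le_trans st.
  by apply: le_trans tr (le_trans re _); rewrite lerD2l.
move: H; move: (fine _) (fine _) => D1 D2; lra.
Qed.

End service_rate.

(** * Uniqueness *)

Section supports_and_atoms.
Context {R : realType}.
Implicit Types (m : measOn (@Rplus R)) (x t u d e : R).

Let mR : measurable (Rplus : set (measurableTypeR R)).
Proof. exact: measurable_itv. Qed.

Lemma inf_support_mass m t x : inf_support m = t%:E -> t < x ->
  0 < fine (m `[0, x]%classic).
Proof.
move=> mt tx; have mxt : (inf_support m < x%:E)%E by rewrite mt lte_fin.
have [_ [y my <-]] := ereal_inf_lt mxt; rewrite lte_fin => yx.
have mray : measurable (`]-oo, x[%classic : set (measurableTypeR R)) by exact: measurable_itv.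
have : (0 < m `]-oo, x[%classic)%E.
  by apply: my; [exact: lray_open|rewrite /= in_itv].
rewrite -(measOn_setI mR m mray) => pos.
have mx : measurable (`[0, x]%classic : set (measurableTypeR R)) by exact: measurable_itv.
rewrite -lte_fin fineK ?fin_num_measure//; apply: lt_le_trans pos _.
apply: le_measure; rewrite ?inE//; first exact: measurableI.
by move=> z [] /=; rewrite /Rplus/= !in_itv/= andbT => /ltW -> ->.
Qed.

(** The bound applies to the intervals ]t - d_n, t + d_n], which shrink to {t}. *)
Lemma atomless_thin m t u e : atomless m -> 0 < t -> t < u ->
  (forall x x', 0 <= x' -> x' < t -> t < x -> x <= u ->
    e <= fine (m `[0, x]%classic) - fine (m `[0, x']%classic)) -> e <= 0.
Proof.
move=> at0 t0 tu H; pose d := Num.min t (u - t).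
have d0 : 0 < d by rewrite /d lt_min t0 subr_gt0.
have dt : d <= t by rewrite /d ge_min lexx.
have du : d <= u - t by rewrite /d ge_min lexx orbT.
pose dn n := d / n.+1%:R.
have dn0 n : 0 < dn n by rewrite divr_gt0.
have dnd n : dn n <= d by rewrite ler_pdivrMr// ler_peMr ?ler1n// ltW.
have cd : dn n @[n --> \oo] --> 0.
  by rewrite -[X in _ --> X](mulr0 d); apply: cvgM; [exact: cvg_cst|exact: cvg_harmonic].
pose A n : set (measurableTypeR R) := `](t - dn n), (t + dn n)]%classic.
have mA n : measurable (A n) by exact: measurable_itv.
have eA n : e <= fine (m (A n)).
  have x'0 : 0 <= t - dn n by have := dnd n; lra.
  have := H (t + dn n) (t - dn n) x'0.
  rewrite ltrBlDr !ltrDl dn0 => /(_ isT isT) He.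
  have : e <= fine (m `[0, t + dn n]%classic) - fine (m `[0, t - dn n]%classic).
    by apply: He; have := dnd n; lra.
  move=> /le_trans; apply; rewrite lerBlDl -fineD ?fin_num_measure//.
  rewrite -measureU//.
  - rewrite (_ : `[0, t + dn n]%classic = `[0, t - dn n]%classic `|` A n)//.
    apply/seteqP; split => y; rewrite /A/= !in_itv/=.
      by move=> /andP[y0 yt]; rewrite y0 yt; case: (leP y (t - dn n)) => ?; [left|right].
    have tt : t - dn n <= t + dn n by have := dn0 n; lra.
    move=> [/andP[-> /le_trans]|/andP[ty ->]]; first exact.
    by rewrite (le_trans x'0 (ltW ty)).
  - apply/seteqP; split => y //; rewrite /A/= !in_itv/= => -[/andP[_ y1] /andP[y2 _]].
    by move: (lt_le_trans y2 y1); rewrite ltxx.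
have AE : [set t] = \bigcap_n A n.
  apply/seteqP; split => x.
    by move=> -> n _; rewrite /A/= in_itv/= ltrBlDr ltrDl dn0 lerDl ltW.
  move=> Ax; apply/eqP; rewrite eq_le; apply/andP; split.
    rewrite -[leRHS]addr0; apply: (ler_cvg_to (cvg_cst x) (cvgD (cvg_cst t) cd)).
    by apply: nearW => n; have := Ax n Logic.I; rewrite /A/= in_itv/= => /andP[_].
  rewrite -[leLHS]subr0; apply: (ler_cvg_to (cvgB (cvg_cst t) cd) (cvg_cst x)).
  by apply: nearW => n; have := Ax n Logic.I; rewrite /A/= in_itv/= => /andP[/ltW].
have cA : fine (m (A n)) @[n --> \oo] --> 0.
  rewrite -(_ : fine (m [set t]) = 0); last by rewrite at0.
  apply: fine_cvg; rewrite fineK ?fin_num_measure//.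
  rewrite AE; apply: nonincreasing_cvg_mu.
  - by rewrite ltey_eq fin_num_measure.
  - exact: mA.
  - by rewrite -AE; exact: measurable_set1.
  - move=> n k nk; apply/subsetPset => x; rewrite /A/= !in_itv/=.
    have dkn : dn k <= dn n by rewrite /dn ler_pM2l// lef_pV2 ?posrE// ler_nat.
    by move=> /andP[? ?]; apply/andP; split; lra.
by apply: (ler_cvg_to (cvg_cst e) cA); exact: nearW.
Qed.

End supports_and_atoms.

Section solution.
Context {R : realType}.
Variables (G g lambda : R -> R) (pi : probability (measurableTypeR R) R).
Hypotheses (hG : service_cdf G g) (hlambda : arrival_rate lambda) (hpi : patience_law pi).
Variables (Q0 : measOn (@Rplus R)) (nu0 : measOn (ages G)).
Variables (alpha : R -> measOn (@Rplus R)) (X0 : R).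
Hypotheses (hAB : assumptionA g nu0 \/ assumptionB pi).
Hypotheses (hdata : initial_data Q0 nu0 alpha X0).
Hypotheses (halpha : arrival_process Q0 lambda pi alpha).
Variables (Q : R -> measOn (@Rplus R)) (nu : R -> measOn (ages G)) (K Ren : R -> R).
Hypothesis sol : FME g Q nu K Ren Q0 nu0 alpha.
Implicit Types (x s t r u e : R).
Local Notation q := (total_queue Q).
Local Notation busy t := (pairing (cst 1) (nu t)).

Let nu01 : (nu0 setT <= 1)%E. Proof. by case: hdata => -[]. Qed.

Lemma solution_balance t : 0 <= t -> q 0 + arrivals alpha t = q t + K t + Ren t.
Proof. by move=> t0; have [_ [_ /(_ t t0)[[]]]] := sol. Qed.

Lemma solution_K_Ren0 : K 0 = 0 /\ Ren 0 = 0.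
Proof.
have [[_ _ [_ K0 _] [_ R0 _]] _] := sol.
have := solution_balance (lexx 0); rewrite /arrivals subrr addr0.
by have := K0 0 (lexx 0); have := R0 0 (lexx 0) => ? ? ?; split; lra.
Qed.

Lemma solution_dynamics : service_dynamics g nu0 nu K.
Proof.
have [[_ [nuc nu1] KC RC] [[_ _ dep] H]] := sol.
split => //; first by split => //; have [] := solution_K_Ren0.
by move=> t t0 phi phix phis C; have [[tr _ _ _] _] := H t t0; exact: tr.
Qed.

Lemma solution_entries t : 0 <= t ->
  K t = busy t - pairing (cst 1) nu0 + fine (departures g nu t).
Proof. by move=> t0; have [_ [_ /(_ t t0)[[]]]] := sol. Qed.

Lemma solution_queue t : 0 <= t -> q t = pos_part (q t + busy t - 1).
Proof. by move=> t0; have [_ [_ /(_ t t0)[[]]]] := sol. Qed.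

Lemma solution_queue_cont : cont_path q.
Proof.
have [[Qc _ _ _] _] := sol.
have qE : q = (fun t => pairing (cst 1) (Q t)).
  by apply/funext => t; rewrite pairing_cst1//; exact: measurable_itv.
rewrite qE; apply: pairing_cont_path => //.
by apply: (@bounded_test_fun _ _ _ 1) => [|x]; [exact: cst_continuous|rewrite normr1].
Qed.

Let KR s := K s + Ren s.

Lemma solution_reflection x : 0 <= x ->
  exists eta, reflection (mass_upto alpha x \- KR) (mass_upto Q x) eta /\ eta 0 = 0.
Proof.
move=> x0; have [[_ _ [Kc _ _] [Rc _ _]] [_ H]] := sol.
have [_ [_ [sk _]]] := H 0 (lexx 0).
apply: (skorohod_reflection sk) => //; last exact: (arrival_cont hlambda halpha).
  exact: cont_pathD.
by rewrite /KR; have [-> ->] := solution_K_Ren0; rewrite addr0.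
Qed.

Lemma psi_cont x : 0 <= x -> cont_path (mass_upto alpha x \- KR).
Proof.
move=> x0; have [[_ _ [Kc _ _] [Rc _ _]] _] := sol.
apply: cont_pathB; first exact: (arrival_cont hlambda halpha).
exact: cont_pathD.
Qed.

Lemma mass_upto_ge0 x t : 0 <= mass_upto Q x t.
Proof. exact: fine_ge0. Qed.

Lemma mass_upto_le_queue x t : mass_upto Q x t <= q t.
Proof.
have mx : measurable (`[0, x]%classic : set (measurableTypeR R)) by exact: measurable_itv.
have mo : measurable (`[0, +oo[%classic : set (measurableTypeR R)) by exact: measurable_itv.
rewrite /mass_upto /total_queue -lee_fin !fineK ?fin_num_measure//.
apply: le_measure; rewrite ?inE//.
by move=> y /=; rewrite !in_itv/= andbT => /andP[].
Qed.

(** Positivity of the queue is asked on ]s, r] only, so that [s] may be a zero of the queue, as in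
    the argument from its last zero. *)
Definition window_at u e := forall x s r,
    0 <= x -> x <= u + e -> u <= s -> s <= r -> r <= u + e ->
    (forall t, s < t -> t <= r -> 0 < q t) ->
    (mass_upto alpha x \- KR) r <= (mass_upto alpha x \- KR) s.

Lemma window_exists u : 0 <= u -> exists2 e0, 0 < e0 & forall e, e <= e0 -> window_at u e.
Proof.
move=> u0; have [e0 e00 He] := entries_exceed_urgent_arrivals hG nu01 solution_dynamics
  hlambda halpha hpi hAB solution_entries solution_queue u0.
have [[_ _ _ [_ _ Rnd]] _] := sol.
exists e0 => // e ee x s r x0 xe us sr re qpos; have s0 := le_trans u0 us.
have := He e ee x s r x0 xe us sr re qpos; have := Rnd s r s0 sr.
by rewrite /= /KR; lra.
Qed.

(** The queue may become positive after [u]. From its last zero before [t] on, the driving path is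
    nonincreasing, so the reflected mass of [0, x], which is 0 at that zero, is 0 at [t]. *)
Lemma empty_queue_window u e x t : 0 <= u -> window_at u e -> q u = 0 ->
  0 <= x -> x <= u + e -> u <= t -> t <= u + e -> mass_upto Q x t = 0.
Proof.
move=> u0 win qu x0 xe ut te.
have qu0 : q u <= 0 by rewrite qu.
have [s [us st qs qpos]] := last_nonpos_time solution_queue_cont u0 ut qu0.
have s0 := le_trans u0 us.
have [eta [refl _]] := solution_reflection x0.
apply/eqP; rewrite eq_le mass_upto_ge0 andbT.
apply: le_trans (reflection_le (psi_cont x0) refl s0 st _) _.
  move=> s' r ss' sr rt; apply: win => //; first exact: le_trans us ss'.
    exact: le_trans rt te.
  by move=> t' st' t'r; apply: qpos; [exact: le_lt_trans st'|exact: le_trans rt].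
rewrite /pos_part ge_max lexx andbT.
have := mass_upto_le_queue x s.
have : (mass_upto alpha x \- KR) t <= (mass_upto alpha x \- KR) s by apply: win.
lra.
Qed.

Lemma reneging_ae : {ae stieltjes Ren, forall s, 0 <= s -> inf_support (Q s) = s%:E}.
Proof. by have [_ [_ /(_ 0 (lexx 0))[_ [_ []]]]] := sol. Qed.

(** Reneging at [r] puts the infimum of the support at [r], hence positive mass on [0, u + e] when r
    < u + e; this is why the end of the window is excluded. *)
Lemma empty_queue_no_reneging u e t : 0 <= u -> window_at u e -> q u = 0 ->
  u <= t -> t < u + e -> Ren t = Ren u.
Proof.
move=> u0 win qu ut te; have [[_ _ _ RC] _] := sol; apply/esym.
apply: (stieltjes_ae_const (Cup_Dup RC) reneging_ae u0 ut) => r /andP[ur rt] H.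
have r0 := le_trans u0 (ltW ur); have re := le_lt_trans rt te.
have := inf_support_mass (H r0) re.
rewrite -/(mass_upto Q (u + e) r) (empty_queue_window u0 win qu) ?ltxx ?(ltW ur) ?(ltW re)//.
exact: le_trans r0 (ltW re).
Qed.

Lemma queue_left_null t x : 0 <= t -> x < t -> mass_upto Q x t = 0.
Proof.
move=> t0 xt; have [_ [_ /(_ t t0)[_ [[Qt _] _]]]] := sol.
apply/eqP; rewrite eq_le mass_upto_ge0 andbT /mass_upto -lee_fin fineK ?fin_num_measure//.
apply: (@le_trans _ _ (Q t `[0, t[%classic)); last by rewrite Qt.
apply: le_measure; rewrite ?inE; [exact: measurable_itv|exact: measurable_itv|].
by move=> y /=; rewrite !in_itv/= => /andP[-> /le_lt_trans]; apply.
Qed.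

Lemma queue_increment_le x x' t : 0 <= x' -> x' <= x -> 0 <= t ->
  mass_upto Q x t - mass_upto Q x' t <= mass_upto alpha x t - mass_upto alpha x' t.
Proof.
have [_ [_ H]] := sol; have [_ [_ [sk _]]] := H 0 (lexx 0).
exact: (skorohod_increment_le sk).
Qed.

End solution.

(** * Comparison of two solutions *)

Section two_solutions.
Context {R : realType}.
Variables (G g lambda : R -> R) (pi : probability (measurableTypeR R) R).
Hypotheses (hG : service_cdf G g) (hlambda : arrival_rate lambda) (hpi : patience_law pi).
Variables (Q0 : measOn (@Rplus R)) (nu0 : measOn (ages G)).
Variables (alpha : R -> measOn (@Rplus R)) (X0 : R).
Hypotheses (hAB : assumptionA g nu0 \/ assumptionB pi).
Hypotheses (hdata : initial_data Q0 nu0 alpha X0).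
Hypotheses (halpha : arrival_process Q0 lambda pi alpha).
Implicit Types (Q : R -> measOn (@Rplus R)) (nu : R -> measOn (ages G)) (K : R -> R).
Implicit Types (x s t r u e : R).

Definition same_controls K1 Ren1 K2 (Ren2 : R -> R) u :=
  forall s, 0 <= s -> s <= u -> K1 s = K2 s /\ Ren1 s = Ren2 s.

Lemma same_controls_queue Q1 Q2 nu1 nu2 K1 K2 Ren1 Ren2 x u :
  FME g Q1 nu1 K1 Ren1 Q0 nu0 alpha -> FME g Q2 nu2 K2 Ren2 Q0 nu0 alpha ->
  same_controls K1 Ren1 K2 Ren2 u -> 0 <= x -> 0 <= u ->
  mass_upto Q1 x u = mass_upto Q2 x u.
Proof.
move=> sol1 sol2 same x0 u0.
have [eta1 [r1 e1]] := solution_reflection hlambda halpha sol1 x0.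
have [eta2 [r2 e2]] := solution_reflection hlambda halpha sol2 x0.
have psi12 t : 0 <= t -> t <= u -> (mass_upto alpha x \- (fun s => K1 s + Ren1 s)) t =
    (mass_upto alpha x \- (fun s => K2 s + Ren2 s)) t.
  by move=> t0 tu; have [/= -> ->] := same t t0 tu.
have e12 := reflection_unique r1 r2 (etrans e1 (esym e2)) psi12 u0 (lexx u).
have [E1 _ _ _ _] := r1; have [E2 _ _ _ _] := r2.
by rewrite E1// E2// e12 psi12.
Qed.

Lemma same_initial_queue Q1 Q2 nu1 nu2 K1 K2 Ren1 Ren2 :
  FME g Q1 nu1 K1 Ren1 Q0 nu0 alpha -> FME g Q2 nu2 K2 Ren2 Q0 nu0 alpha ->
  total_queue Q1 0 = total_queue Q2 0.
Proof.
move=> [_ [[Q1E _ _] _]] [_ [[Q2E _ _] _]].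
by rewrite /total_queue Q1E ?Q2E//; exact: measurable_itv.
Qed.

(* The customers reneging at time t are those with deadline t. In excess of R2,
   they would still be in the queue Q2 at their deadline, which would give the
   atomless measure alpha t an atom at t. *)
Lemma reneging_le Q1 Q2 nu1 nu2 K1 K2 Ren1 Ren2 u e :
  FME g Q1 nu1 K1 Ren1 Q0 nu0 alpha -> FME g Q2 nu2 K2 Ren2 Q0 nu0 alpha ->
  same_controls K1 Ren1 K2 Ren2 u -> 0 <= u ->
  (forall t, u <= t -> t <= u + e -> K1 t = K2 t) ->
  window_at alpha Q1 K1 Ren1 u e ->
  (forall t, u <= t -> t <= u + e -> 0 < total_queue Q1 t) ->
  forall t, u <= t -> t < u + e -> Ren1 t <= Ren2 t.
Proof.
move=> sol1 sol2 same u0 K12 win qpos t ut te; rewrite leNgt; apply/negP => R12.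
have [[_ _ _ RC1] _] := sol1; have [[_ _ _ RC2] _] := sol2.
have [Rc1 _ Rnd1] := RC1; have [Rc2 _ Rnd2] := RC2.
have [_ Ru] := same u u0 (lexx u).
have fc : cont_path (Ren1 \- Ren2) by exact: cont_pathB.
have fu : (Ren1 \- Ren2) u <= 0 by rewrite /= Ru subrr.
have [v [uv vt fv fpos]] := last_nonpos_time fc u0 ut fu.
have v0 := le_trans u0 uv.
(* [Ren1] increases on ]v, t], since it exceeds the nondecreasing [Ren2] at [t] but not at [v];
   hence some time there satisfies the almost everywhere condition on the support. *)
have [tau [vtau taut suptau]] : exists tau, [/\ v < tau, tau <= t & inf_support (Q1 tau) = tau%:E].
  apply: contrapT => none.
  have := stieltjes_ae_const (Cup_Dup RC1) (reneging_ae sol1) v0 vt.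
  have R1v : Ren1 v <> Ren1 t.
    by move=> E; have := Rnd2 v t v0 vt; move: fv; rewrite /= E; lra.
  move=> H; apply: R1v; apply: H => r /andP[vr rt] Hr; apply: none; exists r; split => //.
  by apply: Hr; exact: le_trans (ltW vr).
have utau := le_lt_trans uv vtau; have tau0 := le_lt_trans u0 utau.
have taue := le_lt_trans taut te.
have dpos := fpos tau vtau taut; rewrite /= in dpos.
pose psi1 x := mass_upto alpha x \- (fun s => K1 s + Ren1 s).
(* Q1[0, x] is positive at [tau] and its driving path is nonincreasing, so it was positive on all of
   ]u, tau] and its regulator is flat. The regulator of Q2[0, x] can only push up. Since the two
   masses agree at [u] and the entries agree, Q2[0, x] exceeds Q1[0, x] at [tau] by at least the
   reneging difference. *)
have key x : tau < x -> x <= u + e -> Ren1 tau - Ren2 tau <= mass_upto Q2 x tau.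
  move=> tx xe; have x0 : 0 <= x := le_trans (ltW tau0) (ltW tx).
  have ytau : 0 < mass_upto Q1 x tau := inf_support_mass suptau tx.
  have [eta1 [r1 _]] := solution_reflection hlambda halpha sol1 x0.
  have [eta2 [r2 _]] := solution_reflection hlambda halpha sol2 x0.
  have pc1 := psi_cont hlambda halpha sol1 x0.
  have dec s r : u <= s -> s <= r -> r <= tau -> psi1 x r <= psi1 x s.
    move=> us sr rtau; apply: win => //; first exact: le_trans rtau (ltW taue).
    move=> t' st' t'r; apply: qpos; first exact: le_trans us (ltW st').
    exact: le_trans t'r (le_trans rtau (ltW taue)).
  have y1pos r : u < r -> r <= tau -> 0 < mass_upto Q1 x r.
    move=> ur rtau; rewrite ltNge; apply/negP => y0.
    have := reflection_le pc1 r1 (le_trans u0 (ltW ur)) rtau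
      (fun s r' rs sr' r't => dec s r' (le_trans (ltW ur) rs) sr' r't).
    rewrite leNgt => /negP; apply; apply: le_lt_trans ytau.
    have := dec r tau (ltW ur) rtau (lexx _); rewrite /psi1 => ?.
    by rewrite /pos_part ge_max lexx andbT; lra.
  have [E1 _ _ _ flat] := r1.
  have eta1E := flat u tau u0 (ltW utau) y1pos.
  have y2 := reflection_ge r2 u0 (ltW utau).
  have yu := same_controls_queue sol1 sol2 same x0 u0.
  have [Ku _] := same u u0 (lexx u).
  have Ktau := K12 tau (ltW utau) (ltW taue).
  move: ytau y2; rewrite -yu !E1// ?(ltW tau0)// eta1E /= Ku Ktau Ru; lra.
have [[_ _ [_ aat] _] _] := hdata.
(* All mass of [Q2] on [0, x] sits in ]x', x], as deadlines before [tau] have been cleared, and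
   there it is at most the mass of alpha_tau. *)
have := atomless_thin (aat tau (ltW tau0)) tau0 taue (e := Ren1 tau - Ren2 tau).
rewrite leNgt dpos => /(_ _)/negP; apply => // x x' x'0 x't tx xe.
apply: le_trans (key x tx xe) _.
have := queue_increment_le sol2 x'0 (ltW (lt_trans x't tx)) (ltW tau0).
by rewrite (queue_left_null sol2 (ltW tau0) x't) subr0.
Qed.

Lemma pos_near (f : R -> R) u : cont_path f -> 0 <= u -> 0 < f u ->
  exists2 d, 0 < d & forall t, u <= t -> t <= u + d -> 0 < f t.
Proof.
move=> fc u0 fu; have [d d0 H] := cont_path_ltP fc u0 fu.
exists (d / 2); first by rewrite divr_gt0.
move=> t ut td; have t0 := le_trans u0 ut.
have : `|u - t| < d by rewrite ltr_norml; apply/andP; split; lra.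
by move=> /(H t t0); rewrite ltr_norml => /andP[_]; lra.
Qed.

(** With equal arrivals and equal reneging, k1 - k2 = q2 - q1. The strictly longer queue is
    positive, so its system has all servers busy. *)
Let opposite_signs (q1 q2 k1 k2 r E b1 b2 : R) : E = q1 + k1 + r -> E = q2 + k2 + r ->
  (q2 < q1 -> b2 <= b1) -> (q1 < q2 -> b1 <= b2) -> (k1 - k2) * (b1 - b2) <= 0.
Proof.
move=> E1 E2 H1 H2; have -> : k1 - k2 = q2 - q1 by lra.
have [q12|q21|->] := ltgtP q1 q2; last by rewrite subrr mul0r.
  by rewrite mulr_ge0_le0 ?subr_ge0 ?(ltW q12)// subr_le0 H2.
by rewrite mulr_le0_ge0 ?subr_le0 ?(ltW q21)// subr_ge0 H1.
Qed.

Variables (Q1 Q2 : R -> measOn (@Rplus R)) (nu1 nu2 : R -> measOn (ages G)).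
Variables (K1 K2 Ren1 Ren2 : R -> R).
Hypotheses (sol1 : FME g Q1 nu1 K1 Ren1 Q0 nu0 alpha).
Hypotheses (sol2 : FME g Q2 nu2 K2 Ren2 Q0 nu0 alpha).

Let nu01 : (nu0 setT <= 1)%E. Proof. by case: hdata => -[]. Qed.

Lemma same_controls_extend u : 0 <= u -> same_controls K1 Ren1 K2 Ren2 u ->
  exists2 e, 0 < e & same_controls K1 Ren1 K2 Ren2 (u + e).
Proof.
move=> u0 same.
have sd1 := solution_dynamics sol1; have sd2 := solution_dynamics sol2.
have [e1 e10 w1] := window_exists hG hlambda hpi hAB hdata halpha sol1 u0.
have [e2 e20 w2] := window_exists hG hlambda hpi hAB hdata halpha sol2 u0.
have [e3 e30 Ae3] := ages_pos hG.
pose e := Num.min e1 (Num.min e2 e3).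
have e0 : 0 < e by rewrite !lt_min e10 e20.
have ee1 : e <= e1 by rewrite /e ge_min lexx.
have ee2 : e <= e2 by rewrite /e !ge_min lexx !orbT.
have ee3 : e <= e3 by rewrite /e !ge_min lexx !orbT.
have agesle d : 0 <= d -> d <= e -> ages G d.
  by move=> d0 de; apply: (ages_itv Ae3); rewrite /= in_itv/= d0 (le_trans de).
have Ksame s : 0 <= s -> s <= u -> K1 s = K2 s by move=> s0 su; have [] := same s s0 su.
have q0E := same_initial_queue sol1 sol2.
have bal1 t := @solution_balance _ _ _ _ _ _ _ _ _ _ sol1 t.
have bal2 t := @solution_balance _ _ _ _ _ _ _ _ _ _ sol2 t.
have sq1 := @solution_queue _ _ _ _ _ _ _ _ _ _ sol1.
have sq2 := @solution_queue _ _ _ _ _ _ _ _ _ _ sol2.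
have quE : total_queue Q1 u = total_queue Q2 u.
  have := bal1 u u0; have := bal2 u u0; rewrite q0E.
  by have [-> ->] := same u u0 (lexx u); lra.
have q1ge0 t : 0 <= total_queue Q1 t by exact: fine_ge0.
have q2ge0 t : 0 <= total_queue Q2 t by exact: fine_ge0.
have signs t : 0 <= t -> Ren1 t = Ren2 t ->
    (K1 t - K2 t) * (pairing (cst 1) (nu1 t) - pairing (cst 1) (nu2 t)) <= 0.
  move=> t0 Rt; have E1 := bal1 t t0; have E2 := bal2 t t0; rewrite q0E Rt in E1.
  apply: (opposite_signs E1 E2) => q12.
    rewrite (busy_full sq1 t0); first exact: (busy_le1 sd2 t0).
    exact: le_lt_trans (q2ge0 t) q12.
  rewrite (busy_full sq2 t0); first exact: (busy_le1 sd1 t0).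
  exact: le_lt_trans (q1ge0 t) q12.
have [qu0|] := eqVneq (total_queue Q1 u) 0.
  (* Half the window, since the absence of reneging is known only strictly before u + e. *)
  pose d := e / 2; have d0 : 0 < d by rewrite divr_gt0.
  have de : d < e by rewrite ltr_pdivrMr// ltr_pMr// ltr1n.
  have Rd t : u <= t -> t <= u + d -> Ren1 t = Ren2 t.
    move=> ut td; have te : t < u + e by apply: le_lt_trans td _; rewrite ltrD2l.
    rewrite (empty_queue_no_reneging hlambda halpha sol1 u0 (w1 e ee1) qu0 ut te).
    rewrite quE in qu0.
    rewrite (empty_queue_no_reneging hlambda halpha sol2 u0 (w2 e ee2) qu0 ut te).
    by have [] := same u u0 (lexx u).
  exists d => // s s0 sd; split.
    apply: (entries_unique hG nu01 sd1 sd2 u0 (ltW d0) _ Ksame) => //.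
      by apply: agesle; exact: ltW.
    by move=> t ut td; apply: signs; [exact: le_trans ut|exact: Rd].
  by have [su|us] := leP s u; [have [] := same s s0 su|apply: Rd => //; exact: ltW].
rewrite neq_lt ltNge q1ge0/= => qu.
have [d1 d10 q1pos] := pos_near (solution_queue_cont sol1) u0 qu.
have qu2 : 0 < total_queue Q2 u by rewrite -quE.
have [d2 d20 q2pos] := pos_near (solution_queue_cont sol2) u0 qu2.
pose f := Num.min e (Num.min d1 d2).
have f0 : 0 < f by rewrite lt_min e0 lt_min d10.
have fe : f <= e by rewrite /f ge_min lexx.
have fd1 : f <= d1 by rewrite /f !ge_min lexx !orbT.
have fd2 : f <= d2 by rewrite /f !ge_min lexx !orbT.
have q1f t : u <= t -> t <= u + f -> 0 < total_queue Q1 t.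
  by move=> ut tf; apply: q1pos => //; apply: le_trans tf _; rewrite lerD2l.
have q2f t : u <= t -> t <= u + f -> 0 < total_queue Q2 t.
  by move=> ut tf; apply: q2pos => //; apply: le_trans tf _; rewrite lerD2l.
have Kf s : 0 <= s -> s <= u + f -> K1 s = K2 s.
  apply: (entries_unique hG nu01 sd1 sd2 u0 (ltW f0) _ Ksame).
    by apply: agesle => //; exact: ltW.
  (* Both queues are positive, so both busy masses are 1 and the sign condition holds with value
     0. *)
  move=> t ut tf; have t0 := le_trans u0 ut.
  by rewrite (busy_full sq1 t0 (q1f t ut tf)) (busy_full sq2 t0 (q2f t ut tf)) subrr mulr0.
have wf1 := w1 f (le_trans fe ee1); have wf2 := w2 f (le_trans fe ee2).
have same' : same_controls K2 Ren2 K1 Ren1 u.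
  by move=> s s0 su; have [-> ->] := same s s0 su.
exists (f / 2); first by rewrite divr_gt0.
have ff : f / 2 < f by rewrite ltr_pdivrMr// ltr_pMr// ltr1n.
move=> s s0 sf; have sf' : s < u + f by apply: le_lt_trans sf _; rewrite ltrD2l.
split; first by apply: Kf => //; exact: ltW.
have [su|us] := leP s u; first by have [] := same s s0 su.
apply/eqP; rewrite eq_le; apply/andP; split.
  apply: (reneging_le sol1 sol2 same u0 _ wf1 q1f (ltW us) sf') => t ut.
  exact: Kf (le_trans u0 ut).
apply: (reneging_le sol2 sol1 same' u0 _ wf2 q2f (ltW us) sf') => t ut tf.
by rewrite Kf// (le_trans u0 ut).
Qed.

(** The times of agreement form an interval from 0, closed by continuity of the controls, and
    agreement up to its supremum extends beyond it. *)
Lemma controls_unique t : 0 <= t -> same_controls K1 Ren1 K2 Ren2 t.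
Proof.
move=> t0; pose S := [set u | 0 <= u <= t /\ same_controls K1 Ren1 K2 Ren2 u].
have S0 : S 0.
  rewrite /S/= lexx t0; split => // s s0 s1.
  have -> : s = 0 by apply/eqP; rewrite eq_le s1.
  by have [-> ->] := solution_K_Ren0 sol1; have [-> ->] := solution_K_Ren0 sol2.
have hS : has_sup S by split; [exists 0|exists t => u [/andP[]]].
pose u := sup S; have u0 : 0 <= u by apply: ub_le_sup => //; case: hS.
have ut : u <= t by apply: ge_sup; [exists 0|move=> r [/andP[]]].
have below s : 0 <= s -> s < u -> K1 s = K2 s /\ Ren1 s = Ren2 s.
  move=> s0 su; have us : 0 < u - s by rewrite subr_gt0.
  have [r [/andP[r0 rt] Sr] sr] := sup_adherent us hS.
  by apply: Sr => //; move: sr; rewrite /u; lra.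
have closed (f1 f2 : R -> R) : cont_path f1 -> cont_path f2 ->
    (forall s, 0 <= s -> s < u -> f1 s = f2 s) -> f1 0 = f2 0 -> f1 u = f2 u.
  move=> c1 c2 f12 f0; move: (u0); rewrite le_eqVlt => /predU1P[<-//|u0'].
  apply/eqP; rewrite -subr_eq0 -normr_le0; apply/ler_addgt0Pr => e e0; rewrite add0r.
  have [d d0 H] := cont_path_ltP (cont_pathB c1 c2) u0 e0.
  pose s := Num.max 0 (u - d / 2).
  have s0 : 0 <= s by rewrite /s le_max lexx.
  have su : s < u by rewrite /s gt_max u0' ltrBlDr ltrDl divr_gt0.
  have sd : u - d / 2 <= s by rewrite /s le_max lexx orbT.
  have : `|u - s| < d by rewrite ltr_norml; apply/andP; split; lra.
  by move=> /(H s s0); rewrite /= (f12 s s0 su) subrr subr0 => /ltW.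
have [[_ _ [Kc1 _ _] [Rc1 _ _]] _] := sol1; have [[_ _ [Kc2 _ _] [Rc2 _ _]] _] := sol2.
have [K10 R10] := solution_K_Ren0 sol1; have [K20 R20] := solution_K_Ren0 sol2.
have same : same_controls K1 Ren1 K2 Ren2 u.
  move=> s s0; rewrite le_eqVlt => /predU1P[->|]; last exact: below.
  split; apply: closed => //; rewrite ?K10 ?K20 ?R10 ?R20//.
    by move=> r r0 ru; have [] := below r r0 ru.
  by move=> r r0 ru; have [] := below r r0 ru.
have [e e0 sameE] := same_controls_extend u0 same.
suff -> : t = u by [].
apply/eqP; rewrite eq_le ut andbT leNgt; apply/negP => ult.
pose r := Num.min t (u + e).
have ur : u < r by rewrite /r lt_min ult ltrDl.
have : S r.
  split; first by rewrite (le_trans u0 (ltW ur)) /r ge_min lexx.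
  by move=> s s0 sr; apply: sameE => //; apply: le_trans sr _; rewrite /r ge_min lexx orbT.
move=> /(ub_le_sup (proj2 hS)); rewrite -/u => ru.
by move: (lt_le_trans ur ru); rewrite ltxx.
Qed.

Lemma queue_law_unique t : 0 <= t -> measure_eq (Q1 t) (Q2 t).
Proof.
move=> t0; apply: measure_eq_closed_rays => x.
have mR : measurable (Rplus : set (measurableTypeR R)) by exact: measurable_itv.
have mx : measurable (`]-oo, x]%classic : set (measurableTypeR R)) by exact: measurable_itv.
rewrite -!(measOn_setI mR _ mx).
have [x0|x0] := leP 0 x; last first.
  rewrite (_ : _ `&` _ = set0) ?measure0//; apply/seteqP; split => y //=.
  rewrite /Rplus/= !in_itv/= andbT => -[yx y0].
  by move: (le_lt_trans (le_trans y0 yx) x0); rewrite ltxx.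
rewrite (_ : _ `&` _ = `[0, x]%classic); last first.
  by apply/seteqP; split => y; rewrite /Rplus/= !in_itv/= andbT;
    [move=> [-> ->]|move=> /andP[-> ->]].
have := same_controls_queue sol1 sol2 (controls_unique t0) x0 t0.
by move=> H; rewrite (measOn_itvE (Q1 t) `[0, x]) (measOn_itvE (Q2 t) `[0, x]); congr EFin; exact: H.
Qed.

End two_solutions.

Theorem theorem3p1 (R : realType) (G g lambda : R -> R)
    (pi : probability (measurableTypeR R) R)
    (hG : service_cdf G g) (hreg : hazard_regular G g)
    (hlambda : arrival_rate lambda) (hpi : patience_law pi)
    (Q0 : measOn (@Rplus R)) (nu0 : measOn (ages G))
    (alpha : R -> measOn (@Rplus R)) (X0 : R)
    (hAB : assumptionA g nu0 \/ assumptionB pi)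
    (hdata : initial_data Q0 nu0 alpha X0)
    (halpha : arrival_process Q0 lambda pi alpha)
    (Q1 Q2 : R -> measOn (@Rplus R)) (nu1 nu2 : R -> measOn (ages G))
    (K1 K2 Ren1 Ren2 : R -> R)
    (sol1 : FME g Q1 nu1 K1 Ren1 Q0 nu0 alpha)
    (sol2 : FME g Q2 nu2 K2 Ren2 Q0 nu0 alpha) :
  forall t : R, 0 <= t ->
    [/\ measure_eq (Q1 t) (Q2 t), measure_eq (nu1 t) (nu2 t),
        K1 t = K2 t & Ren1 t = Ren2 t].
Proof.
move=> t t0; have same := controls_unique hG hlambda hpi hAB hdata halpha sol1 sol2 t0.
have [Kt Rt] := same t t0 (lexx t); split => //.
  exact: (queue_law_unique hG hlambda hpi hAB hdata halpha sol1 sol2 t0).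
have [[_ nu01 _ _] _] := hdata.
apply: (ages_law_unique hG nu01 (solution_dynamics sol1) (solution_dynamics sol2) t0).
by move=> s s0 st; have [] := same s s0 st.
Qed.
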